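(* Let $\mathbb{T}=\mathbb{R}^2/\mathbb{Z}^2$ with global coordinates $(x,y)$ and fiber coordinates $(\xi_x,\xi_y)$, let $0\le\varepsilon<1$, and let $F_\varepsilon$ be the Katok--Ziller metric $$F_\varepsilon(x,y;\xi_x,\xi_y)=\frac{1}{1-\varepsilon^2}\left(\sqrt{\xi_x^2+(1-\varepsilon^2)\xi_y^2}-\varepsilon\,\xi_x\right).$$ Then the Finsler--Laplace operator of $F_\varepsilon$ is $$\Delta^{F_\varepsilon}=\frac{2(1-\varepsilon^2)}{1+\sqrt{1-\varepsilon^2}}\left(\sqrt{1-\varepsilon^2}\,\frac{\partial^2}{\partial x^2}+\frac{\partial^2}{\partial y^2}\right),$$ and the spectrum (of $-\Delta^{F_\varepsilon}$) is the set of $\lambda_{(p,q)}$, $(p,q)\in\mathbb{Z}^2$, given by $$\lambda_{(p,q)}=4\pi^2\,\frac{2(1-\varepsilon^2)}{1+\sqrt{1-\varepsilon^2}}\left(\sqrt{1-\varepsilon^2}\,p^2+q^2\right).$$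
   Context: A Finsler metric on an $n$-manifold $M$ is a continuous function $F\colon TM\to[0,\infty)$ that is $C^\infty$ off the zero section, satisfies $F(x,\lambda v)=\lambda F(x,v)$ for $\lambda>0$, $F(x,v)\ge 0$ with equality iff $v=0$, and is strongly convex: $\left(\frac{\partial^2F^2}{\partial v_i\partial v_j}\right)$ is positive definite off the zero section. Let $HM=(TM\smallsetminus\{0\})/\mathbb{R}^+_*$, $r\colon TM\smallsetminus\{0\}\to HM$, $\pi\colon HM\to M$ the projections, $VHM=\ker d\pi$. The Hilbert form is $A_{(x,\xi)}(Z)=\lim_{\epsilon\to0}\frac1\epsilon(F(x,v+\epsilon\,d\pi(Z))-F(x,v))$ for $r(x,v)=(x,\xi)$; it is a contact form whose Reeb field $X$ ($A(X)=1$, $i_XdA=0$) generates the geodesic flow on $HM$. There are a unique volume form $\Omega^F$ on $M$ and an $(n-1)$-form $\alpha^F$ on $HM$, nowhere zero and unique on $VHM$, with $\alpha^F\wedge\pi^*\Omega^F=A\wedge dA^{n-1}$ and $\int_{H_xM}\alpha^F=\mathrm{vol}_{\mathrm{Eucl}}(\mathbb{S}^{n-1})$ for all $x$. The Finsler--Laplace operator is $\Delta^Ff(x)=\frac{n}{\mathrm{vol}_{\mathrm{Eucl}}(\mathbb{S}^{n-1})}\int_{H_xM}L_X^2(\pi^*f)\,\alpha^F$. $F_\varepsilon$ is the Katok--Ziller metric associated with the standard flat metric and the Killing field $\partial/\partial x$. *)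

(* Defs.v *)
(* The torus T = R^2/Z^2 is handled through its universal cover: functions and
   forms on T are Z^2-periodic ones on R^2.  Since the tangent bundle is
   trivial, TM is T x R^2, and HM = (TM minus 0)/R_+^* is T x (R/2piZ), the
   point ((x,y),th) standing for the ray at (x,y) spanned by (cos th, sin th). *)
From Stdlib Require Import Reals ZArith ClassicalEpsilon.
From Coquelicot Require Import Coquelicot.
Open Scope R_scope.

Definition R2 : Type := (R * R)%type.
Definition HT : Type := (R2 * R)%type.

Definition ddir {V : NormedModule R_AbsRing} (f : V -> R) (m v : V) : R :=
  Derive (fun t : R => f (plus m (scal t v))) 0.

(* C^k on an open subset U of a finite-dimensional space V, by iterating
   directional derivatives. *)
Fixpoint Ck {V : NormedModule R_AbsRing} (k : nat) (U : V -> Prop) (f : V -> R)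
  : Prop :=
  (forall m, U m -> continuous f m) /\
  match k with
  | O => True
  | S j => forall v : V,
      (forall m, U m -> ex_derive (fun t : R => f (plus m (scal t v))) 0) /\
      Ck j U (fun m => ddir f m v)
  end.

Definition smooth_on {V : NormedModule R_AbsRing} (U : V -> Prop) (f : V -> R)
  : Prop := forall k, Ck k U f.

Definition periodicT {A : Type} (f : R2 -> A) : Prop :=
  forall x y, f (x + 1, y) = f (x, y) /\ f (x, y + 1) = f (x, y).

Definition smoothT (f : R * R -> R) : Prop :=
  periodicT f /\ smooth_on (fun _ => True) f.

(* F q v is the value at the tangent vector v at q. *)
Definition hess_F2 (F : R2 -> R2 -> R) (q v u w : R * R) : R :=
  ddir (fun v' => ddir (fun v'' => F q v'' ^ 2) v' u) v w.

Record finsler (F : R * R -> R * R -> R) : Prop := {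
  finsler_periodic : periodicT F;
  finsler_continuous :
    forall p : (R * R) * (R * R), continuous (fun p => F (fst p) (snd p)) p;
  finsler_smooth :
    smooth_on (fun p : (R * R) * (R * R) => snd p <> (0, 0))
      (fun p => F (fst p) (snd p));
  finsler_homogeneous :
    forall q v (l : R), 0 < l -> F q (scal l v) = l * F q v;
  finsler_nonneg : forall q v, 0 <= F q v;
  finsler_eq0 : forall q v, F q v = 0 <-> v = (0, 0);
  finsler_convex :
    forall q v, v <> (0, 0) ->
    forall a b : R, (a, b) <> (0, 0) ->
      0 < hess_F2 F q v (1, 0) (1, 0) * (a * a)
          + hess_F2 F q v (1, 0) (0, 1) * (a * b)
          + hess_F2 F q v (0, 1) (1, 0) * (b * a)
          + hess_F2 F q v (0, 1) (0, 1) * (b * b)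
}.

(* On HM, d pi is the first projection.  By homogeneity of F the derivative
   does not depend on the vector chosen on the ray; the unit one is used. *)
Definition hilbert (F : R * R -> R * R -> R) (m Z : HT) : R :=
  ddir (F (fst m)) (cos (snd m), sin (snd m)) (fst Z).

(* Exterior derivative of a 1-form on HM, the tangent vectors Z and W being
   extended to constant (hence commuting) fields. *)
Definition extd (A : HT -> HT -> R) (m Z W : R * R * R) : R :=
  ddir (fun m' => A m' W) m Z - ddir (fun m' => A m' Z) m W.

Definition wedge12 (a : HT -> HT -> R) (b : HT -> HT -> HT -> R)
  (m Z1 Z2 Z3 : HT) : R :=
  a m Z1 * b m Z2 Z3 - a m Z2 * b m Z1 Z3 + a m Z3 * b m Z1 Z2.

Definition is_reeb (F : R * R -> R * R -> R) (X : HT -> HT) : Prop :=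
  forall m, hilbert F m (X m) = 1 /\
            forall W, extd (hilbert F) m (X m) W = 0.

Definition reeb (F : R * R -> R * R -> R) : HT -> HT :=
  epsilon (inhabits (fun m => m)) (is_reeb F).

Definition form1_HT (a : HT -> HT -> R) : Prop :=
  (forall m (Z W : R * R * R) (c : R),
     a m (plus (scal c Z) W) = c * a m Z + a m W) /\
  (forall Z : R * R * R,
     smooth_on (fun _ : R * R * R => True) (fun m => a m Z)) /\
  (forall th, periodicT (fun q => a (q, th))) /\
  (forall q th, a (q, th + 2 * PI) = a (q, th)).

(* The volume form rho dx /\ dy pulled back to HM. *)
Definition pull_vol (rho : R * R -> R) (m Z W : HT) : R :=
  rho (fst m) * (fst (fst Z) * snd (fst W) - snd (fst Z) * fst (fst W)).

Definition vol_S1 : R := 2 * PI.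

(* The pair (Omega, alpha), with Omega = rho dx /\ dy, in dimension n = 2.
   Fibers of HM are oriented by d th; the opposite choice replaces
   (Omega, alpha) by (- Omega, - alpha) and does not affect the integrals of
   alpha over the fibers, nor the Laplacian.  With this orientation rho turns
   out to be negative, so only its absolute value is used as a density. *)
Definition is_angle_volume (F : R * R -> R * R -> R)
  (p : (R * R -> R) * (HT -> HT -> R)) : Prop :=
  let rho := fst p in
  let alpha := snd p in
  (smoothT rho /\ forall q, rho q <> 0) /\
  form1_HT alpha /\
  (forall m Z : R * R * R, fst Z = (0, 0) -> Z <> (0, 0, 0) -> alpha m Z <> 0) /\
  (forall m Z1 Z2 Z3,
     wedge12 alpha (pull_vol rho) m Z1 Z2 Z3 =
     wedge12 (hilbert F) (extd (hilbert F)) m Z1 Z2 Z3) /\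
  (forall q, is_RInt (fun th => alpha (q, th) (0, 0, 1)) 0 (2 * PI) vol_S1).

Definition angle_volume (F : R * R -> R * R -> R)
  : (R * R -> R) * (HT -> HT -> R) :=
  epsilon (inhabits (fun _ => 0, fun _ _ => 0)) (is_angle_volume F).

Definition vol_density (F : R * R -> R * R -> R) (q : R * R) : R :=
  Rabs (fst (angle_volume F) q).

Definition angle_form (F : R * R -> R * R -> R) : HT -> HT -> R :=
  snd (angle_volume F).

Definition lie (X : HT -> HT) (g : HT -> R) (m : R * R * R) : R :=
  ddir g m (X m).

Definition finsler_laplacian (F : R * R -> R * R -> R) (f : R * R -> R)
  (q : R * R) : R :=
  2 / vol_S1 *
  RInt (fun th =>
          lie (reeb F) (lie (reeb F) (fun m => f (fst m))) (q, th)
          * angle_form F (q, th) (0, 0, 1))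
       0 (2 * PI).

Definition smoothTC (f : R * R -> C) : Prop :=
  smoothT (fun q => fst (f q)) /\ smoothT (fun q => snd (f q)).

(* - Delta^F - lam on complex-valued functions. *)
Definition shifted_op (F : R * R -> R * R -> R) (lam : C) (f : R * R -> C)
  (q : R * R) : C :=
  (- (finsler_laplacian F (fun q => fst (f q)) q,
      finsler_laplacian F (fun q => snd (f q)) q) - lam * f q)%C.

Definition L2norm (F : R * R -> R * R -> R) (f : R * R -> C) : R :=
  sqrt (RInt (fun x =>
          RInt (fun y => Cmod (f (x, y)) ^ 2 * vol_density F (x, y)) 0 1) 0 1).

Definition eigenvalue (F : R * R -> R * R -> R) (lam : C) : Prop :=
  exists f, smoothTC f /\ (exists q, f q <> 0%C) /\
            forall q, shifted_op F lam f q = 0%C.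

(* Regular value of - Delta^F, as a densely defined operator on L^2(T, Omega^F)
   with domain the smooth functions: - Delta^F - lam is injective with
   bounded inverse, and has dense range.  As smooth functions are dense in L^2,
   it suffices to approximate the smooth ones. *)
Definition regular_value (F : R * R -> R * R -> R) (lam : C) : Prop :=
  (exists c : R, 0 < c /\
     forall f, smoothTC f -> c * L2norm F f <= L2norm F (shifted_op F lam f)) /\
  (forall g, smoothTC g -> forall e : R, 0 < e ->
     exists f, smoothTC f /\
       L2norm F (fun q => shifted_op F lam f q - g q)%C < e).

Definition spectrum (F : R * R -> R * R -> R) (lam : C) : Prop :=
  ~ regular_value F lam.

Definition katok_ziller (eps : R) (q v : R * R) : R :=
  1 / (1 - eps ^ 2) *
  (sqrt (fst v ^ 2 + (1 - eps ^ 2) * snd v ^ 2) - eps * fst v).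

Definition lambda_pq (eps : R) (p q : Z) : R :=
  4 * PI ^ 2 * (2 * (1 - eps ^ 2) / (1 + sqrt (1 - eps ^ 2)))
  * (sqrt (1 - eps ^ 2) * IZR p ^ 2 + IZR q ^ 2).

(* Main.v *)
(* On the unit circle the Finsler norm is [(s - eps cos th) / (1 - eps^2)] with
   [s^2 = cos^2 th + (1 - eps^2) sin^2 th], so that
   [(s - eps cos th) (s + eps cos th) = 1 - eps^2].  The Reeb field is the unit
   vector divided by its norm, with no vertical part, because the momentum
   [dF] moves along the vector [(- sin th, cos th) / s^3].  Hence the Laplacian has
   constant coefficients, given by the integrals of [cos^2 / s^2] and
   [sin^2 / s^2] over the circle, the other terms being odd.

   For the spectrum, let [P = - Delta - lam] with [lam] at distance at least [sqrt d]
   from all [lambda_pq].  On trigonometric polynomials, which are uniformly dense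
   by convolution with the kernels [cos (PI t) ^ (2 n)], [P] is diagonal with
   inverse bounded by [1 / sqrt d].  Density of the range is immediate; the lower
   bound [d |f|^2 <= |P f|^2] follows by duality: if [T] approximates [f] and
   [T = P^* h], then [<f, T> = <P f, h> <= (|P f|^2 / d + |T|^2) / 2]. *)
Require Import Defs.
From Stdlib Require Import Reals ZArith ClassicalEpsilon FunctionalExtensionality.
From Stdlib Require Import Lra Lia List.
From Coquelicot Require Import Coquelicot.
Open Scope R_scope.

(** * Smooth elementary functions *)

(** [reeb] and [angle_volume] are choices by [epsilon], so each needs existence together with the
    uniqueness of what is used of it: the whole Reeb field, the volume density, and the value of the
    angle form on the vertical vector. Smoothness is phrased through iterated directional
    derivatives, so linearity of the derivative in the direction has to be derived from continuity
    of the partial derivatives. The duality in the spectral estimate answers one obstacle: uniform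
    closeness of [T] to [f] says nothing about closeness of [P T] to [P f], so the bound on
    trigonometric polynomials does not pass to the limit directly. Moving [P] to the other factor
    takes only integration by parts, and [T] is then compared with [f] alone. A positive gap [d]
    exists for every [lam] that is not an eigenvalue because the eigenvalues tend to infinity: only
    finitely many can come near [lam]. The kernels cos (PI t) ^ (2 n) are nonnegative trigonometric
    polynomials whose masses satisfy a two-term recursion, which makes the rate of convergence
    explicit. *)

Notation NR2 := (prod_NormedModule R_AbsRing R_NormedModule R_NormedModule).
Notation NR4 := (prod_NormedModule R_AbsRing NR2 NR2).
Notation NHT := (prod_NormedModule R_AbsRing NR2 R_NormedModule).

Lemma line_zero {V : NormedModule R_AbsRing} (m v : V) :
  plus m (scal 0 v) = m.
Proof.
  rewrite <- (plus_zero_r m) at 2. f_equal. apply (scal_zero_l v).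
Qed.

Lemma line_continuous {V : NormedModule R_AbsRing} (m v : V) (t : R) :
  continuous (fun t : R => plus m (scal t v)) t.
Proof.
  apply (continuous_plus (fun _ : R => m) (fun t : R => scal t v)).
  - apply continuous_const.
  - apply (continuous_scal_l (fun t : R => t) v). apply continuous_id.
Qed.

Lemma line_locally {V : NormedModule R_AbsRing} (U : V -> Prop) (m v : V) :
  open U -> U m -> locally 0 (fun t : R => U (plus m (scal t v))).
Proof.
  intros HU Hm. apply (line_continuous m v 0).
  rewrite line_zero. now apply HU.
Qed.

(** Openness of [U] keeps short segments from a point of [U] inside [U], so that functions equal on
    [U] also have equal directional derivatives there. *)
Lemma Ck_ext {V : NormedModule R_AbsRing} (k : nat) (U : V -> Prop) :
  open U -> forall f g : V -> R, (forall m, U m -> f m = g m) ->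
  Ck k U f -> Ck k U g.
Proof.
  intros HU. induction k as [|k IH]; intros f g Hfg [Hc Hd]; split.
  - intros m Hm. apply (continuous_ext_loc g f); [|now apply Hc].
    apply (filter_imp U); [|now apply HU]. intros; now apply Hfg.
  - exact I.
  - intros m Hm. apply (continuous_ext_loc g f); [|now apply Hc].
    apply (filter_imp U); [|now apply HU]. intros; now apply Hfg.
  - intros v. destruct (Hd v) as [H1 H2].
    assert (L : forall m, U m -> locally 0
              (fun t : R => f (plus m (scal t v)) = g (plus m (scal t v)))).
    { intros m Hm. generalize (line_locally U m v HU Hm).
      apply filter_imp. intros; now apply Hfg. }
    split.
    + intros m Hm. apply (ex_derive_ext_loc (fun t : R => f (plus m (scal t v)))).
      * now apply L.
      * now apply H1.
    + apply (IH (fun m => ddir f m v)); [|exact H2].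
      intros m Hm. unfold ddir. apply Derive_ext_loc. now apply L.
Qed.

(** A syntactic class closed under directional derivatives: once [elementary_derive] yields a
    derivative in the same class, smoothness follows by induction on the order, without product or
    chain rules for [Ck]. The side conditions are imposed on [U] only. *)
Inductive elementary {V : NormedModule R_AbsRing} (U : V -> Prop) : (V -> R) -> Prop :=
| elementary_const c : elementary U (fun _ => c)
| elementary_plus f g : elementary U f -> elementary U g -> elementary U (fun m => f m + g m)
| elementary_mult f g : elementary U f -> elementary U g -> elementary U (fun m => f m * g m)
| elementary_inv f : elementary U f -> (forall m, U m -> f m <> 0) -> elementary U (fun m => / f m)
| elementary_sqrt f : elementary U f -> (forall m, U m -> 0 < f m) ->
    elementary U (fun m => sqrt (f m))
| elementary_linear (f : V -> R) : is_linear f -> elementary U f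
| elementary_sin f : elementary U f -> elementary U (fun m => sin (f m))
| elementary_cos f : elementary U f -> elementary U (fun m => cos (f m)).

Lemma elementary_continuous {V : NormedModule R_AbsRing} (U : V -> Prop) (f : V -> R) :
  elementary U f -> forall m, U m -> continuous f m.
Proof.
  induction 1; intros m Hm.
  - apply continuous_const.
  - apply (continuous_plus f g); auto.
  - apply (continuous_mult f g); auto.
  - apply (continuous_comp f Rinv); auto. now apply continuous_Rinv, H0.
  - apply (continuous_comp f sqrt); auto. apply continuous_sqrt.
  - now apply (linear_cont f m).
  - apply (continuous_comp f sin); auto. apply continuous_sin.
  - apply (continuous_comp f cos); auto. apply continuous_cos.
Qed.

Lemma elementary_derive {V : NormedModule R_AbsRing} (U : V -> Prop) (f : V -> R) (v : V) :
  elementary U f -> exists g, elementary U g /\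
    forall m, U m -> is_derive (fun t : R => f (plus m (scal t v))) 0 (g m).
Proof.
  induction 1 as [c|f g _ [f' [Ef Hf]] _ [g' [Eg Hg]]
    |f g Ef0 [f' [Ef Hf]] Eg0 [g' [Eg Hg]]
    |f Ef0 [f' [Ef Hf]] Hn|f Ef0 [f' [Ef Hf]] Hp|f Hl
    |f Ef0 [f' [Ef Hf]]|f Ef0 [f' [Ef Hf]]].
  - exists (fun _ => 0). split; [apply elementary_const|].
    intros m _. apply (is_derive_const c).
  - exists (fun m => f' m + g' m). split; [now apply elementary_plus|].
    intros m Hm. apply (is_derive_plus (fun t : R => f (plus m (scal t v)))
      (fun t : R => g (plus m (scal t v)))); auto.
  - exists (fun m => f' m * g m + f m * g' m).
    split; [apply elementary_plus; now apply elementary_mult|].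
    intros m Hm.
    assert (E := is_derive_mult (fun t : R => f (plus m (scal t v)))
      (fun t : R => g (plus m (scal t v))) 0 _ _ (Hf m Hm) (Hg m Hm) Rmult_comm).
    cbv beta in E. now rewrite line_zero in E.
  - exists (fun m => (-1 * f' m) * / (f m * f m)). split.
    { apply elementary_mult; [apply elementary_mult; [apply elementary_const|exact Ef]|].
      apply (elementary_inv U (fun m => f m * f m)); [now apply elementary_mult|].
      intros m Hm. specialize (Hn m Hm). now apply Rmult_integral_contrapositive. }
    intros m Hm. specialize (Hn m Hm).
    assert (E := is_derive_inv (fun t : R => f (plus m (scal t v))) 0 _ (Hf m Hm)).
    cbv beta in E. rewrite line_zero in E. specialize (E Hn).
    replace (-1 * f' m * / (f m * f m)) with (- f' m / f m ^ 2); [exact E|].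
    field. exact Hn.
  - exists (fun m => f' m * / (2 * sqrt (f m))). split.
    { apply elementary_mult; [exact Ef|].
      apply (elementary_inv U (fun m => 2 * sqrt (f m))).
      - apply elementary_mult; [apply elementary_const|now apply elementary_sqrt].
      - intros m Hm. specialize (sqrt_lt_R0 _ (Hp m Hm)). lra. }
    intros m Hm.
    assert (E := is_derive_sqrt (fun t : R => f (plus m (scal t v))) 0 _ (Hf m Hm)).
    cbv beta in E. rewrite line_zero in E. exact (E (Hp m Hm)).
  - exists (fun _ => f v). split; [apply elementary_const|]. intros m _.
    apply (is_derive_ext (fun t : R => f m + t * f v)).
    { intros t. rewrite (linear_plus f Hl), (linear_scal f Hl). reflexivity. }
    auto_derive; [exact I|ring].
  - exists (fun m => f' m * cos (f m)).
    split; [apply elementary_mult; [exact Ef|now apply elementary_cos]|]. intros m Hm.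
    assert (E := is_derive_comp sin (fun t : R => f (plus m (scal t v))) 0 _ _
      (is_derive_sin _) (Hf m Hm)).
    cbv beta in E. now rewrite line_zero in E.
  - exists (fun m => f' m * (-1 * sin (f m))).
    split; [apply elementary_mult; [exact Ef|apply elementary_mult;
      [apply elementary_const|now apply elementary_sin]]|]. intros m Hm.
    assert (E := is_derive_comp cos (fun t : R => f (plus m (scal t v))) 0 _ _
      (is_derive_cos _) (Hf m Hm)).
    cbv beta in E. rewrite line_zero in E.
    replace (-1 * sin (f m)) with (- sin (f m)) by ring. exact E.
Qed.

Lemma elementary_smooth {V : NormedModule R_AbsRing} (U : V -> Prop) (f : V -> R) :
  open U -> elementary U f -> smooth_on U f.
Proof.
  intros HU Ef k. revert f Ef. induction k as [|k IH]; intros f Ef; split.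
  - now apply elementary_continuous.
  - exact I.
  - now apply elementary_continuous.
  - intros v. destruct (elementary_derive U f v Ef) as [g [Eg Hg]]. split.
    + intros m Hm. eexists. now apply Hg.
    + apply (Ck_ext k U HU g); [|now apply IH].
      intros m Hm. symmetry. apply is_derive_unique. now apply Hg.
Qed.

(** Powers, differences and quotients have no constructor, so a function is first rewritten with
    products, constants and inverses; this transfers smoothness back to the original expression. *)
Lemma elementary_ext {V : NormedModule R_AbsRing} (U : V -> Prop) (f g : V -> R) :
  open U -> (forall m, U m -> f m = g m) -> elementary U f -> smooth_on U g.
Proof.
  intros HU Hfg Ef k. apply (Ck_ext k U HU f); [exact Hfg|].
  now apply elementary_smooth.
Qed.

Lemma smooth_on_continuous {V : NormedModule R_AbsRing} (U : V -> Prop) (f : V -> R) :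
  smooth_on U f -> forall m, U m -> continuous f m.
Proof. intros Hf. exact (proj1 (Hf 0%nat)). Qed.

Lemma smooth_on_ddir {V : NormedModule R_AbsRing} (U : V -> Prop) (f : V -> R) (v : V) :
  smooth_on U f -> smooth_on U (fun m => ddir f m v).
Proof. intros Hf k. exact (proj2 (proj2 (Hf (S k)) v)). Qed.

Lemma smooth_on_is_derive {V : NormedModule R_AbsRing} (U : V -> Prop) (f : V -> R)
  (m v : V) :
  smooth_on U f -> U m ->
  is_derive (fun t : R => f (plus m (scal t v))) 0 (ddir f m v).
Proof.
  intros Hf Hm. apply Derive_correct. exact (proj1 (proj2 (Hf 1%nat) v) m Hm).
Qed.

(** * The Katok--Ziller metric is a Finsler metric *)

Lemma one_minus_sq_pos (eps : R) : 0 <= eps -> eps < 1 -> 0 < 1 - eps ^ 2.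
Proof. intros. nra. Qed.

Lemma R2_neq0 (v : R * R) : v <> (0, 0) -> fst v <> 0 \/ snd v <> 0.
Proof.
  destruct v as [x y]; simpl; intros H.
  destruct (Req_dec x 0) as [->|]; [|now left].
  destruct (Req_dec y 0) as [->|]; [|now right]. now elim H.
Qed.

Lemma ellipse_pos (a : R) (v : R * R) :
  0 < a -> v <> (0, 0) -> 0 < fst v ^ 2 + a * snd v ^ 2.
Proof.
  intros Ha Hv.
  assert (P1 := pow2_ge_0 (fst v)). assert (P2 := pow2_ge_0 (snd v)).
  destruct (R2_neq0 v Hv) as [H|H]; specialize (pow2_gt_0 _ H); nra.
Qed.

(** The root is at least [fst v], which exceeds [eps * fst v] when [fst v] is positive; otherwise
    the subtracted term is not positive while the root is. *)
Lemma katok_ziller_pos (eps : R) (v : R * R) : 0 <= eps -> eps < 1 ->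
  v <> (0, 0) ->
  0 < sqrt (fst v ^ 2 + (1 - eps ^ 2) * snd v ^ 2) - eps * fst v.
Proof.
  intros H0 H1 Hv. assert (Ha := one_minus_sq_pos eps H0 H1).
  assert (Hp := ellipse_pos _ v Ha Hv).
  assert (Hs := sqrt_lt_R0 _ Hp).
  assert (Hq := sqrt_sqrt _ (Rlt_le _ _ Hp)).
  set (s := sqrt _) in *.
  destruct (Rle_or_lt (fst v) 0) as [L|L]; [nra|].
  assert (P2 := pow2_ge_0 (snd v)).
  assert (fst v <= s).
  { apply Rsqr_incr_0_var; [unfold Rsqr; nra|lra]. }
  nra.
Qed.

Lemma open_nonzero : open (fun v : R * R => v <> (0, 0)).
Proof.
  apply (open_ext (fun v : R * R => 0 < fst v ^ 2 + 1 * snd v ^ 2)).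
  - intros v; split.
    + intros H E. rewrite E in H. simpl in H. lra.
    + intros H. exact (ellipse_pos 1 v Rlt_0_1 H).
  - apply (open_comp (fun v : R * R => fst v ^ 2 + 1 * snd v ^ 2)
      (fun y => 0 < y)); [|apply open_gt].
    intros p _. apply (elementary_continuous (V := NR2) (fun _ => True)); [|exact I].
    apply elementary_plus; simpl pow; repeat apply elementary_mult; try apply elementary_const;
    apply elementary_linear; try apply is_linear_snd; apply is_linear_fst.
Qed.

Lemma open_nonzero_velocity :
  open (fun p : (R * R) * (R * R) => snd p <> (0, 0)).
Proof.
  apply (open_comp (fun p : (R * R) * (R * R) => snd p) (fun v => v <> (0, 0))).
  - intros p _. apply continuous_snd.
  - exact open_nonzero.
Qed.

Lemma katok_ziller_smooth (eps : R) : 0 <= eps -> eps < 1 ->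
  smooth_on (fun p : (R * R) * (R * R) => snd p <> (0, 0))
      (fun p => katok_ziller eps (fst p) (snd p)).
Proof.
  intros H0 H1. assert (Ha := one_minus_sq_pos eps H0 H1).
  set (U := fun p : (R * R) * (R * R) => snd p <> (0, 0)).
  assert (L1 : elementary (V := NR4) U (fun p => fst (snd p))).
  { apply elementary_linear. apply (is_linear_comp snd fst);
    [apply is_linear_snd|apply is_linear_fst]. }
  assert (L2 : elementary (V := NR4) U (fun p => snd (snd p))).
  { apply elementary_linear. apply (is_linear_comp snd snd); apply is_linear_snd. }
  apply (elementary_ext U (fun p => 1 / (1 - eps ^ 2) *
    (sqrt (fst (snd p) * fst (snd p) + (1 - eps ^ 2) * (snd (snd p) * snd (snd p)))
      + (- eps) * fst (snd p)))).
  - exact open_nonzero_velocity.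
  - intros [q [v1 v2]] _. unfold katok_ziller. cbn [fst snd].
    replace (v1 * v1) with (v1 ^ 2) by ring. replace (v2 * v2) with (v2 ^ 2) by ring.
    ring.
  - apply elementary_mult; [apply elementary_const|].
    apply elementary_plus; [|now apply elementary_mult; [apply elementary_const|]].
    apply elementary_sqrt.
    + apply elementary_plus; [now apply elementary_mult|].
      apply elementary_mult; [apply elementary_const|now apply elementary_mult].
    + intros m Hm. assert (P := ellipse_pos _ _ Ha Hm). simpl in P |- *. lra.
Qed.

Lemma ddir_katok_ziller_sq (eps : R) (q v u : R * R) : 0 <= eps -> eps < 1 ->
  v <> (0, 0) ->
  let s := sqrt (fst v ^ 2 + (1 - eps ^ 2) * snd v ^ 2) in
  ddir (fun v' : R * R => katok_ziller eps q v' ^ 2) v u =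
  2 / (1 - eps ^ 2) ^ 2 * ((s - eps * fst v) *
   ((fst v * fst u + (1 - eps ^ 2) * (snd v * snd u)) / s - eps * fst u)).
Proof.
  intros H0 H1 Hv s. assert (Ha := one_minus_sq_pos eps H0 H1).
  assert (Hp := ellipse_pos _ v Ha Hv). assert (Hs := sqrt_lt_R0 _ Hp). fold s in Hs.
  destruct v as [v1 v2]; destruct u as [u1 u2]. apply is_derive_unique.
  apply (is_derive_ext (fun t : R => (1 / (1 - eps ^ 2) *
    (sqrt ((v1 + t * u1) ^ 2 + (1 - eps ^ 2) * (v2 + t * u2) ^ 2)
     - eps * (v1 + t * u1))) ^ 2)); [reflexivity|].
  cbn [fst snd] in *. set (a := 1 - eps ^ 2) in *.
  auto_derive.
  - replace (v1 + 0 * u1) with v1 by ring. replace (v2 + 0 * u2) with v2 by ring.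
    simpl in Hp |- *. lra.
  - replace (v1 + 0 * u1) with v1 by ring. replace (v2 + 0 * u2) with v2 by ring.
    replace (v1 * (v1 * 1) + a * (v2 * (v2 * 1))) with (v1 ^ 2 + a * v2 ^ 2) by ring.
    fold s. field. lra.
Qed.

Lemma hess_katok_ziller (eps : R) (q v u w : R * R) : 0 <= eps -> eps < 1 ->
  v <> (0, 0) ->
  let a := 1 - eps ^ 2 in
  let s := sqrt (fst v ^ 2 + a * snd v ^ 2) in
  hess_F2 (katok_ziller eps) q v u w =
  2 / a ^ 2 *
  (((fst v * fst u + a * (snd v * snd u)) / s - eps * fst u) *
   ((fst v * fst w + a * (snd v * snd w)) / s - eps * fst w) +
   (s - eps * fst v) * ((fst w * fst u + a * (snd w * snd u)) / s
    - (fst v * fst u + a * (snd v * snd u)) *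
      (fst v * fst w + a * (snd v * snd w)) / s ^ 3)).
Proof.
  intros H0 H1 Hv a s. assert (Ha := one_minus_sq_pos eps H0 H1). fold a in Ha.
  assert (Hp := ellipse_pos _ v Ha Hv). assert (Hs := sqrt_lt_R0 _ Hp). fold s in Hs.
  apply is_derive_unique.
  destruct v as [v1 v2]; destruct u as [u1 u2]; destruct w as [w1 w2].
  apply (is_derive_ext_loc (fun t : R =>
    let s := sqrt ((v1 + t * w1) ^ 2 + a * (v2 + t * w2) ^ 2) in
    2 / a ^ 2 * ((s - eps * (v1 + t * w1)) *
    (((v1 + t * w1) * u1 + a * ((v2 + t * w2) * u2)) / s - eps * u1)))).
  (* The formula for the first derivative is known at nonzero vectors only, so it is used near
     [t = 0], where the segment stays off the origin. *)
  - assert (L := line_locally (V := NR2) _ (v1, v2) (w1, w2) open_nonzero Hv).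
    revert L. apply filter_imp. intros t Ht.
    rewrite ddir_katok_ziller_sq; [reflexivity|assumption..].
  - cbn [fst snd] in *. cbv zeta. auto_derive.
    + replace (v1 + 0 * w1) with v1 by ring. replace (v2 + 0 * w2) with v2 by ring.
      simpl in Hp. repeat split; try lra.
      replace (v1 * (v1 * 1) + a * (v2 * (v2 * 1))) with (v1 ^ 2 + a * v2 ^ 2) by ring.
      fold s. lra.
    + replace (v1 + 0 * w1) with v1 by ring. replace (v2 + 0 * w2) with v2 by ring.
      replace (v1 * (v1 * 1) + a * (v2 * (v2 * 1))) with (v1 ^ 2 + a * v2 ^ 2) by ring.
      fold s. field. lra.
Qed.

(** With [z = (x, y)], the quadratic form is a positive multiple of a sum of two squares. [D] is [s]
    times the derivative along [z] of the numerator of the metric, and [W] is the determinant of [v]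
    and [z]; it enters through the Lagrange identity for the form [x ^ 2 + a * y ^ 2]. The weight of
    [W ^ 2] is positive by [katok_ziller_pos], so only the simultaneous vanishing of [D] and [W] has
    to be excluded. *)
Lemma katok_ziller_convex (eps : R) (q v : R * R) : 0 <= eps -> eps < 1 ->
  v <> (0, 0) -> forall x y : R, (x, y) <> (0, 0) ->
  let F := katok_ziller eps in
  0 < hess_F2 F q v (1, 0) (1, 0) * (x * x)
      + hess_F2 F q v (1, 0) (0, 1) * (x * y)
      + hess_F2 F q v (0, 1) (1, 0) * (y * x)
      + hess_F2 F q v (0, 1) (0, 1) * (y * y).
Proof.
  intros H0 H1 Hv x y Hxy F. unfold F. rewrite !hess_katok_ziller by assumption.
  assert (Ha := one_minus_sq_pos eps H0 H1).
  assert (Hp := ellipse_pos _ v Ha Hv). assert (Hs := sqrt_lt_R0 _ Hp).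
  assert (Hq := sqrt_sqrt _ (Rlt_le _ _ Hp)).
  assert (HF := katok_ziller_pos eps v H0 H1 Hv).
  assert (Hz := ellipse_pos _ _ Ha Hxy).
  assert (Hz1 := ellipse_pos _ _ Rlt_0_1 Hxy).
  set (s := sqrt _) in *. destruct v as [v1 v2]. cbn [fst snd] in *.
  set (D := v1 * x + (1 - eps ^ 2) * (v2 * y) - eps * s * x).
  set (W := v1 * y - v2 * x).
  set (a := 1 - eps ^ 2) in *.
  match goal with |- 0 < ?e => replace e with
    (2 / (a ^ 2 * s ^ 2) * (D ^ 2 + (s - eps * v1) / s * (a * W ^ 2))) end.
  2:{ assert (E : a * W ^ 2 = (s * s) * (x ^ 2 + a * y ^ 2)
        - (v1 * x + a * (v2 * y)) ^ 2) by (rewrite Hq; unfold W; ring).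
      rewrite E. unfold D. field. lra. }
  assert (K : 0 < 2 / (a ^ 2 * s ^ 2)).
  { apply Rdiv_lt_0_compat; [lra|]. apply Rmult_lt_0_compat; apply pow_lt; lra. }
  apply Rmult_lt_0_compat; [exact K|].
  assert (K2 : 0 < (s - eps * v1) / s) by (apply Rdiv_lt_0_compat; lra).
  (* If [W] and [D] both vanish, the Lagrange identity reads [eps ^ 2 * s ^ 2 * x ^ 2 = s ^ 2 * (x ^
     2 + a * y ^ 2)], and [1 - eps ^ 2 = a] then forces [x = y = 0]. *)
  destruct (Req_dec W 0) as [HW|HW].
  - assert (D <> 0).
    { intros HD.
      assert (E : (v1 * x + a * (v2 * y)) ^ 2 + a * W ^ 2
        = (s * s) * (x ^ 2 + a * y ^ 2)) by (rewrite Hq; unfold W; ring).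
      rewrite HW in E.
      replace (v1 * x + a * (v2 * y)) with (eps * s * x) in E
        by (unfold D in HD; lra).
      assert (E2 : s * s * (a * (x ^ 2 + 1 * y ^ 2)) = 0).
      { unfold a in *. lra. }
      apply Rmult_integral in E2. nra. }
    specialize (pow2_gt_0 _ H). rewrite HW. intros. nra.
  - specialize (pow2_gt_0 _ HW). intros P.
    assert (0 < (s - eps * v1) / s * (a * W ^ 2)).
    { apply Rmult_lt_0_compat; [exact K2|]. now apply Rmult_lt_0_compat. }
    specialize (pow2_ge_0 D). lra.
Qed.

Lemma katok_ziller_finsler (eps : R) : 0 <= eps -> eps < 1 ->
  finsler (katok_ziller eps).
Proof.
  intros H0 H1. assert (Ha := one_minus_sq_pos eps H0 H1).
  assert (Hia : 0 < 1 / (1 - eps ^ 2)) by (apply Rdiv_lt_0_compat; lra).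
  assert (Hzero : forall q, katok_ziller eps q (0, 0) = 0).
  { intros q. unfold katok_ziller. cbn [fst snd].
    replace (0 ^ 2 + (1 - eps ^ 2) * 0 ^ 2) with 0 by ring. rewrite sqrt_0. ring. }
  assert (Hpos : forall q v, v <> (0, 0) -> 0 < katok_ziller eps q v).
  { intros q v Hv. apply Rmult_lt_0_compat; [exact Hia|].
    now apply katok_ziller_pos. }
  assert (Hdec : forall v : R * R, v = (0, 0) \/ v <> (0, 0)).
  { intros [x y]. destruct (Req_dec x 0) as [->|]; [destruct (Req_dec y 0) as [->|]|].
    - now left.
    - right. congruence.
    - right. congruence. }
  constructor.
  - intros x y. split; reflexivity.
  - intros p. unfold katok_ziller.
    assert (C1 : continuous (fun p : (R * R) * (R * R) => fst (snd p)) p).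
    { apply (continuous_comp snd fst); [apply continuous_snd|apply continuous_fst]. }
    assert (C2 : continuous (fun p : (R * R) * (R * R) => snd (snd p)) p).
    { apply (continuous_comp snd snd); apply continuous_snd. }
    apply (continuous_mult (fun _ => 1 / (1 - eps ^ 2))
      (fun p => sqrt (fst (snd p) ^ 2 + (1 - eps ^ 2) * snd (snd p) ^ 2)
        - eps * fst (snd p))); [apply continuous_const|].
    apply (continuous_minus
      (fun p => sqrt (fst (snd p) ^ 2 + (1 - eps ^ 2) * snd (snd p) ^ 2))
      (fun p => eps * fst (snd p))).
    (* On the zero section the radicand vanishes, outside the reach of [elementary_sqrt]; here
       continuity of [sqrt] at every real number is used. *)
    + apply (continuous_comp (fun p : (R * R) * (R * R) =>
        fst (snd p) ^ 2 + (1 - eps ^ 2) * snd (snd p) ^ 2) sqrt);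
        [|apply continuous_sqrt].
      apply (elementary_continuous (V := NR4) (fun _ => True)); [|exact I].
      assert (L1 : elementary (V := NR4) (fun _ : (R * R) * (R * R) => True) (fun p => fst (snd p))).
      { apply elementary_linear. apply (is_linear_comp snd fst);
        [apply is_linear_snd|apply is_linear_fst]. }
      assert (L2 : elementary (V := NR4) (fun _ : (R * R) * (R * R) => True) (fun p => snd (snd p))).
      { apply elementary_linear. apply (is_linear_comp snd snd); apply is_linear_snd. }
      simpl pow.
      repeat first [apply elementary_plus|apply elementary_mult|exact L1|exact L2|apply elementary_const].
    + apply (continuous_mult (fun _ => eps) (fun p => fst (snd p)));
        [apply continuous_const|exact C1].
  - now apply katok_ziller_smooth.
  - intros q [x y] l Hl. unfold katok_ziller.
    change (fst (scal l (x, y))) with (l * x). change (snd (scal l (x, y))) with (l * y).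
    cbn [fst snd].
    replace ((l * x) ^ 2 + (1 - eps ^ 2) * (l * y) ^ 2)
      with (l ^ 2 * (x ^ 2 + (1 - eps ^ 2) * y ^ 2)) by ring.
    rewrite sqrt_mult_alt by apply pow2_ge_0. rewrite sqrt_pow2 by lra. ring.
  - intros q v. destruct (Hdec v) as [->|Hv]; [rewrite Hzero; lra|].
    now apply Rlt_le, Hpos.
  - intros q v. split; [|intros ->; apply Hzero].
    intros E. destruct (Hdec v) as [|Hv]; [assumption|].
    specialize (Hpos q v Hv). lra.
  - intros q v Hv x y. now apply katok_ziller_convex.
Qed.

(** * The Reeb field *)

Lemma smooth_partial_x (f : R * R -> R) (x y : R) :
  smooth_on (V := NR2) (fun _ => True) f ->
  is_derive (fun s : R => f (s, y)) x (ddir f (x, y) (1, 0)).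
Proof.
  intros Hf.
  assert (D := smooth_on_is_derive (V := NR2) _ f (x, y) (1, 0) Hf I).
  assert (D1 : is_derive (fun s : R => s - x) x 1) by (auto_derive; trivial; ring).
  replace 0 with (x - x) in D at 1 by ring.
  assert (E := is_derive_comp _ (fun s : R => s - x) x _ _ D D1).
  replace (ddir f (x, y) (1, 0)) with (scal 1 (ddir f (x, y) (1, 0)))
    by apply (Rmult_1_l _).
  refine (is_derive_ext _ _ _ _ _ E). intros t.
  change (f (x + (t - x) * 1, y + (t - x) * 0) = f (t, y)). apply (f_equal f), (f_equal2 pair); ring.
Qed.

Lemma smooth_partial_y (f : R * R -> R) (x y : R) :
  smooth_on (V := NR2) (fun _ => True) f ->
  is_derive (fun s : R => f (x, s)) y (ddir f (x, y) (0, 1)).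
Proof.
  intros Hf.
  assert (D := smooth_on_is_derive (V := NR2) _ f (x, y) (0, 1) Hf I).
  assert (D1 : is_derive (fun s : R => s - y) y 1) by (auto_derive; trivial; ring).
  replace 0 with (y - y) in D at 1 by ring.
  assert (E := is_derive_comp _ (fun s : R => s - y) y _ _ D D1).
  replace (ddir f (x, y) (0, 1)) with (scal 1 (ddir f (x, y) (0, 1)))
    by apply (Rmult_1_l _).
  refine (is_derive_ext _ _ _ _ _ E). intros t.
  change (f (x + (t - y) * 0, y + (t - y) * 1) = f (x, t)). apply (f_equal f), (f_equal2 pair); ring.
Qed.

(** Directional derivatives alone need not be linear in the direction. Here one partial derivative
    exists everywhere and is continuous, the other exists at the point, and together they give
    Frechet differentiability; the chain rule along a line does the rest. *)
Lemma smooth_ddir_linear (f : R * R -> R) (x y u v : R) :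
  smooth_on (V := NR2) (fun _ => True) f ->
  is_derive (fun t : R => f (x + t * u, y + t * v)) 0
    (u * ddir f (x, y) (1, 0) + v * ddir f (x, y) (0, 1)).
Proof.
  intros Hf.
  assert (D1 : is_derive (fun t : R => x + t * u) 0 u)
    by (auto_derive; trivial; ring).
  assert (D2 : is_derive (fun t : R => y + t * v) 0 v)
    by (auto_derive; trivial; ring).
  assert (D : filterdiff (fun p : R * R => f (fst p, snd p))
    (locally (x + 0 * u, y + 0 * v))
    (fun p : R * R => plus (scal (fst p) (ddir f (x, y) (1, 0)))
      (scal (snd p) (ddir f (x, y) (0, 1))))).
  { rewrite !Rmult_0_l, !Rplus_0_r.
    apply (is_derive_filterdiff (fun x y => f (x, y)) x y
      (fun x y => ddir f (x, y) (1, 0))).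
    - apply filter_forall. intros p. now apply smooth_partial_x.
    - now apply smooth_partial_y.
    - apply (continuous_ext (fun p : R * R => ddir f p (1, 0))); [now intros []|].
      apply (smooth_on_continuous (V := NR2) (fun _ => True)); [|exact I].
      now apply (smooth_on_ddir (V := NR2)). }
  assert (E := filterdiff_comp'_2 (fun t : R => x + t * u) (fun t : R => y + t * v)
    (fun p q => f (p, q)) 0 _ _
    (fun p q => plus (scal p (ddir f (x, y) (1, 0)))
      (scal q (ddir f (x, y) (0, 1)))) D1 D2 D).
  refine (filterdiff_ext_lin _ _ _ E _). intros t.
  unfold scal, plus; simpl; unfold mult; simpl. ring.
Qed.

Lemma ddir_linear (f : R * R -> R) (q : R * R) (u v : R) :
  smooth_on (V := NR2) (fun _ => True) f ->
  ddir f q (u, v) = u * ddir f q (1, 0) + v * ddir f q (0, 1).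
Proof.
  intros Hf. destruct q as [x y]. apply is_derive_unique.
  now apply smooth_ddir_linear.
Qed.

Lemma smooth_Derive2_x (f : R * R -> R) (x y : R) :
  smooth_on (V := NR2) (fun _ => True) f ->
  Derive_n (fun s => f (s, y)) 2 x = ddir (fun q : R * R => ddir f q (1, 0)) (x, y) (1, 0).
Proof.
  intros Hf. simpl.
  rewrite (Derive_ext _ (fun s => ddir f (s, y) (1, 0))).
  - apply is_derive_unique.
    apply (smooth_partial_x (fun q : R * R => ddir f q (1, 0))).
    now apply (smooth_on_ddir (V := NR2)).
  - intros t. apply is_derive_unique. now apply smooth_partial_x.
Qed.

Lemma smooth_Derive2_y (f : R * R -> R) (x y : R) :
  smooth_on (V := NR2) (fun _ => True) f ->
  Derive_n (fun s => f (x, s)) 2 y = ddir (fun q : R * R => ddir f q (0, 1)) (x, y) (0, 1).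
Proof.
  intros Hf. simpl.
  rewrite (Derive_ext _ (fun s => ddir f (x, s) (0, 1))).
  - apply is_derive_unique.
    apply (smooth_partial_y (fun q : R * R => ddir f q (0, 1))).
    now apply (smooth_on_ddir (V := NR2)).
  - intros t. apply is_derive_unique. now apply smooth_partial_y.
Qed.

(** * The metric and its momentum on the unit circle *)

Definition kz_s (eps th : R) : R := sqrt (cos th ^ 2 + (1 - eps ^ 2) * sin th ^ 2).

Lemma cos2_sin2 (th : R) : cos th ^ 2 + sin th ^ 2 = 1.
Proof. specialize (sin2_cos2 th). unfold Rsqr. lra. Qed.

Lemma cos_sin_neq0 (th : R) : (cos th, sin th) <> (0, 0).
Proof. intros E. injection E as E1 E2. specialize (cos2_sin2 th). rewrite E1, E2. lra. Qed.

Lemma kz_s_pos (eps th : R) : 0 <= eps -> eps < 1 -> 0 < kz_s eps th.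
Proof.
  intros H0 H1. apply sqrt_lt_R0.
  apply (ellipse_pos _ (cos th, sin th)); [now apply one_minus_sq_pos|].
  apply cos_sin_neq0.
Qed.

Lemma kz_s_sq (eps th : R) : 0 <= eps -> eps < 1 ->
  kz_s eps th ^ 2 = cos th ^ 2 + (1 - eps ^ 2) * sin th ^ 2.
Proof.
  intros H0 H1. unfold kz_s. rewrite pow2_sqrt; [reflexivity|].
  apply Rlt_le, (ellipse_pos _ (cos th, sin th)); [now apply one_minus_sq_pos|].
  apply cos_sin_neq0.
Qed.

Lemma kz_phi_pos (eps th : R) : 0 <= eps -> eps < 1 ->
  0 < kz_s eps th - eps * cos th.
Proof.
  intros H0 H1. apply (katok_ziller_pos eps (cos th, sin th) H0 H1).
  apply cos_sin_neq0.
Qed.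

Lemma is_derive_kz_s (eps th : R) : 0 <= eps -> eps < 1 ->
  is_derive (kz_s eps) th (- eps ^ 2 * (sin th * cos th) / kz_s eps th).
Proof.
  intros H0 H1. assert (Hs := kz_s_pos eps th H0 H1).
  assert (P : 0 < cos th ^ 2 + (1 - eps ^ 2) * sin th ^ 2).
  { apply (ellipse_pos _ (cos th, sin th)); [now apply one_minus_sq_pos|].
    apply cos_sin_neq0. }
  unfold kz_s at 1. auto_derive.
  - simpl in P |- *. lra.
  - replace (cos th * (cos th * 1) + (1 - eps * (eps * 1)) * (sin th * (sin th * 1)))
      with (cos th ^ 2 + (1 - eps ^ 2) * sin th ^ 2) by ring.
    fold (kz_s eps th). field. lra.
Qed.

Lemma is_derive_momentum_x (eps th : R) : 0 <= eps -> eps < 1 ->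
  is_derive (fun th => (cos th / kz_s eps th - eps) / (1 - eps ^ 2)) th
    (- sin th / kz_s eps th ^ 3).
Proof.
  intros H0 H1. assert (Hs := kz_s_pos eps th H0 H1).
  assert (Ha := one_minus_sq_pos eps H0 H1).
  assert (D := is_derive_kz_s eps th H0 H1). assert (Hq := kz_s_sq eps th H0 H1).
  assert (C := cos2_sin2 th).
  evar_last.
  - apply (is_derive_ext (fun th => / (1 - eps ^ 2) * (cos th / kz_s eps th - eps))).
    { intros t. simpl. unfold Rdiv. ring. }
    apply is_derive_scal.
    apply (is_derive_minus (fun th => cos th / kz_s eps th) (fun _ => eps));
      [|apply is_derive_const].
    apply is_derive_div; [apply is_derive_cos|exact D|lra].
  - unfold minus, plus, opp, zero; simpl. simpl in Hq. simpl in C.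
    set (s := kz_s eps th) in *. set (c := cos th) in *. set (n := sin th) in *.
    (* The quotient rule leaves [- n * s ^ 2 + eps ^ 2 * n * c ^ 2] as numerator; it equals
       [- n * (1 - eps ^ 2)] because [s ^ 2 = 1 - eps ^ 2 * n ^ 2]. *)
    replace (- n / (s * (s * (s * 1)))) with
      (((- n) * (1 - eps ^ 2)) / ((1 - eps ^ 2) * (s * s * s)))
      by (field; split; lra).
    replace ((- n) * (1 - eps ^ 2)) with (- n * (s * s) + eps ^ 2 * n * (c * c)).
    2:{ replace (s * s) with (s * (s * 1)) by ring. rewrite Hq.
        replace (c * c) with (1 - n * n) by lra. replace (c * (c * 1)) with (1 - n * n) by lra.
        ring. }
    field. split; lra.
Qed.

Lemma is_derive_momentum_y (eps th : R) : 0 <= eps -> eps < 1 ->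
  is_derive (fun th => sin th / kz_s eps th) th (cos th / kz_s eps th ^ 3).
Proof.
  intros H0 H1. assert (Hs := kz_s_pos eps th H0 H1).
  assert (D := is_derive_kz_s eps th H0 H1). assert (Hq := kz_s_sq eps th H0 H1).
  assert (C := cos2_sin2 th).
  evar_last.
  - apply is_derive_div; [apply is_derive_sin|exact D|lra].
  - simpl in Hq |- *. simpl in C.
    set (s := kz_s eps th) in *. set (c := cos th) in *. set (n := sin th) in *.
    assert (K : s * s + eps ^ 2 * (n * n) = 1).
    { replace (s * s) with (s * (s * 1)) by ring. rewrite Hq.
      replace (c * (c * 1)) with (1 - n * n) by lra. ring. }
    replace (c / (s * (s * (s * 1)))) with (c * (s * s + eps ^ 2 * (n * n)) / (s * s * s))
      by (rewrite K; field; lra).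
    field. lra.
Qed.

(** * The Hilbert form, its exterior derivative and its Reeb field *)

Lemma hilbert_kz (eps : R) (m Z : HT) : 0 <= eps -> eps < 1 ->
  hilbert (katok_ziller eps) m Z =
  (cos (snd m) / kz_s eps (snd m) - eps) / (1 - eps ^ 2) * fst (fst Z) +
  sin (snd m) / kz_s eps (snd m) * snd (fst Z).
Proof.
  intros H0 H1. destruct m as [q th]. destruct Z as [[u v] w].
  assert (Hs := kz_s_pos eps th H0 H1). assert (Ha := one_minus_sq_pos eps H0 H1).
  assert (Hp := ellipse_pos _ (cos th, sin th) Ha (cos_sin_neq0 th)).
  unfold hilbert. apply is_derive_unique. cbn [fst snd] in *.
  apply (is_derive_ext (fun t : R => 1 / (1 - eps ^ 2) *
    (sqrt ((cos th + t * u) ^ 2 + (1 - eps ^ 2) * (sin th + t * v) ^ 2)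
     - eps * (cos th + t * u)))); [reflexivity|].
  auto_derive.
  - rewrite !Rmult_0_l, !Rplus_0_r. simpl in Hp. lra.
  - rewrite !Rmult_0_l, !Rplus_0_r.
    replace (cos th * (cos th * 1) + (1 - eps * (eps * 1)) * (sin th * (sin th * 1)))
      with (cos th ^ 2 + (1 - eps ^ 2) * sin th ^ 2) by ring.
    fold (kz_s eps th). field. simpl in Ha. lra.
Qed.

(** The coefficients of the form depend on the angle only, so just the vertical component of [Z]
    matters, and the momentum derivatives supply the factor in front of it. *)
Lemma ddir_hilbert_kz (eps : R) (m Z W : HT) : 0 <= eps -> eps < 1 ->
  ddir (fun m' : HT => hilbert (katok_ziller eps) m' W) m Z =
  (- sin (snd m) * fst (fst W) + cos (snd m) * snd (fst W))
    / kz_s eps (snd m) ^ 3 * snd Z.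
Proof.
  intros H0 H1. destruct m as [q th]. destruct Z as [Z z].
  destruct W as [[u v] w]. cbn [fst snd].
  assert (Hs := kz_s_pos eps th H0 H1).
  apply is_derive_unique.
  apply (is_derive_ext (fun t : R =>
    (fun th => (cos th / kz_s eps th - eps) / (1 - eps ^ 2) * u
      + sin th / kz_s eps th * v) (th + t * z))).
  { intros t. rewrite hilbert_kz by assumption. reflexivity. }
  evar_last.
  - apply (is_derive_comp (fun th => (cos th / kz_s eps th - eps) / (1 - eps ^ 2) * u
      + sin th / kz_s eps th * v) (fun t : R => th + t * z)).
    + replace (th + 0 * z) with th by ring.
      apply (is_derive_plus (fun th => (cos th / kz_s eps th - eps) / (1 - eps ^ 2) * u)
        (fun th => sin th / kz_s eps th * v)).
      * apply (is_derive_scal_l (V := R_NormedModule)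
          (fun th => (cos th / kz_s eps th - eps) / (1 - eps ^ 2)) th (- sin th / kz_s eps th ^ 3) u).
        now apply is_derive_momentum_x.
      * apply (is_derive_scal_l (V := R_NormedModule) (fun th => sin th / kz_s eps th) th (cos th / kz_s eps th ^ 3) v).
        now apply is_derive_momentum_y.
    + auto_derive; [exact I|reflexivity].
  - unfold scal, plus; simpl; unfold mult; simpl. field. lra.
Qed.

Lemma extd_hilbert_kz (eps : R) (m Z W : HT) : 0 <= eps -> eps < 1 ->
  extd (hilbert (katok_ziller eps)) m Z W =
  (- sin (snd m) * fst (fst W) + cos (snd m) * snd (fst W))
    / kz_s eps (snd m) ^ 3 * snd Z -
  (- sin (snd m) * fst (fst Z) + cos (snd m) * snd (fst Z))
    / kz_s eps (snd m) ^ 3 * snd W.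
Proof. intros H0 H1. unfold extd. now rewrite !ddir_hilbert_kz. Qed.

(* The unit vector at angle [th] divided by its Finsler length, lifted horizontally. *)
Definition kz_reeb (eps : R) (m : HT) : HT :=
  let k := (1 - eps ^ 2) / (kz_s eps (snd m) - eps * cos (snd m)) in
  ((k * cos (snd m), k * sin (snd m)), 0).

(** Euler's relation for a 1-homogeneous function: the differential of the norm at a unit vector,
    applied to that vector, returns its norm. *)
Lemma kz_length (eps th : R) : 0 <= eps -> eps < 1 ->
  (cos th / kz_s eps th - eps) / (1 - eps ^ 2) * cos th
  + sin th / kz_s eps th * sin th = (kz_s eps th - eps * cos th) / (1 - eps ^ 2).
Proof.
  intros H0 H1. assert (Hs := kz_s_pos eps th H0 H1).
  assert (Ha := one_minus_sq_pos eps H0 H1). assert (Hq := kz_s_sq eps th H0 H1).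
  replace (kz_s eps th - eps * cos th) with
    (kz_s eps th ^ 2 / kz_s eps th - eps * cos th) by (field; lra).
  rewrite Hq. field. lra.
Qed.

Lemma kz_reeb_is_reeb (eps : R) : 0 <= eps -> eps < 1 ->
  is_reeb (katok_ziller eps) (kz_reeb eps).
Proof.
  intros H0 H1 [q th]. assert (Hs := kz_s_pos eps th H0 H1).
  assert (Ha := one_minus_sq_pos eps H0 H1). assert (Hf := kz_phi_pos eps th H0 H1).
  split.
  - rewrite hilbert_kz by assumption. unfold kz_reeb. cbn [fst snd].
    set (k := (1 - eps ^ 2) / (kz_s eps th - eps * cos th)).
    transitivity (k * ((cos th / kz_s eps th - eps) / (1 - eps ^ 2) * cos th
      + sin th / kz_s eps th * sin th)); [ring|].
    rewrite kz_length by assumption. unfold k. field. lra.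
  - intros [[u v] w]. rewrite extd_hilbert_kz by assumption.
    unfold kz_reeb. cbn [fst snd]. field. lra.
Qed.

(** Three test equations determine the three components. Contracting [dA] with the horizontal vector
    normal to the ray kills the vertical part, contracting it with the vertical vector makes the
    horizontal part radial, and [A(X) = 1] fixes the remaining factor [k]. *)
Lemma is_reeb_unique (eps : R) (X : HT -> HT) : 0 <= eps -> eps < 1 ->
  is_reeb (katok_ziller eps) X -> forall m, X m = kz_reeb eps m.
Proof.
  intros H0 H1 HX [q th]. destruct (HX (q, th)) as [HA HdA].
  assert (Hs := kz_s_pos eps th H0 H1).
  assert (Ha := one_minus_sq_pos eps H0 H1). assert (Hf := kz_phi_pos eps th H0 H1).
  assert (C := cos2_sin2 th). assert (L := kz_length eps th H0 H1).
  assert (Hs3 : 0 < kz_s eps th ^ 3) by now apply pow_lt.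
  rewrite hilbert_kz in HA by assumption.
  assert (E1 := HdA ((- sin th, cos th), 0)). assert (E2 := HdA ((0, 0), 1)).
  rewrite extd_hilbert_kz in E1, E2 by assumption. clear HdA.
  unfold kz_reeb. cbn [fst snd] in *.
  destruct (X (q, th)) as [[u v] w]. cbn [fst snd] in *.
  assert (Hw : w = 0).
  { replace (- sin th * - sin th + cos th * cos th) with 1 in E1 by lra.
    assert (w / kz_s eps th ^ 3 = 0) by lra.
    replace w with (w / kz_s eps th ^ 3 * kz_s eps th ^ 3) by (field; lra).
    rewrite H. ring. }
  assert (Hperp : - sin th * u + cos th * v = 0).
  { replace (- sin th * u + cos th * v) with
      ((- sin th * u + cos th * v) / kz_s eps th ^ 3 * 1 * kz_s eps th ^ 3)
      by (field; lra).
    replace ((- sin th * u + cos th * v) / kz_s eps th ^ 3 * 1) with 0 by lra. ring. }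
  assert (Hu : u = (cos th * u + sin th * v) * cos th).
  { transitivity (u * (cos th ^ 2 + sin th ^ 2)
      + sin th * (- sin th * u + cos th * v)); [rewrite C, Hperp; ring|ring]. }
  assert (Hv : v = (cos th * u + sin th * v) * sin th).
  { transitivity (v * (cos th ^ 2 + sin th ^ 2)
      - cos th * (- sin th * u + cos th * v)); [rewrite C, Hperp; ring|ring]. }
  set (k := cos th * u + sin th * v) in *.
  assert (Hk : k = (1 - eps ^ 2) / (kz_s eps th - eps * cos th)).
  { rewrite Hu, Hv in HA.
    assert (HA' : k * ((kz_s eps th - eps * cos th) / (1 - eps ^ 2)) = 1)
      by (rewrite <- L; lra).
    transitivity (k * ((kz_s eps th - eps * cos th) / (1 - eps ^ 2))
      * ((1 - eps ^ 2) / (kz_s eps th - eps * cos th))); [field; lra|].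
    rewrite HA'. ring. }
  rewrite <- Hk. rewrite Hu, Hv, Hw. reflexivity.
Qed.

(** The explicit field witnesses that the choice is made from a nonempty set; uniqueness then
    identifies the chosen field pointwise. *)
Lemma reeb_kz (eps : R) (m : HT) : 0 <= eps -> eps < 1 ->
  reeb (katok_ziller eps) m = kz_reeb eps m.
Proof.
  intros H0 H1. apply is_reeb_unique; try assumption.
  unfold reeb. apply epsilon_spec. exists (kz_reeb eps). now apply kz_reeb_is_reeb.
Qed.

(** * The angle form and the volume form *)

Lemma cos_sin_div_kz_s_continuous (eps th : R) (i j k : nat) : 0 <= eps -> eps < 1 ->
  continuous (fun th => cos th ^ i * sin th ^ j / kz_s eps th ^ k) th.
Proof.
  intros H0 H1. assert (Hs := kz_s_pos eps th H0 H1).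
  apply (ex_derive_continuous (V := R_NormedModule)).
  assert (D := is_derive_kz_s eps th H0 H1).
  apply (ex_derive_div (fun th => cos th ^ i * sin th ^ j) (fun th => kz_s eps th ^ k)).
  - now auto_derive.
  - apply ex_derive_pow. now exists (- eps ^ 2 * (sin th * cos th) / kz_s eps th).
  - apply pow_nonzero. lra.
Qed.

(* [atan (b tan th) / b], written so that it is smooth for all [th]. *)
Definition kz_angle (eps th : R) : R :=
  let b := sqrt (1 - eps ^ 2) in
  (th + atan ((b - 1) * (sin th * cos th) / (cos th ^ 2 + b * sin th ^ 2))) / b.

Lemma sqrt_one_minus_sq (eps : R) : 0 <= eps -> eps < 1 ->
  0 < sqrt (1 - eps ^ 2) /\ sqrt (1 - eps ^ 2) * sqrt (1 - eps ^ 2) = 1 - eps ^ 2.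
Proof.
  intros H0 H1. assert (Ha := one_minus_sq_pos eps H0 H1).
  split; [now apply sqrt_lt_R0|apply sqrt_sqrt; lra].
Qed.

(** By the addition formula for the tangent, the [atan] term is [atan (b tan th) - th] wherever the
    tangent is defined. The derivative is computed from the formula that is valid for all [th]. *)
Lemma is_derive_kz_angle (eps th : R) : 0 <= eps -> eps < 1 ->
  is_derive (kz_angle eps) th (1 / kz_s eps th ^ 2).
Proof.
  intros H0 H1. destruct (sqrt_one_minus_sq eps H0 H1) as [Hb Hbb].
  rewrite kz_s_sq, <- Hbb by assumption. unfold kz_angle. cbv zeta.
  set (b := sqrt (1 - eps ^ 2)) in *.
  assert (HD : 0 < cos th ^ 2 + b * sin th ^ 2)
    by apply (ellipse_pos b (cos th, sin th) Hb (cos_sin_neq0 th)).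
  assert (HE : 0 < cos th ^ 2 + b * b * sin th ^ 2).
  { apply (ellipse_pos (b * b) (cos th, sin th)); [nra|apply cos_sin_neq0]. }
  assert (C := cos2_sin2 th).
  auto_derive.
  - simpl in HD. lra.
  - set (c := cos th) in *. set (s := sin th) in *.
    replace (c * (c * 1) + b * (s * (s * 1))) with (c ^ 2 + b * s ^ 2) by ring.
    set (D := c ^ 2 + b * s ^ 2) in *. set (E := c ^ 2 + b * b * s ^ 2) in *.
    (* The product of two sums of squares, with [c ^ 2 + s ^ 2 = 1], turns the denominator produced
       by [atan] into [E], which is [kz_s ^ 2]. *)
    assert (K1 : D ^ 2 + ((b - 1) * (s * c)) ^ 2 = E).
    { transitivity ((c ^ 2 + s ^ 2) * E); [unfold D, E; ring|rewrite C; ring]. }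
    (* [N / D ^ 2] is the derivative of the quotient under [atan], so the numerator of
       [th + atan (...)] has derivative [1 + N / E = b / E]. *)
    set (N := (b - 1) * ((c ^ 2 - s ^ 2) * D - 2 * (b - 1) * (s * c) ^ 2)).
    assert (K2 : E + N = b).
    { transitivity (b * (c ^ 2 + s ^ 2) ^ 2); [|rewrite C; ring].
      transitivity ((c ^ 2 + s ^ 2) * E + N); [rewrite C; ring|].
      unfold N, D, E. ring. }
    transitivity (/ b * ((D ^ 2 + ((b - 1) * (s * c)) ^ 2 + N)
       / (D ^ 2 + ((b - 1) * (s * c)) ^ 2))).
    2:{ rewrite K1, K2. field. lra. }
    unfold N. simpl. field. repeat split; try lra.
Qed.

(** The correction by [atan] vanishes at both ends, so a full turn contributes only through the
    linear term [th]. *)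
Lemma kz_angle_2PI (eps : R) : 0 <= eps -> eps < 1 ->
  kz_angle eps (2 * PI) - kz_angle eps 0 = 2 * PI / sqrt (1 - eps ^ 2).
Proof.
  intros H0 H1. destruct (sqrt_one_minus_sq eps H0 H1) as [Hb _].
  unfold kz_angle. cbv zeta. rewrite sin_2PI, sin_0, cos_2PI, cos_0.
  replace ((sqrt (1 - eps ^ 2) - 1) * (0 * 1)
    / (1 ^ 2 + sqrt (1 - eps ^ 2) * 0 ^ 2)) with 0 by (field; lra).
  rewrite atan_0. field. lra.
Qed.

Lemma is_RInt_inv_kz_s2 (eps : R) : 0 <= eps -> eps < 1 ->
  is_RInt (fun th => 1 / kz_s eps th ^ 2) 0 (2 * PI) (2 * PI / sqrt (1 - eps ^ 2)).
Proof.
  intros H0 H1. rewrite <- kz_angle_2PI by assumption.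
  apply (is_RInt_derive (kz_angle eps)).
  - intros th _. now apply is_derive_kz_angle.
  - intros th _. apply (continuous_ext
      (fun th => cos th ^ 0 * sin th ^ 0 / kz_s eps th ^ 2)).
    + intros t. simpl. unfold Rdiv. ring.
    + now apply cos_sin_div_kz_s_continuous.
Qed.

(** Integrating [s ^ 2 / s ^ 2 = 1] with [s ^ 2 = 1 - eps ^ 2 * sin ^ 2] gives a linear equation for
    the unknown integral in terms of that of [1 / s ^ 2]. *)
Lemma is_RInt_sin2_kz_s2 (eps : R) : 0 <= eps -> eps < 1 ->
  is_RInt (fun th => cos th ^ 0 * sin th ^ 2 / kz_s eps th ^ 2) 0 (2 * PI)
    (2 * PI / (sqrt (1 - eps ^ 2) * (1 + sqrt (1 - eps ^ 2)))).
Proof.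
  intros H0 H1. destruct (sqrt_one_minus_sq eps H0 H1) as [Hb Hbb].
  assert (V : is_RInt (fun th => cos th ^ 0 * sin th ^ 2 / kz_s eps th ^ 2) 0 (2 * PI)
    (RInt (fun th => cos th ^ 0 * sin th ^ 2 / kz_s eps th ^ 2) 0 (2 * PI))).
  { apply (RInt_correct (V := R_CompleteNormedModule)).
    apply (ex_RInt_continuous (V := R_CompleteNormedModule)). intros.
    now apply cos_sin_div_kz_s_continuous. }
  (* The linear equation has leading coefficient [eps ^ 2]; for [eps = 0] it degenerates, and an
     explicit primitive of [sin ^ 2] is used instead. *)
  destruct (Req_dec eps 0) as [E|E].
  - assert (Hb1 : sqrt (1 - eps ^ 2) = 1).
    { rewrite E. replace (1 - 0 ^ 2) with 1 by ring. apply sqrt_1. }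
    rewrite Hb1.
    apply (is_RInt_ext (fun th => sin th ^ 2)).
    { intros th _. change (sin th ^ 2 = cos th ^ 0 * sin th ^ 2 / kz_s eps th ^ 2).
      rewrite kz_s_sq, E by assumption.
      replace (cos th ^ 2 + (1 - 0 ^ 2) * sin th ^ 2) with 1
        by (specialize (cos2_sin2 th); lra). field. }
    replace (2 * PI / (1 * (1 + 1))) with
      (minus ((fun th => (th - sin th * cos th) / 2) (2 * PI))
             ((fun th => (th - sin th * cos th) / 2) 0)).
    2:{ unfold minus, plus, opp; simpl. rewrite sin_2PI, sin_0. field. }
    apply (is_RInt_derive (fun th => (th - sin th * cos th) / 2)).
    + intros th _. auto_derive; [exact I|]. specialize (cos2_sin2 th).
      intros. simpl in *. lra.
    + intros th _. apply (ex_derive_continuous (V := R_NormedModule)). now auto_derive.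
  - assert (HI := is_RInt_inv_kz_s2 eps H0 H1).
    set (S := RInt _ _ _) in V.
    assert (W : is_RInt (fun _ => 1) 0 (2 * PI) (2 * PI / sqrt (1 - eps ^ 2) - eps ^ 2 * S)).
    { apply (is_RInt_ext (fun th => minus (1 / kz_s eps th ^ 2)
        (scal (eps ^ 2) (cos th ^ 0 * sin th ^ 2 / kz_s eps th ^ 2)))).
      - intros th _. unfold minus, plus, opp, scal; simpl. unfold mult; simpl.
        assert (Hs := kz_s_pos eps th H0 H1). assert (Hq := kz_s_sq eps th H0 H1).
        assert (C := cos2_sin2 th).
        transitivity ((1 - eps ^ 2 * sin th ^ 2) / kz_s eps th ^ 2).
        { field. lra. }
        replace (1 - eps ^ 2 * sin th ^ 2) with (kz_s eps th ^ 2).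
        { field. lra. }
        rewrite Hq. replace (cos th ^ 2) with (1 - sin th ^ 2) by lra. ring.
      - apply (is_RInt_minus (V := R_NormedModule)); [exact HI|].
        apply (is_RInt_scal (V := R_NormedModule)). exact V. }
    apply (is_RInt_unique (V := R_CompleteNormedModule)) in W. rewrite RInt_const in W.
    change ((2 * PI - 0) * 1 = 2 * PI / sqrt (1 - eps ^ 2) - eps ^ 2 * S) in W.
    set (b := sqrt (1 - eps ^ 2)) in *.
    assert (Hb1 : b <> 1) 
      by (intros Hb1; apply (pow_nonzero eps 2 E); rewrite Hb1 in Hbb; lra).
    replace (2 * PI / (b * (1 + b))) with S; [exact V|].
    apply (Rmult_eq_reg_l (eps ^ 2)); [|now apply pow_nonzero].
    transitivity (2 * PI / b - 2 * PI); [lra|].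
    replace (eps ^ 2) with ((1 - b) * (1 + b)) by lra. field. lra.
Qed.

Lemma is_RInt_cos2_kz_s2 (eps : R) : 0 <= eps -> eps < 1 ->
  is_RInt (fun th => cos th ^ 2 * sin th ^ 0 / kz_s eps th ^ 2) 0 (2 * PI)
    (2 * PI / (1 + sqrt (1 - eps ^ 2))).
Proof.
  intros H0 H1. destruct (sqrt_one_minus_sq eps H0 H1) as [Hb _].
  set (b := sqrt (1 - eps ^ 2)) in *.
  replace (2 * PI / (1 + b)) with (minus (2 * PI / b) (2 * PI / (b * (1 + b)))).
  2:{ unfold minus, plus, opp; simpl. field. lra. }
  apply (is_RInt_ext (fun th => minus (1 / kz_s eps th ^ 2)
        (cos th ^ 0 * sin th ^ 2 / kz_s eps th ^ 2))).
  - intros th _. unfold minus, plus, opp; simpl.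
    assert (Hs := kz_s_pos eps th H0 H1).
    replace (cos th * (cos th * 1)) with (1 - sin th * sin th)
      by (specialize (cos2_sin2 th); intros; lra). field. lra.
  - apply (is_RInt_minus (V := R_NormedModule));
    [now apply is_RInt_inv_kz_s2|now apply is_RInt_sin2_kz_s2].
Qed.

Lemma is_RInt_antiperiodic (h : R -> R) (T : R) :
  (forall t, continuous h t) -> (forall t, h (t + T) = - h t) ->
  is_RInt h 0 (2 * T) 0.
Proof.
  intros Hc Hh.
  assert (X : forall a b, ex_RInt h a b).
  { intros a b. apply (ex_RInt_continuous (V := R_CompleteNormedModule)). auto. }
  assert (V := RInt_correct (V := R_CompleteNormedModule) _ _ _ (X 0 T)).
  set (v := RInt h 0 T : R) in V. change (is_RInt (V := R_NormedModule) h 0 T v) in V.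
  replace 0 with (v + - v) at 2 by ring.
  apply (is_RInt_Chasles (V := R_NormedModule) h 0 T (2 * T) v (- v)); [exact V|].
  apply (is_RInt_ext (fun t => opp (h (1 * t + - T) : R))).
  { intros t _. unfold opp; simpl. rewrite <- Hh. f_equal. ring. }
  apply (is_RInt_opp (V := R_NormedModule)).
  apply (is_RInt_ext (fun t => scal 1 (h (1 * t + - T)))).
  { intros t _. apply (scal_one (V := R_NormedModule)). }
  apply (is_RInt_comp_lin (V := R_NormedModule)).
  replace (1 * T + - T) with 0 by ring. replace (1 * (2 * T) + - T) with T by ring.
  exact V.
Qed.

Lemma is_RInt_antisymmetric (h : R -> R) (T : R) :
  (forall t, continuous h t) -> (forall t, h (T - t) = - h t) ->
  is_RInt h 0 T 0.
Proof.
  intros Hc Hh.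
  assert (X : ex_RInt h 0 T).
  { apply (ex_RInt_continuous (V := R_CompleteNormedModule)). auto. }
  assert (V := RInt_correct (V := R_CompleteNormedModule) _ _ _ X).
  assert (W : is_RInt h 0 T (- RInt h 0 T)).
  { apply (is_RInt_ext (fun t => scal (-1) (h (-1 * t + T)))).
    { intros t _. replace (-1 * t + T) with (T - t) by ring. rewrite Hh.
      unfold scal; simpl; unfold mult; simpl. ring. }
    apply (is_RInt_comp_lin (V := R_NormedModule)).
    replace (-1 * 0 + T) with T by ring. replace (-1 * T + T) with 0 by ring.
    apply (is_RInt_swap (V := R_NormedModule)). exact V. }
  assert (E := is_RInt_unique (V := R_CompleteNormedModule) _ _ _ _ W).
  replace 0 with (RInt h 0 T) at 2 by (change (RInt h 0 T = - RInt h 0 T) in E; lra).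
  exact V.
Qed.

(** A half turn negates both [cos] and [sin] and preserves [kz_s], so a monomial of odd total degree
    changes sign. *)
Lemma is_RInt_kz_odd (eps : R) (i j k : nat) : 0 <= eps -> eps < 1 ->
  Nat.Odd (i + j) ->
  is_RInt (fun th => cos th ^ i * sin th ^ j / kz_s eps th ^ k) 0 (2 * PI) 0.
Proof.
  intros H0 H1 [n Hn]. apply is_RInt_antiperiodic.
  - intros t. now apply cos_sin_div_kz_s_continuous.
  - intros t. unfold kz_s. rewrite neg_cos, neg_sin.
    replace ((- cos t) ^ 2) with (cos t ^ 2) by ring.
    replace ((- sin t) ^ 2) with (sin t ^ 2) by ring.
    replace (- cos t) with (-1 * cos t) by ring.
    replace (- sin t) with (-1 * sin t) by ring.
    rewrite !Rpow_mult_distr.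
    transitivity ((-1) ^ (i + j) * (cos t ^ i * sin t ^ j
      / sqrt (cos t ^ 2 + (1 - eps ^ 2) * sin t ^ 2) ^ k)).
    + rewrite pow_add. unfold Rdiv. ring.
    + rewrite Hn, Nat.add_1_r, pow_1_odd. ring.
Qed.

(** The reflection [th -> 2 PI - th] negates [sin] alone. This covers [cos * sin / s ^ 2], whose
    even degree makes it invariant under the half turn. *)
Lemma is_RInt_kz_odd_sin (eps : R) (i k : nat) : 0 <= eps -> eps < 1 ->
  is_RInt (fun th => cos th ^ i * sin th ^ 1 / kz_s eps th ^ k) 0 (2 * PI) 0.
Proof.
  intros H0 H1. apply is_RInt_antisymmetric.
  - intros t. now apply cos_sin_div_kz_s_continuous.
  - intros t.
    assert (Hc : cos (2 * PI - t) = cos t).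
    { rewrite cos_minus, cos_2PI, sin_2PI. ring. }
    assert (Hs : sin (2 * PI - t) = - sin t).
    { rewrite sin_minus, cos_2PI, sin_2PI. ring. }
    unfold kz_s. rewrite Hc, Hs.
    replace ((- sin t) ^ 2) with (sin t ^ 2) by ring. unfold Rdiv. ring.
Qed.

(** * The volume form and the angle form *)

Definition kz_alpha (eps th : R) : R :=
  sqrt (1 - eps ^ 2) * (kz_s eps th - eps * cos th) / kz_s eps th ^ 3.

Lemma is_RInt_kz_alpha (eps : R) : 0 <= eps -> eps < 1 ->
  is_RInt (kz_alpha eps) 0 (2 * PI) (2 * PI).
Proof.
  intros H0 H1. destruct (sqrt_one_minus_sq eps H0 H1) as [Hb _].
  set (b := sqrt (1 - eps ^ 2)) in *.
  apply (is_RInt_ext (fun th => scal b (minus (1 / kz_s eps th ^ 2)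
    (scal eps (cos th ^ 1 * sin th ^ 0 / kz_s eps th ^ 3))))).
  - intros th _. assert (Hs := kz_s_pos eps th H0 H1).
    unfold kz_alpha. fold b. unfold minus, plus, opp, scal; simpl; unfold mult; simpl.
    field. lra.
  - replace (2 * PI) with (scal b (minus (2 * PI / b) (scal eps 0))) at 2.
    2:{ unfold minus, plus, opp, scal; simpl; unfold mult; simpl. field. lra. }
    apply (is_RInt_scal (V := R_NormedModule)), (is_RInt_minus (V := R_NormedModule));
      [now apply is_RInt_inv_kz_s2|].
    apply (is_RInt_scal (V := R_NormedModule)).
    apply is_RInt_kz_odd; try assumption. now exists 0%nat.
Qed.

Lemma kz_wedge_basis (eps : R) (m : HT) : 0 <= eps -> eps < 1 ->
  wedge12 (hilbert (katok_ziller eps)) (extd (hilbert (katok_ziller eps))) m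
    ((1, 0), 0) ((0, 1), 0) ((0, 0), 1) =
  - (kz_s eps (snd m) - eps * cos (snd m)) / (1 - eps ^ 2) / kz_s eps (snd m) ^ 3.
Proof.
  intros H0 H1. destruct m as [q th]. unfold wedge12.
  rewrite !hilbert_kz, !extd_hilbert_kz by assumption. cbn [fst snd].
  assert (Hs := kz_s_pos eps th H0 H1). assert (Ha := one_minus_sq_pos eps H0 H1).
  transitivity (- ((cos th / kz_s eps th - eps) / (1 - eps ^ 2) * cos th
    + sin th / kz_s eps th * sin th) / kz_s eps th ^ 3); [field; lra|].
  rewrite kz_length by assumption. field. lra.
Qed.

(** The top form fixes only the product of [rho] with the vertical coefficient of [alpha], as
    computed in [kz_wedge_basis]. The factor [sqrt (1 - eps ^ 2)] in [kz_alpha] gives each fiber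
    mass [2 PI], and [rho] absorbs the inverse factor. *)
Lemma kz_angle_volume_exists (eps : R) : 0 <= eps -> eps < 1 ->
  is_angle_volume (katok_ziller eps)
    (fun _ => - / ((1 - eps ^ 2) * sqrt (1 - eps ^ 2)),
     fun m Z => kz_alpha eps (snd m) * snd Z).
Proof.
  intros H0 H1. destruct (sqrt_one_minus_sq eps H0 H1) as [Hb Hbb].
  assert (Ha := one_minus_sq_pos eps H0 H1).
  assert (Hal : forall th, 0 < kz_alpha eps th).
  { intros th. assert (Hs := kz_s_pos eps th H0 H1). assert (Hf := kz_phi_pos eps th H0 H1).
    apply Rdiv_lt_0_compat; [nra|now apply pow_lt]. }
  assert (Hk : 0 < / ((1 - eps ^ 2) * sqrt (1 - eps ^ 2))) by (apply Rinv_0_lt_compat; nra).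
  unfold is_angle_volume. cbn [fst snd]. repeat split.
  - apply (elementary_smooth (V := NR2)); [apply open_true|apply elementary_const].
  - intros _. lra.
  - intros m [Z z] [W w] c.
    change (kz_alpha eps (snd m) * (c * z + w)
      = c * (kz_alpha eps (snd m) * z) + kz_alpha eps (snd m) * w). ring.
  - intros Z.
    set (U := fun _ : R * R * R => True).
    assert (Es : elementary (V := NHT) U (fun m => sin (snd m))).
    { apply elementary_sin, elementary_linear, is_linear_snd. }
    assert (Ec : elementary (V := NHT) U (fun m => cos (snd m))).
    { apply elementary_cos, elementary_linear, is_linear_snd. }
    assert (E2 : elementary (V := NHT) U (fun m => cos (snd m) * cos (snd m)
       + (1 - eps ^ 2) * (sin (snd m) * sin (snd m)))).
    { apply elementary_plus; [now apply elementary_mult|].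
      apply elementary_mult; [apply elementary_const|now apply elementary_mult]. }
    assert (P2 : forall m : R * R * R, 0 < cos (snd m) * cos (snd m)
       + (1 - eps ^ 2) * (sin (snd m) * sin (snd m))).
    { intros m. assert (P := ellipse_pos _ _ Ha (cos_sin_neq0 (snd m))).
      simpl in P |- *. lra. }
    assert (EQ := elementary_sqrt (V := NHT) U _ E2 (fun m _ => P2 m)). cbv beta in EQ.
    assert (PQ := fun m => sqrt_lt_R0 _ (P2 m)). cbv beta in PQ.
    (* The same coefficient written with products and one inverse, the form in which [elementary]
       applies. *)
    apply (elementary_ext (V := NHT) U (fun m =>
      sqrt (1 - eps ^ 2) *
      (sqrt (cos (snd m) * cos (snd m)
       + (1 - eps ^ 2) * (sin (snd m) * sin (snd m))) + (- eps) * cos (snd m)) *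
      / (sqrt (cos (snd m) * cos (snd m)
       + (1 - eps ^ 2) * (sin (snd m) * sin (snd m))) *
      (sqrt (cos (snd m) * cos (snd m)
       + (1 - eps ^ 2) * (sin (snd m) * sin (snd m))) *
      sqrt (cos (snd m) * cos (snd m)
       + (1 - eps ^ 2) * (sin (snd m) * sin (snd m))))) * snd Z)).
    + apply open_true.
    + intros [q th] _. cbn [fst snd]. unfold kz_alpha, kz_s.
      replace (cos th ^ 2 + (1 - eps ^ 2) * sin th ^ 2) with
        (cos th * cos th + (1 - eps ^ 2) * (sin th * sin th)) by ring.
      set (S := sqrt (cos th * cos th + (1 - eps ^ 2) * (sin th * sin th))).
      replace (S ^ 3) with (S * (S * S)) by ring.
      change (sqrt (1 - eps ^ 2) * (S + - eps * cos th) * / (S * (S * S)) * snd Z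
        = sqrt (1 - eps ^ 2) * (S - eps * cos th) * / (S * (S * S)) * snd Z). ring.
    + apply elementary_mult; [|apply elementary_const]. apply elementary_mult.
      * apply elementary_mult; [apply elementary_const|]. apply elementary_plus; [exact EQ|].
        apply elementary_mult; [apply elementary_const|exact Ec].
      * apply (elementary_inv (V := NHT) U (fun m => sqrt (cos (snd m) * cos (snd m)
         + (1 - eps ^ 2) * (sin (snd m) * sin (snd m))) *
        (sqrt (cos (snd m) * cos (snd m)
         + (1 - eps ^ 2) * (sin (snd m) * sin (snd m))) *
        sqrt (cos (snd m) * cos (snd m)
         + (1 - eps ^ 2) * (sin (snd m) * sin (snd m)))))).
        { apply elementary_mult; [exact EQ|now apply elementary_mult]. }
        intros m _. specialize (PQ m).
        apply Rgt_not_eq. apply Rmult_lt_0_compat; [exact PQ|].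
        now apply Rmult_lt_0_compat.
  - intros q th. cbn [fst snd]. unfold kz_alpha, kz_s.
    now rewrite cos_plus, sin_plus, cos_2PI, sin_2PI, !Rmult_1_r, !Rmult_0_r,
      Rminus_0_r, Rplus_0_r.
  - intros [q th] [[u v] w] E1 E2. cbn [fst snd] in *.
    apply Rmult_integral_contrapositive. split; [apply Rgt_not_eq, Hal|].
    intros ->. now rewrite E1 in E2.
  - intros [q th] [[u1 v1] w1] [[u2 v2] w2] [[u3 v3] w3]. unfold wedge12, pull_vol.
    rewrite !hilbert_kz, !extd_hilbert_kz by assumption. cbn [fst snd].
    assert (Hs := kz_s_pos eps th H0 H1).
    assert (L := kz_length eps th H0 H1).
    assert (Hk3 : kz_alpha eps th * - / ((1 - eps ^ 2) * sqrt (1 - eps ^ 2)) =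
      - ((cos th / kz_s eps th - eps) / (1 - eps ^ 2) * cos th
      + sin th / kz_s eps th * sin th) / kz_s eps th ^ 3).
    { rewrite L. unfold kz_alpha. field. lra. }
    (* Both sides are multiples of the determinant of the three vectors; [Hk3] compares the
       coefficients. *)
    transitivity (kz_alpha eps th * - / ((1 - eps ^ 2) * sqrt (1 - eps ^ 2)) *
      (w1 * (u2 * v3 - v2 * u3) - w2 * (u1 * v3 - v1 * u3) + w3 * (u1 * v2 - v1 * u2)));
      [ring|].
    rewrite Hk3. field. lra.
  - intros q. apply (is_RInt_ext (kz_alpha eps)); 
      [intros th _; change (kz_alpha eps th = kz_alpha eps th * 1); ring|].
    now apply is_RInt_kz_alpha.
Qed.

(** The wedge identity on the standard basis gives [alpha * rho] on each fiber. Since [rho] is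
    constant along the fiber, integrating with the normalisation of [alpha] determines [rho], and
    dividing by it determines [alpha] on the vertical vector. *)
Lemma angle_volume_kz (eps : R) : 0 <= eps -> eps < 1 ->
  (forall q, vol_density (katok_ziller eps) q = / ((1 - eps ^ 2) * sqrt (1 - eps ^ 2))) /\
  (forall q th, angle_form (katok_ziller eps) (q, th) ((0, 0), 1) = kz_alpha eps th).
Proof.
  intros H0 H1. destruct (sqrt_one_minus_sq eps H0 H1) as [Hb Hbb].
  assert (Ha := one_minus_sq_pos eps H0 H1).
  assert (Hk : 0 < / ((1 - eps ^ 2) * sqrt (1 - eps ^ 2))) by (apply Rinv_0_lt_compat; nra).
  assert (S : is_angle_volume (katok_ziller eps) (angle_volume (katok_ziller eps))).
  { unfold angle_volume. apply epsilon_spec. eexists. now apply kz_angle_volume_exists. }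
  unfold vol_density, angle_form.
  destruct (angle_volume (katok_ziller eps)) as [rho alpha]. cbn [fst snd].
  destruct S as ((_ & Hrho) & _ & _ & Hw & HI). cbn [fst snd] in *.
  assert (K : forall q th, alpha (q, th) ((0, 0), 1) * rho q =
    - / ((1 - eps ^ 2) * sqrt (1 - eps ^ 2)) * kz_alpha eps th).
  { intros q th. specialize (Hw (q, th) ((1, 0), 0) ((0, 1), 0) ((0, 0), 1)).
    rewrite kz_wedge_basis in Hw by assumption.
    assert (Hs := kz_s_pos eps th H0 H1).
    unfold wedge12, pull_vol in Hw. cbn [fst snd] in Hw.
    transitivity (- (kz_s eps th - eps * cos th) / (1 - eps ^ 2) / kz_s eps th ^ 3).
    - rewrite <- Hw. ring.
    - unfold kz_alpha. field. lra. }
  assert (R : forall q, rho q = - / ((1 - eps ^ 2) * sqrt (1 - eps ^ 2))).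
  { intros q.
    assert (A1 : is_RInt (fun th => scal (rho q) (alpha (q, th) ((0, 0), 1))) 0 (2 * PI)
      (scal (rho q) vol_S1)) by apply (is_RInt_scal (V := R_NormedModule)), HI.
    assert (A2 := is_RInt_scal (V := R_NormedModule) _ 0 (2 * PI)
      (- / ((1 - eps ^ 2) * sqrt (1 - eps ^ 2))) _ (is_RInt_kz_alpha eps H0 H1)).
    apply (is_RInt_unique (V := R_CompleteNormedModule)) in A1.
    apply (is_RInt_unique (V := R_CompleteNormedModule)) in A2.
    rewrite (RInt_ext _ (fun th => scal (- / ((1 - eps ^ 2) * sqrt (1 - eps ^ 2)))
      (kz_alpha eps th))) in A1.
    2:{ intros th _. change (rho q * alpha (q, th) ((0, 0), 1) =
          - / ((1 - eps ^ 2) * sqrt (1 - eps ^ 2)) * kz_alpha eps th).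
        rewrite Rmult_comm. exact (K q th). }
    change (RInt (fun th => - / ((1 - eps ^ 2) * sqrt (1 - eps ^ 2)) * kz_alpha eps th)
      0 (2 * PI) = rho q * (2 * PI)) in A1.
    change (RInt (fun th => - / ((1 - eps ^ 2) * sqrt (1 - eps ^ 2)) * kz_alpha eps th)
      0 (2 * PI) = - / ((1 - eps ^ 2) * sqrt (1 - eps ^ 2)) * (2 * PI)) in A2.
    rewrite A2 in A1.
    assert (P := PI_RGT_0).
    apply (Rmult_eq_reg_r (2 * PI)); [|lra]. now symmetry. }
  split.
  - intros q. rewrite R, Rabs_Ropp. now apply Rabs_pos_eq, Rlt_le.
  - intros q th. specialize (K q th). rewrite R in K.
    apply (Rmult_eq_reg_r (- / ((1 - eps ^ 2) * sqrt (1 - eps ^ 2)))); [lra|lra].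
Qed.

(** * The Laplacian *)

Notation ddx f := (fun q : R * R => ddir f q (1, 0)).
Notation ddy f := (fun q : R * R => ddir f q (0, 1)).

Lemma lie_reeb_kz (eps : R) (f : R * R -> R) (m : HT) : 0 <= eps -> eps < 1 ->
  smooth_on (V := NR2) (fun _ => True) f ->
  let k := (1 - eps ^ 2) / (kz_s eps (snd m) - eps * cos (snd m)) in
  lie (reeb (katok_ziller eps)) (fun m => f (fst m)) m =
  k * (cos (snd m) * ddx f (fst m) + sin (snd m) * ddy f (fst m)).
Proof.
  intros H0 H1 Hf k. destruct m as [q th]. unfold lie. rewrite reeb_kz by assumption.
  unfold kz_reeb. cbn [fst snd] in *. fold k.
  change (ddir f q (k * cos th, k * sin th) =
    k * (cos th * ddir f q (1, 0) + sin th * ddir f q (0, 1))).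
  rewrite ddir_linear by assumption. ring.
Qed.

(** The Reeb field has no vertical part, so along its direction the angle is frozen and [k] is a
    constant: the second derivative is that of [f] along a fixed vector of the plane. *)
Lemma lie_lie_reeb_kz (eps : R) (f : R * R -> R) (q : R * R) (th : R) :
  0 <= eps -> eps < 1 -> smooth_on (V := NR2) (fun _ => True) f ->
  let k := (1 - eps ^ 2) / (kz_s eps th - eps * cos th) in
  lie (reeb (katok_ziller eps)) (lie (reeb (katok_ziller eps)) (fun m => f (fst m))) (q, th) =
  k ^ 2 * (cos th ^ 2 * ddx (ddx f) q + cos th * sin th * (ddy (ddx f) q + ddx (ddy f) q)
    + sin th ^ 2 * ddy (ddy f) q).
Proof.
  intros H0 H1 Hf k. unfold lie at 1. rewrite reeb_kz by assumption.
  unfold kz_reeb. cbn [fst snd]. fold k. destruct q as [x y].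
  apply is_derive_unique.
  apply (is_derive_ext (fun t : R => k *
    (cos th * ddx f (x + t * (k * cos th), y + t * (k * sin th))
     + sin th * ddy f (x + t * (k * cos th), y + t * (k * sin th))))).
  - intros t. rewrite lie_reeb_kz by assumption.
    change (snd (plus (x, y, th) (scal t (k * cos th, k * sin th, 0)))) with (th + t * 0).
    rewrite Rmult_0_r, Rplus_0_r. reflexivity.
  - evar_last.
    + apply is_derive_scal.
      apply (is_derive_plus (V := R_NormedModule)
        (fun t => cos th * ddx f (x + t * (k * cos th), y + t * (k * sin th)))
        (fun t => sin th * ddy f (x + t * (k * cos th), y + t * (k * sin th))));
      apply is_derive_scal.
      * apply (smooth_ddir_linear (ddx f)). now apply (smooth_on_ddir (V := NR2)).
      * apply (smooth_ddir_linear (ddy f)). now apply (smooth_on_ddir (V := NR2)).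
    + unfold plus; simpl. ring.
Qed.

Lemma finsler_laplacian_kz (eps : R) (f : R * R -> R) (q : R * R) :
  0 <= eps -> eps < 1 -> smooth_on (V := NR2) (fun _ => True) f ->
  finsler_laplacian (katok_ziller eps) f q =
  2 * (1 - eps ^ 2) / (1 + sqrt (1 - eps ^ 2))
  * (sqrt (1 - eps ^ 2) * ddx (ddx f) q + ddy (ddy f) q).
Proof.
  intros H0 H1 Hf. destruct (sqrt_one_minus_sq eps H0 H1) as [Hb Hbb].
  assert (Ha := one_minus_sq_pos eps H0 H1).
  unfold finsler_laplacian.
  set (b := sqrt (1 - eps ^ 2)) in *. set (a := 1 - eps ^ 2) in *.
  set (A := ddx (ddx f) q). set (M := ddy (ddx f) q + ddx (ddy f) q). set (D := ddy (ddy f) q).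
  set (P := fun (i j k : nat) (th : R) => cos th ^ i * sin th ^ j / kz_s eps th ^ k).
  assert (L : forall (g h : R -> R) (u l m : R),
    is_RInt g 0 (2 * PI) l -> is_RInt h 0 (2 * PI) m ->
    is_RInt (fun th => u * g th + h th) 0 (2 * PI) (u * l + m)).
  { intros g h u l m Hg Hh.
    apply (is_RInt_plus (V := R_NormedModule) (fun th => u * g th)); [|exact Hh].
    now apply (is_RInt_scal (V := R_NormedModule)). }
  (* Here [k ^ 2 * kz_alpha = a * b * (s + eps * c) / s ^ 3], so each of [c ^ 2], [n ^ 2] and
     [c * n] contributes one term over [s ^ 2] and one with an extra [eps * c] over [s ^ 3]. The
     final [0] lets [L] peel off every term alike. *)
  rewrite (RInt_ext _ (fun th => (a * b * A) * P 2%nat 0%nat 2%nat th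
    + ((a * b * A * eps) * P 3%nat 0%nat 3%nat th
    + ((a * b * D) * P 0%nat 2%nat 2%nat th
    + ((a * b * D * eps) * P 1%nat 2%nat 3%nat th
    + ((a * b * M) * P 1%nat 1%nat 2%nat th
    + ((a * b * M * eps) * P 2%nat 1%nat 3%nat th + 0))))))).
  - rewrite (is_RInt_unique (V := R_CompleteNormedModule) _ _ _
      ((a * b * A) * (2 * PI / (1 + b)) + ((a * b * A * eps) * 0
      + ((a * b * D) * (2 * PI / (b * (1 + b))) + ((a * b * D * eps) * 0
      + ((a * b * M) * 0 + ((a * b * M * eps) * 0 + (2 * PI - 0) * 0))))))).
    + unfold vol_S1. assert (HP := PI_RGT_0). field. lra.
    + apply L; [now apply is_RInt_cos2_kz_s2|].
      apply L; [apply is_RInt_kz_odd; try assumption; now exists 1%nat|].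
      apply L; [now apply is_RInt_sin2_kz_s2|].
      apply L; [apply is_RInt_kz_odd; try assumption; now exists 1%nat|].
      apply L; [now apply is_RInt_kz_odd_sin|].
      apply L; [now apply is_RInt_kz_odd_sin|].
      apply (is_RInt_const (V := R_NormedModule)).
  - intros th _. rewrite lie_lie_reeb_kz by assumption.
    rewrite (proj2 (angle_volume_kz eps H0 H1)).
    assert (Hs := kz_s_pos eps th H0 H1). assert (Hf' := kz_phi_pos eps th H0 H1).
    assert (Hq := kz_s_sq eps th H0 H1). assert (C := cos2_sin2 th).
    fold A D M. unfold kz_alpha, P.
    fold a. fold b.
    set (s := kz_s eps th) in *. set (c := cos th) in *. set (n := sin th) in *.
    (* [(s - eps c) (s + eps c) = 1 - eps ^ 2] clears the Finsler norm from the denominator *)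
    assert (K : a / (s - eps * c) = s + eps * c).
    { replace a with ((s - eps * c) * (s + eps * c)); [field; lra|].
      transitivity (s ^ 2 - eps ^ 2 * c ^ 2); [ring|]. rewrite Hq.
      replace (n ^ 2) with (1 - c ^ 2) by lra. unfold a. ring. }
    transitivity (a * b * (s + eps * c) / s ^ 3 * (c ^ 2 * A + c * n * M + n ^ 2 * D)).
    + rewrite <- K. simpl. field. lra.
    + simpl. field. lra.
Qed.

(** * Integration over the unit square *)

Definition cont2 (u : R * R -> R) : Prop := forall q, continuous u q.

Lemma cont2_section (u : R * R -> R) (x y : R) :
  cont2 u -> continuous (fun y => u (x, y)) y.
Proof.
  intros Hu. apply (continuous_comp_2 (fun _ : R => x) (fun y : R => y) (fun x y => u (x, y))).
  - apply continuous_const.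
  - apply continuous_id.
  - apply (continuous_ext u); [now intros []|apply Hu].
Qed.

Lemma cont2_2d (u : R * R -> R) (x y : R) :
  cont2 u -> continuity_2d_pt (fun x y => u (x, y)) x y.
Proof.
  intros Hu. apply continuity_2d_pt_filterlim.
  apply (continuous_ext u (fun z => u (fst z, snd z))); [now intros []|apply Hu].
Qed.

Lemma ex_RInt_cont (g : R -> R) (a b : R) : (forall t, continuous g t) -> ex_RInt g a b.
Proof.
  intros Hg. apply (ex_RInt_continuous (V := R_CompleteNormedModule)). intros; apply Hg.
Qed.

(** Continuity at the segment over [x] is uniform by compactness, so the integrands over nearby
    abscissas are uniformly close. *)
Lemma continuous_RInt_section (u : R * R -> R) (a b x : R) : a <= b ->
  cont2 u -> continuous (fun x => RInt (fun y => u (x, y)) a b) x.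
Proof.
  intros Hab Hu. apply filterlim_locally. intros eps.
  (* Adding 1 keeps the denominator positive when [a = b] and makes the final estimate strict. *)
  assert (He : 0 < eps / (b - a + 1)).
  { apply Rdiv_lt_0_compat; [apply cond_pos|lra]. }
  destruct (uniform_continuity_2d_1d' (fun x y => u (x, y)) a b x
    (fun y _ => cont2_2d u x y Hu) (mkposreal _ He)) as [d Hd].
  exists d. intros x' Hx'.
  change (Rabs (RInt (fun y => u (x', y)) a b - RInt (fun y => u (x, y)) a b) < eps).
  change (Rabs (x' - x) < d) in Hx'. apply Rabs_lt_between in Hx'.
  assert (D : RInt (fun y => u (x', y)) a b - RInt (fun y => u (x, y)) a b
    = RInt (fun y => u (x', y) - u (x, y)) a b).
  { symmetry. apply (RInt_minus (V := R_CompleteNormedModule) (fun y => u (x', y))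
      (fun y => u (x, y))); apply ex_RInt_cont; intros; now apply cont2_section. }
  rewrite D.
  apply Rle_lt_trans with ((b - a) * (eps / (b - a + 1))).
  - apply (abs_RInt_le_const (fun y => u (x', y) - u (x, y))); [exact Hab| |].
    + apply ex_RInt_cont. intros t.
      apply (continuous_minus (fun y => u (x', y)) (fun y => u (x, y)));
      now apply cont2_section.
    + intros t Ht. assert (Pd := cond_pos d).
      apply Rlt_le. apply (Hd t x t x'); try lra.
      rewrite Rminus_diag, Rabs_R0. apply cond_pos.
  - apply (Rmult_lt_reg_r (b - a + 1)); [lra|].
    specialize (cond_pos eps). intros.
    replace ((b - a) * (eps / (b - a + 1)) * (b - a + 1)) with ((b - a) * eps)
      by (field; lra). lra.
Qed.

Definition sq_int (u : R * R -> R) : R :=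
  RInt (fun x => RInt (fun y => u (x, y)) 0 1) 0 1.

Lemma sq_int_ext (u v : R * R -> R) : (forall q, u q = v q) -> sq_int u = sq_int v.
Proof. intros H. unfold sq_int. apply RInt_ext. intros. apply RInt_ext. intros. apply H. Qed.

Lemma sq_int_plus (u v : R * R -> R) : cont2 u -> cont2 v ->
  sq_int (fun q => u q + v q) = sq_int u + sq_int v.
Proof.
  intros Hu Hv. unfold sq_int.
  rewrite <- (RInt_plus (V := R_CompleteNormedModule) (fun x => RInt (fun y => u (x, y)) 0 1)
    (fun x => RInt (fun y => v (x, y)) 0 1)).
  - apply RInt_ext. intros x _.
    apply (RInt_plus (V := R_CompleteNormedModule) (fun y => u (x, y)) (fun y => v (x, y)));
    apply ex_RInt_cont; intros; now apply cont2_section.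
  - apply ex_RInt_cont. intros. apply continuous_RInt_section; [lra|exact Hu].
  - apply ex_RInt_cont. intros. apply continuous_RInt_section; [lra|exact Hv].
Qed.

Lemma sq_int_scal (c : R) (u : R * R -> R) : cont2 u -> sq_int (fun q => c * u q) = c * sq_int u.
Proof.
  intros Hu. unfold sq_int.
  etransitivity; [|apply (RInt_scal (V := R_CompleteNormedModule)
    (fun x => RInt (fun y => u (x, y)) 0 1) 0 1 c)].
  - apply RInt_ext. intros x _.
    apply (RInt_scal (V := R_CompleteNormedModule) (fun y => u (x, y)));
    apply ex_RInt_cont; intros; now apply cont2_section.
  - apply ex_RInt_cont. intros. apply continuous_RInt_section; [lra|exact Hu].
Qed.

Lemma sq_int_le (u v : R * R -> R) : cont2 u -> cont2 v ->
  (forall q, u q <= v q) -> sq_int u <= sq_int v.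
Proof.
  intros Hu Hv H. unfold sq_int. apply RInt_le; [lra| | |].
  - apply ex_RInt_cont. intros. apply continuous_RInt_section; [lra|exact Hu].
  - apply ex_RInt_cont. intros. apply continuous_RInt_section; [lra|exact Hv].
  - intros x _. apply RInt_le; [lra| | |].
    + apply ex_RInt_cont; intros; now apply cont2_section.
    + apply ex_RInt_cont; intros; now apply cont2_section.
    + intros; apply H.
Qed.

Lemma sq_int_const (c : R) : sq_int (fun _ => c) = c.
Proof.
  unfold sq_int. rewrite (RInt_ext _ (fun _ => c)).
  - rewrite RInt_const. change ((1 - 0) * c = c). ring.
  - intros x _. rewrite RInt_const. change ((1 - 0) * c = c). ring.
Qed.

Lemma cont2_const (c : R) : cont2 (fun _ => c).
Proof. intros q. apply continuous_const. Qed.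

Lemma cont2_plus (u v : R * R -> R) : cont2 u -> cont2 v -> cont2 (fun q => u q + v q).
Proof. intros Hu Hv q. now apply (continuous_plus u v). Qed.

Lemma cont2_minus (u v : R * R -> R) : cont2 u -> cont2 v -> cont2 (fun q => u q - v q).
Proof. intros Hu Hv q. now apply (continuous_minus u v). Qed.

Lemma cont2_opp (u : R * R -> R) : cont2 u -> cont2 (fun q => - u q).
Proof. intros Hu q. now apply (continuous_opp u). Qed.

Lemma cont2_mult (u v : R * R -> R) : cont2 u -> cont2 v -> cont2 (fun q => u q * v q).
Proof. intros Hu Hv q. now apply (continuous_mult u v). Qed.

Lemma cont2_ext (u v : R * R -> R) : (forall q, u q = v q) -> cont2 u -> cont2 v.
Proof. intros H Hu q. now apply (continuous_ext u v). Qed.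

Lemma cont2_smooth (f : R * R -> R) :
  smooth_on (V := NR2) (fun _ => True) f -> cont2 f.
Proof. intros Hf q. now apply (smooth_on_continuous (V := NR2) _ f Hf). Qed.

Lemma RInt_eq0 (g : R -> R) (t : R) :
  (forall t, continuous g t) -> (forall t, 0 <= g t) -> RInt g 0 1 = 0 ->
  0 <= t <= 1 -> g t = 0.
Proof.
  intros Hc Hp HI Ht. destruct (Rle_lt_or_eq_dec _ _ (Hp t)) as [L|E]; [exfalso|now symmetry].
  destruct (proj1 (filterlim_locally _ _) (Hc t) (mkposreal _ L)) as [d Hd].
  assert (Pd := cond_pos d).
  (* The interval of positivity is cut down to the unit interval, since [t] may be an endpoint; it
     still has positive length. *)
  set (a := Rmax 0 (t - d / 2)). set (b := Rmin 1 (t + d / 2)).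
  assert (Ha : 0 <= a) by apply Rmax_l.
  assert (Hb : b <= 1) by apply Rmin_l.
  assert (Ha' : t - d / 2 <= a) by apply Rmax_r.
  assert (Hb' : b <= t + d / 2) by apply Rmin_r.
  assert (Hab : a < b).
  { apply Rmax_lub_lt; apply Rmin_glb_lt; lra. }
  assert (X : forall u v, ex_RInt g u v) by (intros; now apply ex_RInt_cont).
  assert (P : 0 < RInt g a b).
  { apply RInt_gt_0; [exact Hab| |intros; apply Hc].
    intros s Hs. assert (B : ball t d s).
    { change (Rabs (s - t) < d). apply Rabs_lt_between. lra. }
    specialize (Hd s B). change (Rabs (g s - g t) < g t) in Hd.
    apply Rabs_lt_between in Hd. lra. }
  assert (C1 := RInt_Chasles g 0 a 1 (X _ _) (X _ _)).
  assert (C2 := RInt_Chasles g a b 1 (X _ _) (X _ _)).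
  unfold plus in C1, C2; simpl in C1, C2.
  assert (Q1 := RInt_ge_0 g 0 a Ha (X _ _) (fun s _ => Hp s)).
  assert (Q2 := RInt_ge_0 g b 1 Hb (X _ _) (fun s _ => Hp s)).
  lra.
Qed.

Lemma sq_int_eq0 (u : R * R -> R) (x y : R) : cont2 u -> (forall q, 0 <= u q) ->
  sq_int u = 0 -> 0 <= x <= 1 -> 0 <= y <= 1 -> u (x, y) = 0.
Proof.
  intros Hu Hp HI Hx Hy.
  apply (RInt_eq0 (fun y => u (x, y))); [intros; now apply cont2_section|auto| |exact Hy].
  apply (RInt_eq0 (fun x => RInt (fun y => u (x, y)) 0 1)).
  - intros. apply continuous_RInt_section; [lra|exact Hu].
  - intros s. apply RInt_ge_0; [lra| |auto].
    apply ex_RInt_cont; intros; now apply cont2_section.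
  - exact HI.
  - exact Hx.
Qed.

(** * Integration by parts for periodic functions *)

Lemma RInt_derive_periodic (w w' : R -> R) :
  (forall t, is_derive w t (w' t)) -> (forall t, continuous w' t) -> w 1 = w 0 ->
  RInt w' 0 1 = 0.
Proof.
  intros Hd Hc E. apply (is_RInt_unique (V := R_CompleteNormedModule)).
  replace 0 with (minus (w 1) (w 0)) at 2.
  - apply (is_RInt_derive (V := R_CompleteNormedModule) w w'); auto.
  - rewrite E. apply (Rplus_opp_r (w 0)).
Qed.

Lemma sq_int_dy (w w' : R * R -> R) :
  (forall x y, is_derive (fun s => w (x, s)) y (w' (x, y))) -> cont2 w' ->
  (forall x, w (x, 1) = w (x, 0)) -> sq_int w' = 0.
Proof.
  intros Hd Hc E. unfold sq_int. rewrite (RInt_ext _ (fun _ => 0)).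
  - rewrite RInt_const. change ((1 - 0) * 0 = 0). ring.
  - intros x _. apply (RInt_derive_periodic (fun y => w (x, y))); auto.
    intros; now apply cont2_section.
Qed.

(** Unlike in [sq_int_dy], the derivative is in the outer variable, so it is first recognised as the
    derivative of the inner integral. *)
Lemma sq_int_dx (w w' : R * R -> R) :
  (forall x y, is_derive (fun s => w (s, y)) x (w' (x, y))) -> cont2 w -> cont2 w' ->
  (forall y, w (1, y) = w (0, y)) -> sq_int w' = 0.
Proof.
  intros Hd Hc Hc' E. unfold sq_int.
  apply (RInt_derive_periodic (fun x => RInt (fun y => w (x, y)) 0 1)).
  - intros x.
    rewrite (RInt_ext (fun y => w' (x, y)) (fun y => Derive (fun s => w (s, y)) x)).
    2:{ intros y _. symmetry. now apply is_derive_unique. }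
    apply (is_derive_RInt_param (fun s y => w (s, y))).
    + apply filter_forall. intros s t _. eexists. apply Hd.
    + intros t _. apply (continuity_2d_pt_ext (fun s y => w' (s, y))).
      * intros s y. symmetry. now apply is_derive_unique.
      * now apply cont2_2d.
    + apply filter_forall. intros s. apply ex_RInt_cont; intros; now apply cont2_section.
  - intros. apply continuous_RInt_section; [lra|exact Hc'].
  - apply RInt_ext. intros y _. apply E.
Qed.

(** In each variable the integrand is the derivative of the Wronskian [u' v - u v'], which is
    periodic. *)
Lemma sq_int_green (u v : R * R -> R) : smoothT u -> smoothT v ->
  sq_int (fun q => ddx (ddx u) q * v q - u q * ddx (ddx v) q) = 0 /\
  sq_int (fun q => ddy (ddy u) q * v q - u q * ddy (ddy v) q) = 0.
Proof.
  intros [Pu Su] [Pv Sv].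
  assert (Cu := cont2_smooth _ Su). assert (Cv := cont2_smooth _ Sv).
  assert (Pd : forall f (w : R * R), periodicT f -> periodicT (fun q : R * R => ddir f q w)).
  { intros f [a b] Pf x y. split; apply Derive_ext; intros t.
    - change (f (x + 1 + t * a, y + t * b) = f (x + t * a, y + t * b)).
      rewrite <- (proj1 (Pf (x + t * a) (y + t * b))). f_equal. f_equal. ring.
    - change (f (x + t * a, y + 1 + t * b) = f (x + t * a, y + t * b)).
      rewrite <- (proj2 (Pf (x + t * a) (y + t * b))). f_equal. f_equal. ring. }
  assert (Sd : forall f (w : R * R), smooth_on (V := NR2) (fun _ => True) f ->
    smooth_on (V := NR2) (fun _ => True) (fun q : R * R => ddir f q w)).
  { intros f w Sf. now apply (smooth_on_ddir (V := NR2)). }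
  split.
  - apply (sq_int_dx (fun q => ddx u q * v q - u q * ddx v q)).
    + intros x y.
      assert (A1 := smooth_partial_x u x y Su). assert (A2 := smooth_partial_x v x y Sv).
      assert (A3 := smooth_partial_x (ddx u) x y (Sd _ _ Su)).
      assert (A4 := smooth_partial_x (ddx v) x y (Sd _ _ Sv)).
      assert (M1 := is_derive_mult _ _ _ _ _ A3 A2 Rmult_comm).
      assert (M2 := is_derive_mult _ _ _ _ _ A1 A4 Rmult_comm).
      assert (M := is_derive_minus _ _ _ _ _ M1 M2).
      refine (eq_ind _ (is_derive _ _) M _ _).
      unfold minus, plus, opp, mult; simpl. ring.
    + apply cont2_minus; apply cont2_mult; auto; apply cont2_smooth; auto.
    + apply cont2_minus; apply cont2_mult; auto; apply cont2_smooth; auto.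
    + intros y. replace (1, y) with (0 + 1, y) by (f_equal; ring).
      rewrite (proj1 (Pu 0 y)), (proj1 (Pv 0 y)),
        (proj1 (Pd u (1, 0) Pu 0 y)), (proj1 (Pd v (1, 0) Pv 0 y)). reflexivity.
  - apply (sq_int_dy (fun q => ddy u q * v q - u q * ddy v q)).
    + intros x y.
      assert (A1 := smooth_partial_y u x y Su). assert (A2 := smooth_partial_y v x y Sv).
      assert (A3 := smooth_partial_y (ddy u) x y (Sd _ _ Su)).
      assert (A4 := smooth_partial_y (ddy v) x y (Sd _ _ Sv)).
      assert (M1 := is_derive_mult _ _ _ _ _ A3 A2 Rmult_comm).
      assert (M2 := is_derive_mult _ _ _ _ _ A1 A4 Rmult_comm).
      assert (M := is_derive_minus _ _ _ _ _ M1 M2).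
      refine (eq_ind _ (is_derive _ _) M _ _).
      unfold minus, plus, opp, mult; simpl. ring.
    + apply cont2_minus; apply cont2_mult; auto; apply cont2_smooth; auto.
    + intros x. replace (x, 1) with (x, 0 + 1) by (f_equal; ring).
      rewrite (proj2 (Pu x 0)), (proj2 (Pv x 0)),
        (proj2 (Pd u (0, 1) Pu x 0)), (proj2 (Pd v (0, 1) Pv x 0)). reflexivity.
Qed.

(** * Approximation by trigonometric polynomials *)

Lemma periodic_IZR {A : Type} (h : R -> A) : (forall x, h (x + 1) = h x) ->
  forall (x : R) (a : Z), h (x + IZR a) = h x.
Proof.
  intros Hh. assert (P : forall x (n : nat), h (x + INR n) = h x).
  { intros x n. induction n as [|n IH].
    - simpl. f_equal. ring.
    - rewrite S_INR, <- Rplus_assoc, Hh. exact IH. }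
  intros x a. destruct (Z.le_ge_cases 0 a) as [L|L].
  - rewrite <- (Z2Nat.id a L), <- INR_IZR_INZ. apply P.
  - rewrite <- (P (x + IZR a) (Z.to_nat (- a))). f_equal.
    rewrite INR_IZR_INZ, Z2Nat.id by lia. rewrite opp_IZR. ring.
Qed.

Lemma periodicT_IZR {A : Type} (g : R * R -> A) : periodicT g ->
  forall (x y : R) (a b : Z), g (x + IZR a, y + IZR b) = g (x, y).
Proof.
  intros Hg x y a b.
  rewrite (periodic_IZR (fun y => g (x + IZR a, y)) (fun y => proj2 (Hg _ y)) y b).
  apply (periodic_IZR (fun x => g (x, y)) (fun x => proj1 (Hg x y)) x a).
Qed.

Lemma cos_sin_2PI_IZR (t : R) (a : Z) :
  cos (t + 2 * PI * IZR a) = cos t /\ sin (t + 2 * PI * IZR a) = sin t.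
Proof.
  assert (P := PI_RGT_0).
  assert (H : forall s, (cos (2 * PI * (s + 1)), sin (2 * PI * (s + 1)))
    = (cos (2 * PI * s), sin (2 * PI * s))).
  { intros s. rewrite Rmult_plus_distr_l, Rmult_1_r, cos_plus, sin_plus, cos_2PI, sin_2PI.
    f_equal; ring. }
  assert (K := periodic_IZR (fun s => (cos (2 * PI * s), sin (2 * PI * s))) H
    (t / (2 * PI)) a).
  cbv beta in K.
  replace (2 * PI * (t / (2 * PI) + IZR a)) with (t + 2 * PI * IZR a) in K by (field; lra).
  replace (2 * PI * (t / (2 * PI))) with t in K by (field; lra).
  now injection K.
Qed.

Lemma floor_exists (x : R) : exists m : Z, 0 <= x - IZR m < 1.
Proof.
  exists (up x - 1)%Z. destruct (archimed x) as [A1 A2]. rewrite minus_IZR. lra.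
Qed.

(** A segment from the origin to a point of the unit square is cut into [S N] pieces short enough
    for uniform continuity, each changing [g] by less than 1; periodicity reduces every point to the
    square. *)
Lemma cont2_periodic_bounded (g : R * R -> R) : cont2 g -> periodicT g ->
  exists M, 0 < M /\ forall q, Rabs (g q) <= M.
Proof.
  intros Hc Hp.
  destruct (uniform_continuity_2d (fun x y => g (x, y)) 0 1 0 1
    (fun x y _ _ => cont2_2d g x y Hc) (mkposreal 1 Rlt_0_1)) as [d Hd].
  assert (Pd := cond_pos d). simpl in Hd.
  destruct (nfloor_ex (/ d)) as [N HN].
  { apply Rlt_le, Rinv_0_lt_compat, Pd. }
  assert (PN : 0 < INR (S N)) by apply lt_0_INR, Nat.lt_0_succ.
  assert (HN' : / INR (S N) < d).
  { rewrite <- (Rinv_inv d). apply Rinv_lt_contravar.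
    - apply Rmult_lt_0_compat; [now apply Rinv_0_lt_compat|exact PN].
    - rewrite S_INR. lra. }
  assert (K : forall x y, 0 <= x <= 1 -> 0 <= y <= 1 -> forall k, (k <= S N)%nat ->
    Rabs (g (x * (INR k / INR (S N)), y * (INR k / INR (S N))) - g (0, 0)) <= INR k).
  { intros x y Hx Hy k. induction k as [|k IH]; intros Hk.
    - change (INR 0) with 0. replace (0 / INR (S N)) with 0 by (field; lra).
      rewrite !Rmult_0_r, Rminus_diag, Rabs_R0. lra.
    - specialize (IH ltac:(lia)).
      assert (B : forall j, (j <= S N)%nat -> 0 <= INR j / INR (S N) <= 1).
      { intros j Hj. split.
        - apply Rmult_le_pos; [apply pos_INR|now apply Rlt_le, Rinv_0_lt_compat].
        - apply (Rmult_le_reg_r (INR (S N))); [exact PN|].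
          replace (INR j / INR (S N) * INR (S N)) with (INR j) by (field; lra).
          rewrite Rmult_1_l. now apply le_INR. }
      assert (B1 := B k ltac:(lia)). assert (B2 := B (S k) Hk).
      set (s := INR k / INR (S N)) in *. set (t := INR (S k) / INR (S N)) in *.
      assert (Est : t - s = / INR (S N)).
      { unfold t, s. rewrite (S_INR k). field. lra. }
      assert (Pi : 0 < / INR (S N)) by now apply Rinv_0_lt_compat.
      assert (T : Rabs (g (x * t, y * t) - g (x * s, y * s)) < 1).
      { apply Hd; try nra; apply Rabs_def1; nra. }
      rewrite S_INR.
      replace (g (x * t, y * t) - g (0, 0)) with
        ((g (x * t, y * t) - g (x * s, y * s)) + (g (x * s, y * s) - g (0, 0))) by ring.
      eapply Rle_trans; [apply Rabs_triang|]. lra. }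
  exists (INR (S N) + Rabs (g (0, 0))). split.
  { specialize (Rabs_pos (g (0, 0))). lra. }
  intros [x y]. destruct (floor_exists x) as [a Ha]. destruct (floor_exists y) as [b Hb].
  rewrite <- (periodicT_IZR g Hp x y (- a) (- b)), !opp_IZR.
  fold (Rminus x (IZR a)). fold (Rminus y (IZR b)).
  specialize (K (x - IZR a) (y - IZR b) ltac:(lra) ltac:(lra) (S N) (Nat.le_refl _)).
  replace (INR (S N) / INR (S N)) with 1 in K by (field; lra).
  rewrite !Rmult_1_r in K.
  replace (g (x - IZR a, y - IZR b)) with
    ((g (x - IZR a, y - IZR b) - g (0, 0)) + g (0, 0)) by ring.
  eapply Rle_trans; [apply Rabs_triang|]. lra.
Qed.

(* [sin (PI t) ^ 2] *)
Definition hav (t : R) : R := (1 - cos (2 * PI * t)) / 2.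

Lemma hav_pos (t : R) : 0 <= hav t.
Proof. unfold hav. specialize (COS_bound (2 * PI * t)). lra. Qed.

Lemma hav_IZR (t : R) (a : Z) : hav (t + IZR a) = hav t.
Proof.
  unfold hav. rewrite Rmult_plus_distr_l. now rewrite (proj1 (cos_sin_2PI_IZR _ a)).
Qed.

Lemma hav_ge (t d : R) : 0 < d -> d <= Rabs t -> Rabs t <= 1 / 2 ->
  0 < hav d <= hav t.
Proof.
  intros Hd Hdt Ht. assert (P := PI_RGT_0). unfold hav.
  replace (cos (2 * PI * t)) with (cos (2 * PI * Rabs t)).
  2:{ unfold Rabs. destruct (Rcase_abs t); [|reflexivity].
      rewrite <- (cos_neg (2 * PI * t)). f_equal. ring. }
  assert (C0 : cos (2 * PI * d) < cos 0) by (apply cos_decreasing_1; nra).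
  assert (C1 : cos (2 * PI * Rabs t) <= cos (2 * PI * d)) by (apply cos_decr_1; nra).
  rewrite cos_0 in C0. lra.
Qed.

Lemma nearest_shift (x : R) (u : R) : exists k : Z, Rabs (x - (u - IZR k)) <= 1 / 2.
Proof.
  exists (up (u - x - 1 / 2)). destruct (archimed (u - x - 1 / 2)) as [A1 A2].
  apply Rabs_le. lra.
Qed.

(** Points close on the torus are handled by uniform continuity; otherwise one [hav] is at least
    [hav d], and [K = 2 * M / hav d] makes the right side exceed the total oscillation. Distance is
    measured by [hav] because [hav t * bump n t = bump n t - bump (S n) t] has an explicit
    integral. *)
Lemma periodic_modulus (g : R * R -> R) (eta : R) : cont2 g -> periodicT g -> 0 < eta ->
  exists K, 0 <= K /\ forall z w : R * R,
    Rabs (g w - g z) <= eta + K * (hav (fst z - fst w) + hav (snd z - snd w)).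
Proof.
  intros Hc Hp He. destruct (cont2_periodic_bounded g Hc Hp) as [M [HM HB]].
  (* One point is moved into the unit square and the other to within 1/2 of it in each coordinate,
     so the second may leave that square but not this larger one. *)
  destruct (uniform_continuity_2d (fun x y => g (x, y)) (-1) 2 (-1) 2
    (fun x y _ _ => cont2_2d g x y Hc) (mkposreal eta He)) as [d' Hd']. simpl in Hd'.
  set (d := Rmin d' (1 / 2)).
  assert (Hd : 0 < d) by (apply Rmin_glb_lt; [apply cond_pos|lra]).
  assert (Hd1 : d <= d') by apply Rmin_l. assert (Hd2 : d <= 1 / 2) by apply Rmin_r.
  assert (Hm : 0 < hav d).
  { apply (hav_ge (1 / 2)); rewrite ?Rabs_pos_eq; lra. }
  assert (HK : 0 < 2 * M / hav d) by (apply Rdiv_lt_0_compat; lra).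
  exists (2 * M / hav d). split; [lra|].
  intros [x y] [u v]. cbn [fst snd].
  destruct (floor_exists x) as [a Ha]. destruct (floor_exists y) as [b Hb].
  destruct (nearest_shift (x - IZR a) u) as [k Hk].
  destruct (nearest_shift (y - IZR b) v) as [l Hl].
  rewrite <- (periodicT_IZR g Hp x y (- a) (- b)).
  rewrite <- (periodicT_IZR g Hp u v (- k) (- l)).
  rewrite <- (hav_IZR (x - u) (k - a)), <- (hav_IZR (y - v) (l - b)).
  rewrite !minus_IZR, !opp_IZR.
  replace (x - u + (IZR k - IZR a)) with ((x + - IZR a) - (u + - IZR k)) by ring.
  replace (y - v + (IZR l - IZR b)) with ((y + - IZR b) - (v + - IZR l)) by ring.
  fold (Rminus x (IZR a)) (Rminus y (IZR b)) (Rminus u (IZR k)) (Rminus v (IZR l)).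
  set (x' := x - IZR a) in *. set (y' := y - IZR b) in *.
  set (u' := u - IZR k) in *. set (v' := v - IZR l) in *.
  assert (P1 := hav_pos (x' - u')). assert (P2 := hav_pos (y' - v')).
  assert (B : Rabs (g (u', v') - g (x', y')) <= 2 * M).
  { unfold Rminus. eapply Rle_trans; [apply Rabs_triang|]. rewrite Rabs_Ropp.
    specialize (HB (u', v')) as B1. specialize (HB (x', y')) as B2. lra. }
  assert (far : forall t, hav d <= t -> 2 * M <= 2 * M / hav d * t).
  { intros t Ht. replace (2 * M) with (2 * M / hav d * hav d) at 1 by (field; lra).
    apply Rmult_le_compat_l; lra. }
  destruct (Rlt_or_le (Rabs (x' - u')) d) as [L1|L1].
  2:{ assert (Q := far (hav (x' - u') + hav (y' - v'))).
      destruct (hav_ge (x' - u') d Hd L1 Hk). lra. }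
  destruct (Rlt_or_le (Rabs (y' - v')) d) as [L2|L2].
  2:{ assert (Q := far (hav (x' - u') + hav (y' - v'))).
      destruct (hav_ge (y' - v') d Hd L2 Hl). lra. }
  assert (S : Rabs (g (u', v') - g (x', y')) < eta).
  { apply Rabs_le_between in Hk. apply Rabs_le_between in Hl.
    apply Hd'; try lra.
    - rewrite Rabs_minus_sym. lra.
    - rewrite Rabs_minus_sym. lra. }
  assert (0 <= 2 * M / hav d * (hav (x' - u') + hav (y' - v'))) by (apply Rmult_le_pos; lra).
  lra.
Qed.

(* [int_0^1 cos (PI t) ^ (2 n) dt] *)
Fixpoint wallis (n : nat) : R :=
  match n with
  | O => 1
  | S n => wallis n * ((2 * INR n + 1) / (2 * INR n + 2))
  end.

Lemma wallis_pos (n : nat) : 0 < wallis n.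
Proof.
  induction n as [|n IH]; simpl; [lra|].
  specialize (pos_INR n). intros. apply Rmult_lt_0_compat; [exact IH|].
  apply Rdiv_lt_0_compat; lra.
Qed.

(* [cos (PI t) ^ (2 n)] *)
Definition bump (n : nat) (t : R) : R := (1 - hav t) ^ n.

Lemma bump_pos (n : nat) (t : R) : 0 <= bump n t.
Proof. apply pow_le. unfold hav. specialize (COS_bound (2 * PI * t)). lra. Qed.

Lemma bump_continuous (n : nat) (x u : R) : continuous (fun u => bump n (x - u)) u.
Proof.
  apply (ex_derive_continuous (V := R_NormedModule)). unfold bump, hav. now auto_derive.
Qed.

(** The recursion of [wallis] comes from integrating, over one period, the derivative of [bump n]
    times the sine of the same argument, which vanishes by periodicity. *)
Lemma RInt_bump (n : nat) (x : R) : RInt (fun u => bump n (x - u)) 0 1 = wallis n.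
Proof.
  induction n as [|n IH].
  - unfold bump. rewrite (RInt_ext _ (fun _ => 1)) by reflexivity.
    rewrite RInt_const. change ((1 - 0) * 1 = 1). ring.
  - assert (P := PI_RGT_0). assert (Pn := pos_INR n).
    assert (Z : RInt (fun u => (2 * INR n + 1) * bump n (x - u)
      - (2 * INR n + 2) * bump (S n) (x - u)) 0 1 = 0).
    { apply (RInt_derive_periodic (fun u => / PI * (bump n (x - u) * sin (2 * PI * (x - u)) / 2))).
      - intros u. unfold bump, hav. auto_derive; [exact I|].
        set (c := cos (2 * PI * (x + - u))). set (s := sin (2 * PI * (x + - u))).
        assert (E : s * s = (1 - c) * (1 + c)).
        { specialize (cos2_sin2 (2 * PI * (x + - u))). fold c s. simpl. lra. }
        unfold Rminus. fold c s.
        replace (1 + - ((1 + - c) * / 2)) with ((1 + c) / 2) by field.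
        replace (1 + - ((1 + - c) / 2)) with ((1 + c) / 2) by field.
        (* The derivative of the power contains the exponent [pred n], so [n = 0] is treated
           apart. *)
        destruct n as [|n].
        + simpl. field. lra.
        + cbn [pred]. set (N := INR (S n)) in *. rewrite <- !tech_pow_Rmult.
          set (k := (1 + c) / 2). set (kn := k ^ n).
          transitivity (/ 2 * (N * kn * (s * s) - 2 * (k * kn) * c)).
          { field. lra. }
          rewrite E. replace (1 + c) with (2 * k) by (unfold k; field).
          replace c with (2 * k - 1) by (unfold k; field). field.
      - intros u. apply (continuous_minus (fun u => (2 * INR n + 1) * bump n (x - u))
          (fun u => (2 * INR n + 2) * bump (S n) (x - u))).
        + apply (continuous_scal_r (2 * INR n + 1) (fun u => bump n (x - u))).
          apply bump_continuous.
        + apply (continuous_scal_r (2 * INR n + 2) (fun u => bump (S n) (x - u))).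
          apply bump_continuous.
      - replace (2 * PI * (x - 1)) with (2 * PI * x + 2 * PI * IZR (-1)) by ring.
        rewrite (proj2 (cos_sin_2PI_IZR _ (-1))). unfold bump.
        replace (x - 1) with (x + IZR (-1)) by ring.
        rewrite hav_IZR, Rminus_0_r. reflexivity. }
    assert (D : RInt (fun u => (2 * INR n + 1) * bump n (x - u)
      - (2 * INR n + 2) * bump (S n) (x - u)) 0 1 =
      (2 * INR n + 1) * RInt (fun u => bump n (x - u)) 0 1
      - (2 * INR n + 2) * RInt (fun u => bump (S n) (x - u)) 0 1).
    { apply (is_RInt_unique (V := R_CompleteNormedModule)).
      apply (is_RInt_minus (V := R_NormedModule) (fun u => (2 * INR n + 1) * bump n (x - u))
        (fun u => (2 * INR n + 2) * bump (S n) (x - u))).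
      - apply (is_RInt_scal (V := R_NormedModule) (fun u => bump n (x - u))).
        apply (RInt_correct (V := R_CompleteNormedModule)), ex_RInt_cont, bump_continuous.
      - apply (is_RInt_scal (V := R_NormedModule) (fun u => bump (S n) (x - u))).
        apply (RInt_correct (V := R_CompleteNormedModule)), ex_RInt_cont, bump_continuous. }
    rewrite D, IH in Z. simpl wallis.
    apply (Rmult_eq_reg_l (2 * INR n + 2)); [|lra].
    transitivity ((2 * INR n + 1) * wallis n); [lra|]. field. lra.
Qed.

(** * Uniform approximation by convolution *)

Lemma sq_int_prod (g h : R -> R) : (forall t, continuous g t) -> (forall t, continuous h t) ->
  sq_int (fun q => g (fst q) * h (snd q)) = RInt g 0 1 * RInt h 0 1.
Proof.
  intros Hg Hh. unfold sq_int. cbn [fst snd].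
  rewrite (RInt_ext _ (fun x => scal (RInt h 0 1) (g x))).
  - rewrite Rmult_comm. apply (RInt_scal (V := R_CompleteNormedModule)).
    now apply ex_RInt_cont.
  - intros x _. change (RInt (fun y => scal (g x) (h y)) 0 1 = RInt h 0 1 * g x).
    rewrite Rmult_comm. apply (RInt_scal (V := R_CompleteNormedModule)).
    now apply ex_RInt_cont.
Qed.

(** The de la Vallee-Poussin kernel in two variables, before normalisation; its mass is
    [wallis n * wallis n]. *)
Definition kernel (n : nat) (z w : R * R) : R :=
  bump n (fst z - fst w) * bump n (snd z - snd w).

Lemma cont2_bump (m n : nat) (z : R * R) :
  cont2 (fun w => bump m (fst z - fst w) * bump n (snd z - snd w)).
Proof.
  apply cont2_mult.
  - intros w. apply (continuous_comp fst (fun u => bump m (fst z - u))).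
    + apply continuous_fst.
    + apply bump_continuous.
  - intros w. apply (continuous_comp snd (fun u => bump n (snd z - u))).
    + apply continuous_snd.
    + apply bump_continuous.
Qed.

Lemma sq_int_bump (m n : nat) (z : R * R) :
  sq_int (fun w => bump m (fst z - fst w) * bump n (snd z - snd w)) = wallis m * wallis n.
Proof.
  rewrite (sq_int_prod (fun u => bump m (fst z - u)) (fun v => bump n (snd z - v)))
    by apply bump_continuous.
  now rewrite !RInt_bump.
Qed.

Lemma sq_int_abs_le (u v : R * R -> R) : cont2 u -> cont2 v ->
  (forall q, Rabs (u q) <= v q) -> Rabs (sq_int u) <= sq_int v.
Proof.
  intros Hu Hv H.
  assert (A1 : sq_int u <= sq_int v).
  { apply sq_int_le; auto. intros q. specialize (H q). apply Rabs_le_between in H. lra. }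
  assert (A2 : sq_int (fun q => -1 * u q) <= sq_int v).
  { apply sq_int_le; auto.
    - apply cont2_mult; [apply cont2_const|exact Hu].
    - intros q. specialize (H q). apply Rabs_le_between in H. lra. }
  rewrite sq_int_scal in A2 by exact Hu. apply Rabs_le. lra.
Qed.

(** The modulus bound is integrated against the kernel. Each [hav] turns one [bump n] into
    [bump n - bump (S n)], and [wallis (S n) / wallis n = 1 - 1 / (2 n + 2)], so after normalisation
    the error is at most [e / 2 + K / (n + 1)]. *)
Lemma kernel_approx (g : R * R -> R) (e : R) : cont2 g -> periodicT g -> 0 < e ->
  exists n, forall z,
    Rabs (/ (wallis n * wallis n) * sq_int (fun w => g w * kernel n z w) - g z) <= e.
Proof.
  intros Hc Hp He. destruct (periodic_modulus g (e / 2) Hc Hp) as [K [HK Hmod]]; [lra|].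
  (* This [n] satisfies [n + 1 > 2 * K / e], which makes the second error term at most [e / 2]. *)
  destruct (nfloor_ex (2 * K / e)) as [n Hn].
  { apply Rmult_le_pos; [lra|]. now apply Rlt_le, Rinv_0_lt_compat. }
  exists n. intros z. assert (Wp := wallis_pos n). set (W := wallis n) in *.
  assert (Ck : cont2 (kernel n z)) by apply cont2_bump.
  assert (E1 : sq_int (fun w => g w * kernel n z w) - W * W * g z
    = sq_int (fun w => (g w - g z) * kernel n z w)).
  { rewrite (sq_int_ext (fun w => (g w - g z) * kernel n z w)
      (fun w => g w * kernel n z w + (- g z) * kernel n z w)) by (intros; ring).
    rewrite sq_int_plus, sq_int_scal; auto.
    - unfold kernel at 3. rewrite sq_int_bump. fold W. ring.
    - now apply cont2_mult.
    - apply cont2_mult; [apply cont2_const|exact Ck]. }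
  assert (E2 : Rabs (sq_int (fun w => (g w - g z) * kernel n z w)) <=
    (e / 2 + 2 * K) * (W * W) - K * (2 * (W * wallis (S n)))).
  { replace ((e / 2 + 2 * K) * (W * W) - K * (2 * (W * wallis (S n)))) with
      (sq_int (fun w => (e / 2 + 2 * K) * kernel n z w + (- K) *
        (bump (S n) (fst z - fst w) * bump n (snd z - snd w)
        + bump n (fst z - fst w) * bump (S n) (snd z - snd w)))).
    2:{ rewrite sq_int_plus, !sq_int_scal, sq_int_plus, !sq_int_bump; auto;
        try (apply cont2_mult; [apply cont2_const|]); auto;
        try apply cont2_plus; try apply cont2_bump.
        unfold kernel. rewrite sq_int_bump. fold W. ring. }
    apply sq_int_abs_le.
    - apply cont2_mult; [|exact Ck]. apply cont2_minus; [exact Hc|apply cont2_const].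
    - apply cont2_plus; (apply cont2_mult; [apply cont2_const|]); [exact Ck|].
      apply cont2_plus; apply cont2_bump.
    - intros w. rewrite Rabs_mult.
      assert (Kp : 0 <= kernel n z w) by (apply Rmult_le_pos; apply bump_pos).
      rewrite (Rabs_pos_eq _ Kp).
      apply Rle_trans with ((e / 2 + K * (hav (fst z - fst w) + hav (snd z - snd w)))
        * kernel n z w).
      + now apply Rmult_le_compat_r.
      + right. unfold kernel, bump. simpl. ring. }
  assert (Pn := pos_INR n).
  assert (E3 : (e / 2 + 2 * K) * (W * W) - K * (2 * (W * wallis (S n)))
    = W * W * (e / 2 + K / (INR n + 1))).
  { simpl wallis. fold W. field. lra. }
  assert (E4 : K / (INR n + 1) <= e / 2).
  { apply (Rmult_le_reg_r (INR n + 1)); [lra|].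
    replace (K / (INR n + 1) * (INR n + 1)) with K by (field; lra).
    assert (2 * K / e * e <= (INR n + 1) * e) by (apply Rmult_le_compat_r; lra).
    replace (2 * K / e * e) with (2 * K) in H by (field; lra). lra. }
  replace (/ (W * W) * sq_int (fun w => g w * kernel n z w) - g z) with
    (/ (W * W) * sq_int (fun w => (g w - g z) * kernel n z w)) by (rewrite <- E1; field; lra).
  assert (PW : 0 < W * W) by nra.
  rewrite Rabs_mult, Rabs_pos_eq by (apply Rlt_le, Rinv_0_lt_compat, PW).
  apply (Rmult_le_reg_l (W * W)); [exact PW|].
  rewrite <- Rmult_assoc, Rinv_r, Rmult_1_l by lra.
  rewrite E3 in E2. eapply Rle_trans; [exact E2|].
  apply Rmult_le_compat_l; lra.
Qed.

(** * Trigonometric polynomials *)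

Definition phase (i : Z * Z) (q : R * R) : R :=
  2 * PI * (IZR (fst i) * fst q + IZR (snd i) * snd q).

Definition expi (i : Z * Z) (q : R * R) : C := (cos (phase i q), sin (phase i q)).

(** Frequencies and coefficients are kept apart so that diagonal operators, such as derivatives and
    their inverses, change [c] and leave [l] alone. Distinctness of the frequencies is a separate
    hypothesis, needed for orthogonality. *)
Definition tpoly (l : list (Z * Z)) (c : Z * Z -> C) (q : R * R) : C :=
  fold_right (fun i s => (c i * expi i q + s)%C) 0%C l.

Lemma C_ext (z w : C) : fst z = fst w -> snd z = snd w -> z = w.
Proof. apply injective_projections. Qed.

Lemma tpoly_ext (l : list (Z * Z)) (c c' : Z * Z -> C) (q : R * R) :
  (forall i, In i l -> c i = c' i) -> tpoly l c q = tpoly l c' q.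
Proof.
  induction l as [|i l IH]; intros H; [reflexivity|]. simpl.
  rewrite (H i (or_introl eq_refl)), IH; [reflexivity|]. intros j Hj. apply H. now right.
Qed.

Lemma tpoly_plus (l : list (Z * Z)) (c c' : Z * Z -> C) (q : R * R) :
  tpoly l (fun i => (c i + c' i)%C) q = (tpoly l c q + tpoly l c' q)%C.
Proof.
  induction l as [|i l IH]; simpl; [ring|]. rewrite IH. ring.
Qed.

Lemma tpoly_scal (l : list (Z * Z)) (a : C) (c : Z * Z -> C) (q : R * R) :
  tpoly l (fun i => (a * c i)%C) q = (a * tpoly l c q)%C.
Proof.
  induction l as [|i l IH]; simpl; [ring|]. rewrite IH. ring.
Qed.

Lemma index_eq_dec (i j : Z * Z) : {i = j} + {i <> j}.
Proof. decide equality; apply Z.eq_dec. Qed.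

Lemma tpoly_single (l : list (Z * Z)) (i : Z * Z) (a : C) (q : R * R) : NoDup l -> In i l ->
  tpoly l (fun j => if index_eq_dec j i then a else 0%C) q = (a * expi i q)%C.
Proof.
  induction l as [|j l IH]; intros Hl Hi; [easy|]. inversion_clear Hl as [|? ? Hj Hl'].
  simpl. destruct (index_eq_dec j i) as [->|N].
  - rewrite (tpoly_ext l _ (fun _ => (0 * 0)%C)).
    + rewrite (tpoly_scal l 0%C (fun _ => 0%C)). ring.
    + intros k Hk. destruct (index_eq_dec k i) as [->|]; [now elim Hj|]. ring.
  - rewrite IH; [ring|exact Hl'|]. now destruct Hi.
Qed.

(** The closure properties, products above all, are proved for this description by generators;
    computations use the normal form [tpoly]. *)
Inductive trigpoly : (R * R -> C) -> Prop :=
| trigpoly_exp a i : trigpoly (fun q => (a * expi i q)%C)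
| trigpoly_plus f g : trigpoly f -> trigpoly g -> trigpoly (fun q => (f q + g q)%C)
| trigpoly_ext f g : (forall q, f q = g q) -> trigpoly f -> trigpoly g.

Lemma trigpoly_normal_form (f : R * R -> C) : trigpoly f ->
  exists l c, NoDup l /\ forall q, f q = tpoly l c q.
Proof.
  (* The statement is strengthened by an accumulated sum, so that a new exponential is merged with
     an old one of the same frequency and [NoDup] is preserved. *)
  intros Hf. assert (K : forall l c, NoDup l -> exists l' c', NoDup l' /\
    forall q, (f q + tpoly l c q)%C = tpoly l' c' q).
  { induction Hf as [a i|f g _ IHf _ IHg|f g E _ IH]; intros l c Hl.
    - destruct (in_dec index_eq_dec i l) as [Hi|Hi].
      (* The frequency already occurs: the new coefficients are the old ones plus a function
         supported at [i], read off from [tpoly_plus]. *)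
      + exists l. eexists. split; [exact Hl|]. intros q.
        rewrite <- (tpoly_single l i a q Hl Hi), <- tpoly_plus. reflexivity.
      + exists (i :: l), (fun j => if index_eq_dec j i then a else c j).
        split; [now constructor|]. intros q. simpl.
        destruct (index_eq_dec i i) as [_|]; [|easy]. f_equal. apply tpoly_ext.
        intros j Hj. now destruct (index_eq_dec j i) as [->|].
    - destruct (IHg l c Hl) as (l1 & c1 & H1 & E1).
      destruct (IHf l1 c1 H1) as (l2 & c2 & H2 & E2).
      exists l2, c2. split; [exact H2|]. intros q. rewrite <- E2, <- E1. ring.
    - destruct (IH l c Hl) as (l' & c' & H' & E'). exists l', c'. split; [exact H'|].
      intros q. now rewrite <- E, E'. }
  destruct (K nil (fun _ => 0%C) (NoDup_nil _)) as (l & c & Hl & E).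
  exists l, c. split; [exact Hl|]. intros q. rewrite <- E. simpl. ring.
Qed.

Lemma expi_mult (i j : Z * Z) (q : R * R) :
  (expi i q * expi j q)%C = expi (fst i + fst j, snd i + snd j)%Z q.
Proof.
  assert (E : phase (fst i + fst j, snd i + snd j)%Z q = phase i q + phase j q).
  { unfold phase. cbn [fst snd]. rewrite !plus_IZR. ring. }
  unfold expi. rewrite E, cos_plus, sin_plus. apply C_ext; simpl; ring.
Qed.

Lemma trigpoly_scal (a : C) (f : R * R -> C) : trigpoly f -> trigpoly (fun q => (a * f q)%C).
Proof.
  induction 1 as [b i|f g _ IHf _ IHg|f g E _ IH].
  - apply (trigpoly_ext (fun q => ((a * b) * expi i q)%C)); [intros; ring|apply trigpoly_exp].
  - apply (trigpoly_ext (fun q => (a * f q + a * g q)%C)); [intros; ring|now apply trigpoly_plus].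
  - apply (trigpoly_ext (fun q => (a * f q)%C)); [intros; now rewrite E|exact IH].
Qed.

Lemma trigpoly_mult (f g : R * R -> C) : trigpoly f -> trigpoly g -> trigpoly (fun q => (f q * g q)%C).
Proof.
  intros Hf Hg. induction Hf as [a i|f f' _ IHf _ IHf'|f f' E _ IH].
  - induction Hg as [b j|g g' _ IHg _ IHg'|g g' E _ IH].
    + apply (trigpoly_ext (fun q => ((a * b) * expi (fst i + fst j, snd i + snd j)%Z q)%C));
        [|apply trigpoly_exp]. intros q. rewrite <- expi_mult. ring.
    + apply (trigpoly_ext (fun q => (a * expi i q * g q + a * expi i q * g' q)%C));
        [intros; ring|now apply trigpoly_plus].
    + apply (trigpoly_ext (fun q => (a * expi i q * g q)%C)); [intros; now rewrite E|exact IH].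
  - apply (trigpoly_ext (fun q => (f q * g q + f' q * g q)%C)); [intros; ring|now apply trigpoly_plus].
  - apply (trigpoly_ext (fun q => (f q * g q)%C)); [intros; now rewrite E|exact IH].
Qed.

Lemma trigpoly_const (a : C) : trigpoly (fun _ => a).
Proof.
  apply (trigpoly_ext (fun q => (a * expi (0, 0)%Z q)%C)); [|apply trigpoly_exp].
  intros q. unfold expi, phase. cbn [fst snd].
  replace (2 * PI * (0 * fst q + 0 * snd q)) with 0 by ring. rewrite cos_0, sin_0.
  apply C_ext; simpl; ring.
Qed.

Lemma trigpoly_cos_sin (i : Z * Z) :
  trigpoly (fun q => RtoC (cos (phase i q))) /\ trigpoly (fun q => RtoC (sin (phase i q))).
Proof.
  assert (E : forall q, phase (- fst i, - snd i)%Z q = - phase i q).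
  { intros q. unfold phase. cbn [fst snd]. rewrite !opp_IZR. ring. }
  split.
  - apply (trigpoly_ext (fun q => (RtoC (/ 2)%R * expi i q + RtoC (/ 2)%R * expi (- fst i, - snd i)%Z q)%C)).
    + intros q. unfold expi. rewrite E, cos_neg, sin_neg. apply C_ext; simpl; field.
    + apply trigpoly_plus; apply trigpoly_exp.
  - apply (trigpoly_ext (fun q => ((RtoC (- / 2)%R * Ci) * expi i q + (RtoC (/ 2)%R * Ci) * expi (- fst i, - snd i)%Z q)%C)).
    + intros q. unfold expi. rewrite E, cos_neg, sin_neg. apply C_ext; simpl; field.
    + apply trigpoly_plus; apply trigpoly_exp.
Qed.

(** * Degenerate kernels and density of trigonometric polynomials *)

Definition contC (f : R * R -> C) : Prop :=
  cont2 (fun q => fst (f q)) /\ cont2 (fun q => snd (f q)).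

(** Kernels of finite rank, trigonometric in [z] and merely continuous in [w]. Integrating one
    against any continuous function of [w] leaves a finite combination of its [z] factors, hence a
    trigonometric polynomial. *)
Inductive separable : (R * R -> R * R -> C) -> Prop :=
| separable_prod A (B : R * R -> R) : trigpoly A -> cont2 B -> separable (fun z w => (A z * RtoC (B w))%C)
| separable_plus k k' : separable k -> separable k' -> separable (fun z w => (k z w + k' z w)%C)
| separable_ext k k' : (forall z w, k z w = k' z w) -> separable k -> separable k'.

Lemma separable_mult (k k' : R * R -> R * R -> C) : separable k -> separable k' ->
  separable (fun z w => (k z w * k' z w)%C).
Proof.
  intros Hk Hk'. induction Hk as [A B HA HB|k1 k2 _ IH1 _ IH2|k1 k2 E _ IH].
  - induction Hk' as [A' B' HA' HB'|k1 k2 _ IH1 _ IH2|k1 k2 E _ IH].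
    + apply (separable_ext (fun z w => ((A z * A' z) * RtoC (B w * B' w))%C)).
      * intros z w. rewrite RtoC_mult. ring.
      * apply (separable_prod (fun z => (A z * A' z)%C) (fun w => B w * B' w)).
        -- now apply trigpoly_mult.
        -- now apply cont2_mult.
    + apply (separable_ext (fun z w => (A z * RtoC (B w) * k1 z w + A z * RtoC (B w) * k2 z w)%C));
        [intros; ring|now apply separable_plus].
    + apply (separable_ext (fun z w => (A z * RtoC (B w) * k1 z w)%C));
        [intros; now rewrite E|exact IH].
  - apply (separable_ext (fun z w => (k1 z w * k' z w + k2 z w * k' z w)%C));
        [intros; ring|now apply separable_plus].
  - apply (separable_ext (fun z w => (k1 z w * k' z w)%C)); [intros; now rewrite E|exact IH].
Qed.

Lemma separable_cont (k : R * R -> R * R -> C) (z : R * R) : separable k -> contC (k z).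
Proof.
  induction 1 as [A B HA HB|k1 k2 _ [A1 A2] _ [B1 B2]|k1 k2 E _ [A1 A2]]; split.
  - apply (cont2_ext (fun w => fst (A z) * B w)); [intros; simpl; ring|].
    apply cont2_mult; [apply cont2_const|exact HB].
  - apply (cont2_ext (fun w => snd (A z) * B w)); [intros; simpl; ring|].
    apply cont2_mult; [apply cont2_const|exact HB].
  - now apply (cont2_plus (fun w => fst (k1 z w)) (fun w => fst (k2 z w))).
  - now apply (cont2_plus (fun w => snd (k1 z w)) (fun w => snd (k2 z w))).
  - apply (cont2_ext (fun w => fst (k1 z w))); [intros; now rewrite E|exact A1].
  - apply (cont2_ext (fun w => snd (k1 z w))); [intros; now rewrite E|exact A2].
Qed.

Lemma separable_integral (k : R * R -> R * R -> C) (g : R * R -> R) : cont2 g -> separable k ->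
  trigpoly (fun z => (sq_int (fun w => g w * fst (k z w)), sq_int (fun w => g w * snd (k z w)))).
Proof.
  intros Hg. induction 1 as [A B HA HB|k1 k2 S1 IH1 S2 IH2|k1 k2 E _ IH].
  - apply (trigpoly_ext (fun z => (RtoC (sq_int (fun w => (g w * B w)%R)) * A z)%C)).
    + assert (Hc : cont2 (fun w => g w * B w)) by now apply cont2_mult.
      intros z. apply C_ext; simpl.
      * rewrite Rmult_0_l, Rminus_0_r, Rmult_comm, <- sq_int_scal by exact Hc.
        apply sq_int_ext. intros; ring.
      * rewrite Rmult_0_l, Rplus_0_r, Rmult_comm, <- sq_int_scal by exact Hc.
        apply sq_int_ext. intros; ring.
    + now apply trigpoly_scal.
  - eapply trigpoly_ext; [|apply trigpoly_plus; [exact IH1|exact IH2]].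
    intros z. destruct (separable_cont k1 z S1) as [A1 A2]. destruct (separable_cont k2 z S2) as [B1 B2].
    apply C_ext; simpl; rewrite <- sq_int_plus; try (now apply cont2_mult);
    apply sq_int_ext; intros; ring.
  - eapply trigpoly_ext; [|exact IH]. intros z. cbv beta.
    f_equal; apply sq_int_ext; intros; now rewrite E.
Qed.

Lemma cont2_phase (i : Z * Z) : cont2 (fun q => cos (phase i q)) /\ cont2 (fun q => sin (phase i q)).
Proof.
  assert (E : cont2 (phase i)).
  { apply (cont2_ext (fun q => 2 * PI * (IZR (fst i) * fst q + IZR (snd i) * snd q)));
      [reflexivity|].
    apply cont2_mult; [apply cont2_const|]. apply cont2_plus; apply cont2_mult;
    try apply cont2_const; intros q; [apply continuous_fst|apply continuous_snd]. }
  split; intros q.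
  - apply (continuous_comp (phase i) cos); [apply E|apply continuous_cos].
  - apply (continuous_comp (phase i) sin); [apply E|apply continuous_sin].
Qed.

Lemma separable_cos_phase (i : Z * Z) :
  separable (fun z w => RtoC (cos (phase i z - phase i w))).
Proof.
  apply (separable_ext (fun z w => (RtoC (cos (phase i z)) * RtoC (cos (phase i w))
    + RtoC (sin (phase i z)) * RtoC (sin (phase i w)))%C)).
  - intros z w. rewrite cos_minus, RtoC_plus, !RtoC_mult. reflexivity.
  - apply separable_plus.
    + apply (separable_prod (fun z => RtoC (cos (phase i z))) (fun w => cos (phase i w)));
      [apply trigpoly_cos_sin|apply cont2_phase].
    + apply (separable_prod (fun z => RtoC (sin (phase i z))) (fun w => sin (phase i w)));
      [apply trigpoly_cos_sin|apply cont2_phase].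
Qed.

Lemma separable_const (a : R) : separable (fun _ _ => RtoC a).
Proof.
  apply (separable_ext (fun _ _ => (RtoC a * RtoC 1)%C)); [intros; ring|].
  apply (separable_prod (fun _ => RtoC a) (fun _ => 1)); [apply trigpoly_const|apply cont2_const].
Qed.

Lemma separable_pow (k : R * R -> R * R -> R) (n : nat) : separable (fun z w => RtoC (k z w)) ->
  separable (fun z w => RtoC (k z w ^ n)).
Proof.
  intros Hk. induction n as [|n IH]; [apply (separable_const 1)|].
  apply (separable_ext (fun z w => (RtoC (k z w) * RtoC (k z w ^ n))%C)).
  - intros z w. now rewrite <- RtoC_mult.
  - now apply separable_mult.
Qed.

(** [1 - hav] is half of one plus the cosine of a phase difference, for the frequencies (1, 0) and
    (0, 1); the cosine of a difference splits by the addition formula. *)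
Lemma separable_kernel (n : nat) : separable (fun z w => RtoC (kernel n z w)).
Proof.
  assert (K : forall i, separable (fun z w => RtoC ((/ 2 + / 2 * cos (phase i z - phase i w)) ^ n))).
  { intros i. apply separable_pow.
    apply (separable_ext (fun z w => (RtoC (/ 2) + RtoC (/ 2) * RtoC (cos (phase i z - phase i w)))%C)).
    - intros z w. now rewrite <- RtoC_mult, <- RtoC_plus.
    - apply separable_plus; [apply separable_const|]. apply separable_mult; [apply separable_const|apply separable_cos_phase]. }
  eapply separable_ext; [|apply separable_mult; [apply (K (1, 0)%Z)|apply (K (0, 1)%Z)]].
  intros z w. cbv beta. rewrite <- RtoC_mult. f_equal. unfold kernel, bump, hav, phase.
  cbn [fst snd]. f_equal; f_equal.
  - replace (2 * PI * (1 * fst z + 0 * snd z) - 2 * PI * (1 * fst w + 0 * snd w)) with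
      (2 * PI * (fst z - fst w)) by ring. field.
  - replace (2 * PI * (0 * fst z + 1 * snd z) - 2 * PI * (0 * fst w + 1 * snd w)) with
      (2 * PI * (snd z - snd w)) by ring. field.
Qed.

Lemma trigpoly_approx_real (g : R * R -> R) (e : R) : cont2 g -> periodicT g -> 0 < e ->
  exists f : R * R -> R, trigpoly (fun q => RtoC (f q)) /\ forall q, Rabs (f q - g q) <= e.
Proof.
  intros Hc Hp He. destruct (kernel_approx g e Hc Hp He) as [n Hn].
  exists (fun z => / (wallis n * wallis n) * sq_int (fun w => g w * kernel n z w)).
  split; [|exact Hn].
  apply (trigpoly_ext (fun z => (RtoC (/ (wallis n * wallis n))%R *
    (sq_int (fun w => (g w * fst (RtoC (kernel n z w)))%R),
     sq_int (fun w => (g w * snd (RtoC (kernel n z w)))%R)))%C)).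
  - intros z.
    assert (Z0 : sq_int (fun w => g w * snd (RtoC (kernel n z w))) = 0).
    { rewrite (sq_int_ext _ (fun _ => 0)); [apply sq_int_const|]. intros; simpl; ring. }
    rewrite Z0. rewrite RtoC_mult. reflexivity.
  - apply trigpoly_scal. apply (separable_integral (fun z w => RtoC (kernel n z w)) g Hc), separable_kernel.
Qed.

Lemma tpoly_approx (g : R * R -> C) (e : R) : contC g -> periodicT g -> 0 < e ->
  exists l c, NoDup l /\ forall q, Rabs (fst (tpoly l c q) - fst (g q)) <= e /\
    Rabs (snd (tpoly l c q) - snd (g q)) <= e.
Proof.
  intros [C1 C2] Hp He.
  destruct (trigpoly_approx_real (fun q => fst (g q)) e C1) as (f1 & T1 & E1); [|exact He|].
  { intros x y. destruct (Hp x y) as [A B]. now rewrite A, B. }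
  destruct (trigpoly_approx_real (fun q => snd (g q)) e C2) as (f2 & T2 & E2); [|exact He|].
  { intros x y. destruct (Hp x y) as [A B]. now rewrite A, B. }
  destruct (trigpoly_normal_form (fun q => (RtoC (f1 q) + Ci * RtoC (f2 q))%C)) as (l & c & Hl & E).
  { apply trigpoly_plus; [exact T1|]. now apply trigpoly_scal. }
  exists l, c. split; [exact Hl|]. intros q. rewrite <- E. simpl.
  replace (f1 q + (0 * f2 q - 1 * 0)) with (f1 q) by ring.
  replace (0 + (0 * 0 + 1 * f2 q)) with (f2 q) by ring. split; [apply E1|apply E2].
Qed.

(** * The operator on trigonometric polynomials *)

Lemma expi_periodic (i : Z * Z) : periodicT (expi i).
Proof.
  intros x y. unfold expi.
  assert (E1 : phase i (x + 1, y) = phase i (x, y) + 2 * PI * IZR (fst i)).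
  { unfold phase. cbn [fst snd]. ring. }
  assert (E2 : phase i (x, y + 1) = phase i (x, y) + 2 * PI * IZR (snd i)).
  { unfold phase. cbn [fst snd]. ring. }
  rewrite E1, E2, !(proj1 (cos_sin_2PI_IZR _ _)), !(proj2 (cos_sin_2PI_IZR _ _)).
  now split.
Qed.

Lemma tpoly_periodic (l : list (Z * Z)) (c : Z * Z -> C) : periodicT (tpoly l c).
Proof.
  intros x y. induction l as [|i l [IH1 IH2]]; [now split|]. simpl.
  destruct (expi_periodic i x y) as [E1 E2]. now rewrite E1, E2, IH1, IH2.
Qed.

Lemma elementary_phase (i : Z * Z) : elementary (V := NR2) (fun _ => True) (phase i).
Proof.
  unfold phase. apply elementary_mult; [apply elementary_const|].
  apply elementary_plus; apply elementary_mult; try apply elementary_const; apply elementary_linear;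
  [apply is_linear_fst|apply is_linear_snd].
Qed.

Lemma elementary_tpoly (l : list (Z * Z)) (c : Z * Z -> C) :
  elementary (V := NR2) (fun _ => True) (fun q => fst (tpoly l c q)) /\
  elementary (V := NR2) (fun _ => True) (fun q => snd (tpoly l c q)).
Proof.
  induction l as [|i l [IH1 IH2]]; [split; apply (elementary_const (V := NR2) _ 0)|].
  assert (Ec := elementary_cos (V := NR2) _ _ (elementary_phase i)).
  assert (Es := elementary_sin (V := NR2) _ _ (elementary_phase i)).
  simpl. split.
  - apply elementary_plus; [|exact IH1].
    apply (elementary_plus (V := NR2) _ (fun q => fst (c i) * cos (phase i q))
      (fun q => - (snd (c i) * sin (phase i q)))).
    + apply elementary_mult; [apply elementary_const|exact Ec].
    (* The sign is moved into the constant, negation not being a constructor of [elementary]. *)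
    + apply (eq_ind (fun q => (- snd (c i)) * sin (phase i q))
        (fun g => elementary (V := NR2) (fun _ => True) g)).
      * apply elementary_mult; [apply elementary_const|exact Es].
      * apply functional_extensionality. intros q. ring.
  - apply elementary_plus; [|exact IH2].
    apply (elementary_plus (V := NR2) _ (fun q => fst (c i) * sin (phase i q))
      (fun q => snd (c i) * cos (phase i q)));
    (apply elementary_mult; [apply elementary_const|]); assumption.
Qed.

Lemma tpoly_smooth (l : list (Z * Z)) (c : Z * Z -> C) : smoothTC (tpoly l c).
Proof.
  destruct (elementary_tpoly l c) as [E1 E2].
  split; split.
  - intros x y. destruct (tpoly_periodic l c x y) as [A B]. now rewrite A, B.
  - apply (elementary_smooth (V := NR2)); [apply open_true|exact E1].
  - intros x y. destruct (tpoly_periodic l c x y) as [A B]. now rewrite A, B.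
  - apply (elementary_smooth (V := NR2)); [apply open_true|exact E2].
Qed.

(** As [phase i] is linear, [phase i v] is the rate at which the phase grows along [v]:
    differentiating multiplies the coefficient by the imaginary number [(0, phase i v)]. *)
Lemma is_derive_tpoly (l : list (Z * Z)) (c : Z * Z -> C) (q v : R * R) :
  let c' := fun i => (c i * (0%R, phase i v))%C in
  is_derive (fun t : R => fst (tpoly l c (fst q + t * fst v, snd q + t * snd v))) 0
    (fst (tpoly l c' q)) /\
  is_derive (fun t : R => snd (tpoly l c (fst q + t * fst v, snd q + t * snd v))) 0
    (snd (tpoly l c' q)).
Proof.
  intros c'. induction l as [|i l [IH1 IH2]].
  { split; simpl; auto_derive; trivial. }
  assert (P : forall t, phase i (fst q + t * fst v, snd q + t * snd v)
    = phase i q + t * phase i v).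
  { intros t. unfold phase. cbn [fst snd]. ring. }
  split.
  - apply (is_derive_plus (V := R_NormedModule)
      (fun t => fst (c i * expi i (fst q + t * fst v, snd q + t * snd v)%R)%C)); [|exact IH1].
    apply (is_derive_ext (fun t => fst (c i) * cos (phase i q + t * phase i v)
      - snd (c i) * sin (phase i q + t * phase i v))).
    { intros t. rewrite <- P. reflexivity. }
    auto_derive; [exact I|]. rewrite Rmult_0_l, Rplus_0_r. simpl. ring.
  - apply (is_derive_plus (V := R_NormedModule)
      (fun t => snd (c i * expi i (fst q + t * fst v, snd q + t * snd v)%R)%C)); [|exact IH2].
    apply (is_derive_ext (fun t => fst (c i) * sin (phase i q + t * phase i v)
      + snd (c i) * cos (phase i q + t * phase i v))).
    { intros t. rewrite <- P. reflexivity. }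
    auto_derive; [exact I|]. rewrite Rmult_0_l, Rplus_0_r. simpl. ring.
Qed.

Lemma ddir_tpoly (l : list (Z * Z)) (c : Z * Z -> C) (q v : R * R) :
  let c' := fun i => (c i * (0%R, phase i v))%C in
  ddir (fun q : R * R => fst (tpoly l c q)) q v = fst (tpoly l c' q) /\
  ddir (fun q : R * R => snd (tpoly l c q)) q v = snd (tpoly l c' q).
Proof.
  destruct q as [x y]. destruct v as [u w]. split; apply is_derive_unique.
  - exact (proj1 (is_derive_tpoly l c (x, y) (u, w))).
  - exact (proj2 (is_derive_tpoly l c (x, y) (u, w))).
Qed.

Lemma ddir_ext (f g : R * R -> R) (q v : R * R) :
  (forall m, f m = g m) -> ddir f q v = ddir g q v.
Proof. intros H. apply Derive_ext. intros t. apply H. Qed.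

Lemma ddir2_tpoly (l : list (Z * Z)) (c : Z * Z -> C) (q v : R * R) :
  let c'' := fun i => (RtoC (- phase i v ^ 2)%R * c i)%C in
  ddir (fun q : R * R => ddir (fun q : R * R => fst (tpoly l c q)) q v) q v
    = fst (tpoly l c'' q) /\
  ddir (fun q : R * R => ddir (fun q : R * R => snd (tpoly l c q)) q v) q v
    = snd (tpoly l c'' q).
Proof.
  intros c''.
  assert (E : tpoly l c'' q = tpoly l (fun i => (c i * (0%R, phase i v) * (0%R, phase i v))%C) q).
  { apply tpoly_ext. intros i _. unfold c''. apply C_ext; simpl; ring. }
  rewrite E. split.
  - rewrite (ddir_ext _ (fun q => fst (tpoly l (fun i => (c i * (0%R, phase i v))%C) q))).
    + exact (proj1 (ddir_tpoly l (fun i => (c i * (0%R, phase i v))%C) q v)).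
    + intros m. exact (proj1 (ddir_tpoly l c m v)).
  - rewrite (ddir_ext _ (fun q => snd (tpoly l (fun i => (c i * (0%R, phase i v))%C) q))).
    + exact (proj2 (ddir_tpoly l (fun i => (c i * (0%R, phase i v))%C) q v)).
    + intros m. exact (proj2 (ddir_tpoly l c m v)).
Qed.

Definition kz_lap (eps : R) (u : R * R -> R) (q : R * R) : R :=
  2 * (1 - eps ^ 2) / (1 + sqrt (1 - eps ^ 2))
  * (sqrt (1 - eps ^ 2) * ddx (ddx u) q + ddy (ddy u) q).

Lemma shifted_op_kz (eps : R) (lam : C) (f : R * R -> C) (q : R * R) :
  0 <= eps -> eps < 1 -> smoothTC f ->
  shifted_op (katok_ziller eps) lam f q =
  (- kz_lap eps (fun q => fst (f q)) q - (fst lam * fst (f q) - snd lam * snd (f q)),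
   - kz_lap eps (fun q => snd (f q)) q - (fst lam * snd (f q) + snd lam * fst (f q))).
Proof.
  intros H0 H1 [[_ S1] [_ S2]]. unfold shifted_op, kz_lap.
  rewrite !finsler_laplacian_kz by assumption.
  apply C_ext; simpl; ring.
Qed.

Definition eigval (eps : R) (i : Z * Z) : R := lambda_pq eps (fst i) (snd i).

Lemma shifted_op_tpoly (eps : R) (lam : C) (l : list (Z * Z)) (c : Z * Z -> C) (q : R * R) :
  0 <= eps -> eps < 1 ->
  shifted_op (katok_ziller eps) lam (tpoly l c) q =
  tpoly l (fun i => ((RtoC (eigval eps i) - lam) * c i)%C) q.
Proof.
  intros H0 H1. rewrite shifted_op_kz by (try assumption; apply tpoly_smooth).
  set (kap := 2 * (1 - eps ^ 2) / (1 + sqrt (1 - eps ^ 2))).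
  set (b := sqrt (1 - eps ^ 2)).
  assert (E : tpoly l (fun i => ((RtoC (eigval eps i) - lam) * c i)%C) q =
    (RtoC (- kap)%R * (RtoC b * tpoly l (fun i => (RtoC (- phase i (1, 0) ^ 2)%R * c i)%C) q
      + tpoly l (fun i => (RtoC (- phase i (0, 1) ^ 2)%R * c i)%C) q)
     + - lam * tpoly l c q)%C).
  { rewrite <- !tpoly_scal, <- tpoly_plus, <- tpoly_scal, <- tpoly_plus.
    apply tpoly_ext. intros i _. unfold eigval, lambda_pq, phase. cbn [fst snd].
    fold b. unfold kap. fold b. apply C_ext; simpl; unfold Rdiv; ring. }
  rewrite E. unfold kz_lap. fold kap b.
  destruct (ddir2_tpoly l c q (1, 0)) as [A1 A2]. destruct (ddir2_tpoly l c q (0, 1)) as [B1 B2].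
  rewrite A1, A2, B1, B2. apply C_ext; simpl; ring.
Qed.

(** * The real part of the Hermitian product and Parseval's identity *)

Definition rdot (f g : R * R -> C) : R :=
  sq_int (fun q => fst (f q) * fst (g q) + snd (f q) * snd (g q)).

Lemma contC_smooth (f : R * R -> C) : smoothTC f -> contC f.
Proof. intros [[_ S1] [_ S2]]. split; now apply cont2_smooth. Qed.

Lemma cont2_rdot (f g : R * R -> C) : contC f -> contC g ->
  cont2 (fun q => fst (f q) * fst (g q) + snd (f q) * snd (g q)).
Proof. intros [F1 F2] [G1 G2]. now apply cont2_plus; apply cont2_mult. Qed.

Ltac cont2_tac := repeat first [assumption | apply cont2_const | apply cont2_rdot
  | apply cont2_plus | apply cont2_mult].

Lemma contC_minus (f g : R * R -> C) : contC f -> contC g -> contC (fun q => f q - g q)%C.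
Proof. intros [F1 F2] [G1 G2]. split; now apply cont2_minus. Qed.

Lemma rdot_plus_r (f g h : R * R -> C) : contC f -> contC g -> contC h ->
  rdot f (fun q => g q + h q)%C = rdot f g + rdot f h.
Proof.
  intros Cf Cg Ch. unfold rdot. rewrite <- sq_int_plus by now apply cont2_rdot.
  apply sq_int_ext. intros q. simpl. ring.
Qed.

Lemma rdot_plus_sq (f g : R * R -> C) : contC f -> contC g ->
  rdot (fun q => f q + g q)%C (fun q => f q + g q)%C =
  rdot f f + 2 * rdot f g + rdot g g.
Proof.
  intros Cf Cg. unfold rdot. rewrite <- sq_int_scal by now apply cont2_rdot.
  rewrite <- !sq_int_plus by cont2_tac. apply sq_int_ext. intros q. simpl. ring.
Qed.

Lemma rdot_minus_sq (f g : R * R -> C) : contC f -> contC g ->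
  rdot (fun q => f q - g q)%C (fun q => f q - g q)%C =
  rdot f f - 2 * rdot f g + rdot g g.
Proof.
  intros Cf Cg. unfold rdot. replace (rdot f f - 2 * rdot f g + rdot g g) with
    (rdot f f + - 2 * rdot f g + rdot g g) by ring.
  unfold Rminus. rewrite Ropp_mult_distr_l, <- sq_int_scal by now apply cont2_rdot.
  rewrite <- !sq_int_plus by cont2_tac. apply sq_int_ext. intros q. simpl. ring.
Qed.

(** Holds pointwise in each component, the difference of the two sides being
    [(x - t * y) ^ 2 / t]. *)
Lemma rdot_young (f g : R * R -> C) (t : R) : contC f -> contC g -> 0 < t ->
  2 * rdot f g <= / t * rdot f f + t * rdot g g.
Proof.
  intros Cf Cg Ht. unfold rdot. rewrite <- !sq_int_scal by now apply cont2_rdot.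
  assert (S : forall s h k, contC h -> contC k -> cont2 (fun q => s *
    (fst (h q) * fst (k q) + snd (h q) * snd (k q)))).
  { intros s h k Ch Ck. apply cont2_mult; [apply cont2_const|now apply cont2_rdot]. }
  rewrite <- sq_int_plus by now apply S.
  apply sq_int_le; [now apply S|now apply cont2_plus; apply S|].
  intros q.
  assert (A : forall x y : R, 2 * (x * y) <= / t * (x * x) + t * (y * y)).
  { intros x y. assert (0 < / t) by now apply Rinv_0_lt_compat.
    assert (/ t * (x * x) + t * (y * y) - 2 * (x * y) = / t * (x - t * y) ^ 2) by (field; lra).
    specialize (pow2_ge_0 (x - t * y)). nra. }
  specialize (A (fst (f q)) (fst (g q))) as A1.
  specialize (A (snd (f q)) (snd (g q))) as A2. lra.
Qed.

Lemma rdot_le_sup (f : R * R -> C) (e : R) : contC f -> 0 <= e ->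
  (forall q, Rabs (fst (f q)) <= e /\ Rabs (snd (f q)) <= e) -> rdot f f <= 2 * e ^ 2.
Proof.
  intros Cf He H. rewrite <- (sq_int_const (2 * e ^ 2)). unfold rdot.
  apply sq_int_le; [now apply cont2_rdot|apply cont2_const|].
  assert (A : forall x, Rabs x <= e -> x * x <= e ^ 2).
  { intros x Hx. apply Rabs_le_between in Hx. nra. }
  intros q. destruct (H q) as [B1 B2]. apply A in B1. apply A in B2. lra.
Qed.

Lemma rdot_ge0 (f : R * R -> C) : contC f -> 0 <= rdot f f.
Proof.
  intros Cf. rewrite <- (sq_int_const 0). apply sq_int_le; [apply cont2_const|now apply cont2_rdot|].
  intros q. nra.
Qed.

(** Some component of [k] is nonzero, and in the corresponding variable the integrand has a periodic
    primitive; the case distinction selects that variable. *)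
Lemma sq_int_phase (k : Z * Z) (A B : R) : k <> (0, 0)%Z ->
  sq_int (fun q => A * cos (phase k q) + B * sin (phase k q)) = 0.
Proof.
  intros Hk. assert (P := PI_RGT_0). destruct (cont2_phase k) as [Cc Cs].
  assert (Cw : forall s t, cont2 (fun q => s * cos (phase k q) + t * sin (phase k q))).
  { intros s t. apply cont2_plus; apply cont2_mult; try assumption; apply cont2_const. }
  destruct (Z.eq_dec (fst k) 0) as [E|E].
  - assert (N : snd k <> 0%Z) by (intros N; apply Hk; destruct k; simpl in *; congruence).
    apply not_0_IZR in N.
    apply (sq_int_dy (fun q => / (2 * PI * IZR (snd k)) *
      (- B * cos (phase k q) + A * sin (phase k q)))).
    + intros x y. unfold phase. cbn [fst snd]. auto_derive; [exact I|]. field. lra.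
    + apply Cw.
    + intros x. assert (E1 : phase k (x, 1) = phase k (x, 0) + 2 * PI * IZR (snd k)).
      { unfold phase. cbn [fst snd]. ring. }
      rewrite E1. now rewrite (proj1 (cos_sin_2PI_IZR _ _)), (proj2 (cos_sin_2PI_IZR _ _)).
  - apply not_0_IZR in E.
    apply (sq_int_dx (fun q => / (2 * PI * IZR (fst k)) *
      (- B * cos (phase k q) + A * sin (phase k q)))).
    + intros x y. unfold phase. cbn [fst snd]. auto_derive; [exact I|]. field. lra.
    + apply cont2_mult; [apply cont2_const|apply Cw].
    + apply Cw.
    + intros y. assert (E1 : phase k (1, y) = phase k (0, y) + 2 * PI * IZR (fst k)).
      { unfold phase. cbn [fst snd]. ring. }
      rewrite E1. now rewrite (proj1 (cos_sin_2PI_IZR _ _)), (proj2 (cos_sin_2PI_IZR _ _)).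
Qed.

Lemma contC_exp (a : C) (i : Z * Z) : contC (fun q => a * expi i q)%C.
Proof.
  destruct (cont2_phase i) as [Cc Cs]. split.
  - apply cont2_minus; apply cont2_mult; try assumption; apply cont2_const.
  - apply cont2_plus; apply cont2_mult; try assumption; apply cont2_const.
Qed.

Lemma rdot_exp_neq (a b : C) (i j : Z * Z) : i <> j ->
  rdot (fun q => a * expi i q)%C (fun q => b * expi j q)%C = 0.
Proof.
  (* This is the real part of [a] times the conjugate of [b] times the exponential of frequency
     [i - j]. *)
  intros N. unfold rdot.
  rewrite (sq_int_ext _ (fun q =>
    (fst a * fst b + snd a * snd b) * cos (phase (fst i - fst j, snd i - snd j)%Z q) +
    (fst a * snd b - snd a * fst b) * sin (phase (fst i - fst j, snd i - snd j)%Z q))).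
  - apply sq_int_phase. intros E. injection E as E1 E2. apply N.
    destruct i, j; simpl in *; f_equal; lia.
  - intros q.
    assert (E : phase (fst i - fst j, snd i - snd j)%Z q = phase i q - phase j q).
    { unfold phase. cbn [fst snd]. rewrite !minus_IZR. ring. }
    rewrite E, cos_minus, sin_minus. simpl. ring.
Qed.

Lemma rdot_exp_sq (a : C) (i : Z * Z) :
  rdot (fun q => a * expi i q)%C (fun q => a * expi i q)%C = fst a ^ 2 + snd a ^ 2.
Proof.
  unfold rdot. rewrite (sq_int_ext _ (fun _ => fst a ^ 2 + snd a ^ 2)); [apply sq_int_const|].
  intros q. simpl.
  transitivity ((fst a ^ 2 + snd a ^ 2) * (cos (phase i q) ^ 2 + sin (phase i q) ^ 2));
    [ring|]. rewrite cos2_sin2. ring.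
Qed.

Lemma contC_tpoly (l : list (Z * Z)) (c : Z * Z -> C) : contC (tpoly l c).
Proof. apply contC_smooth, tpoly_smooth. Qed.

Lemma rdot_exp_tpoly (a : C) (i : Z * Z) (l : list (Z * Z)) (c : Z * Z -> C) : ~ In i l ->
  rdot (fun q => a * expi i q)%C (tpoly l c) = 0.
Proof.
  induction l as [|j l IH]; intros Hi.
  - unfold rdot. rewrite (sq_int_ext _ (fun _ => 0)); [apply sq_int_const|]. intros q. simpl. ring.
  - change (tpoly (j :: l) c) with (fun q => c j * expi j q + tpoly l c q)%C.
    rewrite rdot_plus_r by (apply contC_exp || apply contC_tpoly).
    rewrite rdot_exp_neq, IH; [ring| |].
    + intros H. apply Hi. now right.
    + intros ->. apply Hi. now left.
Qed.

Lemma rdot_tpoly_sq (l : list (Z * Z)) (c : Z * Z -> C) : NoDup l ->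
  rdot (tpoly l c) (tpoly l c) =
  fold_right (fun i s => fst (c i) ^ 2 + snd (c i) ^ 2 + s) 0 l.
Proof.
  induction 1 as [|i l Hi Hl IH].
  - unfold rdot. rewrite (sq_int_ext _ (fun _ => 0)); [apply sq_int_const|]. intros q. simpl. ring.
  - change (tpoly (i :: l) c) with (fun q => c i * expi i q + tpoly l c q)%C.
    rewrite rdot_plus_sq by (apply contC_exp || apply contC_tpoly).
    rewrite rdot_exp_sq, rdot_exp_tpoly, IH by exact Hi. simpl. ring.
Qed.

(** By Parseval the comparison of norms reduces to that of the coefficients, frequency by
    frequency. *)
Lemma rdot_tpoly_le (l : list (Z * Z)) (c c' : Z * Z -> C) (K : R) : NoDup l ->
  (forall i, K * (fst (c i) ^ 2 + snd (c i) ^ 2) <= fst (c' i) ^ 2 + snd (c' i) ^ 2) ->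
  K * rdot (tpoly l c) (tpoly l c) <= rdot (tpoly l c') (tpoly l c').
Proof.
  intros Hl H. rewrite !rdot_tpoly_sq by exact Hl.
  induction Hl as [|i l _ _ IH]; simpl; [lra|]. 
  rewrite Rmult_plus_distr_l. apply Rplus_le_compat; [apply H|exact IH].
Qed.

(** * The adjoint of the shifted operator and its lower bound *)

Lemma contC_shifted_op (eps : R) (lam : C) (f : R * R -> C) :
  0 <= eps -> eps < 1 -> smoothTC f -> contC (shifted_op (katok_ziller eps) lam f).
Proof.
  intros H0 H1 Sf. destruct (contC_smooth f Sf) as [C1 C2]. destruct (Sf) as [[_ S1] [_ S2]].
  assert (L : forall u, smooth_on (V := NR2) (fun _ => True) u -> cont2 (kz_lap eps u)).
  { intros u Su. apply cont2_mult; [apply cont2_const|].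
    apply cont2_plus; [apply cont2_mult; [apply cont2_const|]|]; apply cont2_smooth;
    do 2 apply (smooth_on_ddir (V := NR2)); exact Su. }
  split.
  - eapply cont2_ext; [intros q; symmetry; rewrite shifted_op_kz by assumption; reflexivity|].
    cbn [fst]. apply cont2_minus; [apply cont2_opp; now apply L|].
    apply cont2_minus; (apply cont2_mult; [apply cont2_const|assumption]).
  - eapply cont2_ext; [intros q; symmetry; rewrite shifted_op_kz by assumption; reflexivity|].
    cbn [snd]. apply cont2_minus; [apply cont2_opp; now apply L|].
    apply cont2_plus; (apply cont2_mult; [apply cont2_const|assumption]).
Qed.

(** The difference of the two sides is a combination of the four Green integrals, two for the real
    parts and two for the imaginary ones; the terms in [lam] cancel pointwise thanks to the
    conjugation. *)
Lemma shifted_op_adjoint (eps : R) (lam : C) (f h : R * R -> C) :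
  0 <= eps -> eps < 1 -> smoothTC f -> smoothTC h ->
  rdot (shifted_op (katok_ziller eps) lam f) h =
  rdot f (shifted_op (katok_ziller eps) (Cconj lam) h).
Proof.
  intros H0 H1 Sf Sh.
  assert (Cf := contC_smooth f Sf). assert (Ch := contC_smooth h Sh).
  assert (CPf := contC_shifted_op eps lam f H0 H1 Sf).
  assert (CPh := contC_shifted_op eps (Cconj lam) h H0 H1 Sh).
  set (b := sqrt (1 - eps ^ 2)).
  set (kap := 2 * (1 - eps ^ 2) / (1 + b)).
  apply Rminus_diag_uniq. unfold rdot.
  replace (sq_int (fun q => fst (shifted_op (katok_ziller eps) lam f q) * fst (h q) +
     snd (shifted_op (katok_ziller eps) lam f q) * snd (h q)) -
    sq_int (fun q => fst (f q) * fst (shifted_op (katok_ziller eps) (Cconj lam) h q) +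
     snd (f q) * snd (shifted_op (katok_ziller eps) (Cconj lam) h q)))
  with (sq_int (fun q => (fst (shifted_op (katok_ziller eps) lam f q) * fst (h q) +
     snd (shifted_op (katok_ziller eps) lam f q) * snd (h q)) + -1 *
     (fst (f q) * fst (shifted_op (katok_ziller eps) (Cconj lam) h q) +
     snd (f q) * snd (shifted_op (katok_ziller eps) (Cconj lam) h q)))).
  2:{ rewrite sq_int_plus, sq_int_scal; [ring| | |].
      - now apply cont2_rdot.
      - now apply cont2_rdot.
      - apply cont2_mult; [apply cont2_const|now apply cont2_rdot]. }
  destruct Sf as [T1 T2]. destruct Sh as [U1 U2].
  assert (G : forall u v, smoothT u -> smoothT v ->
    cont2 (fun q => ddx (ddx u) q * v q - u q * ddx (ddx v) q) /\
    cont2 (fun q => ddy (ddy u) q * v q - u q * ddy (ddy v) q)).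
  { intros u v [_ Su] [_ Sv]. split; apply cont2_minus; apply cont2_mult;
    apply cont2_smooth; try assumption; do 2 apply (smooth_on_ddir (V := NR2)); assumption. }
  destruct (G _ _ T1 U1) as [G1 G2]. destruct (G _ _ T2 U2) as [G3 G4].
  destruct (sq_int_green _ _ T1 U1) as [I1 I2]. destruct (sq_int_green _ _ T2 U2) as [I3 I4].
  assert (Z : forall (s t : R) (u v w k : R * R -> R), cont2 u -> cont2 v -> cont2 w ->
    cont2 k -> sq_int u = 0 -> sq_int v = 0 -> sq_int w = 0 -> sq_int k = 0 ->
    sq_int (fun q => s * u q + (t * v q + (s * w q + t * k q))) = 0).
  { intros s t u v w k Cu Cv Cw Ck Eu Ev Ew Ek.
    rewrite !sq_int_plus, !sq_int_scal by cont2_tac. rewrite Eu, Ev, Ew, Ek. ring. }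
  rewrite <- (Z (- kap * b) (- kap) _ _ _ _ G1 G2 G3 G4 I1 I2 I3 I4).
  apply sq_int_ext. intros q. rewrite !shifted_op_kz by (assumption || now split).
  unfold kz_lap. fold b. fold kap. cbn [fst snd Cconj]. ring.
Qed.

Lemma shifted_op_lower_bound (eps d : R) (lam : C) (f : R * R -> C) :
  0 <= eps -> eps < 1 -> smoothTC f -> 0 < d ->
  (forall i, d <= (eigval eps i - fst lam) ^ 2 + snd lam ^ 2) ->
  d * rdot f f <= rdot (shifted_op (katok_ziller eps) lam f)
                       (shifted_op (katok_ziller eps) lam f).
Proof.
  intros H0 H1 Sf Hd Hgap. assert (Cf := contC_smooth f Sf).
  assert (CPf := contC_shifted_op eps lam f H0 H1 Sf).
  apply le_epsilon. intros e He.
  (* Approximation within [r] costs [d * (2 * r ^ 2)] in the end; [r <= 1] bounds [r ^ 2] by [r],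
     and the second bound makes the cost at most [e]. *)
  set (r := Rmin 1 (e / (2 * d))).
  assert (Hr : 0 < r).
  { apply Rmin_glb_lt; [lra|]. apply Rdiv_lt_0_compat; lra. }
  assert (Hr1 : r <= 1) by apply Rmin_l.
  assert (Hr2 : d * (2 * r ^ 2) <= e).
  { assert (r <= e / (2 * d)) by apply Rmin_r.
    assert (r * (2 * d) <= e / (2 * d) * (2 * d)) by (apply Rmult_le_compat_r; lra).
    replace (e / (2 * d) * (2 * d)) with e in H2 by (field; lra). simpl. nra. }
  destruct (tpoly_approx f r Cf) as (l & c & Hl & HT); [|exact Hr|].
  { destruct Sf as [[P1 _] [P2 _]]. intros x y. split; apply C_ext; apply P1 || apply P2. }
  (* The conjugate appears because [h] has to solve the adjoint equation; the distance to the
     eigenvalues is the same, as they are real. *)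
  set (mu := fun i => (RtoC (eigval eps i) - Cconj lam)%C).
  assert (Hmu : forall i, mu i <> 0%C).
  { intros i E. specialize (Hgap i). apply (f_equal fst) in E as E1. apply (f_equal snd) in E as E2.
    unfold mu in E1, E2. simpl in E1, E2.
    replace (eigval eps i - fst lam) with 0 in Hgap by lra.
    replace (snd lam) with 0 in Hgap by lra. simpl in Hgap. lra. }
  set (h := tpoly l (fun i => (c i / mu i)%C)).
  assert (Ph : forall q, shifted_op (katok_ziller eps) (Cconj lam) h q = tpoly l c q).
  { intros q. unfold h. rewrite shifted_op_tpoly by assumption. apply tpoly_ext.
    intros i _. fold (mu i). field. apply Hmu. }
  assert (Sh : smoothTC h) by apply tpoly_smooth.
  assert (Hh : d * rdot h h <= rdot (tpoly l c) (tpoly l c)).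
  { apply rdot_tpoly_le; [exact Hl|]. intros i. specialize (Hgap i).
    replace (fst (c i) ^ 2 + snd (c i) ^ 2) with
      (((eigval eps i - fst lam) ^ 2 + snd lam ^ 2) *
       (fst (c i / mu i)%C ^ 2 + snd (c i / mu i)%C ^ 2)).
    - apply Rmult_le_compat_r; [|exact Hgap].
      specialize (pow2_ge_0 (fst (c i / mu i)%C)). specialize (pow2_ge_0 (snd (c i / mu i)%C)). lra.
    - replace (c i) with (mu i * (c i / mu i))%C at 3 by (field; apply Hmu).
      replace (c i) with (mu i * (c i / mu i))%C at 4 by (field; apply Hmu).
      set (w := (c i / mu i)%C). unfold mu. simpl. ring. }
  assert (A : rdot f (tpoly l c) = rdot (shifted_op (katok_ziller eps) lam f) h).
  { rewrite shifted_op_adjoint by assumption. apply sq_int_ext. intros q. now rewrite Ph. }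
  (* With parameter [d], Young's inequality bounds [2 * rdot f T] by [X / d + d * rdot h h], hence
     by [X / d + rdot T T], where [T] is [tpoly l c] and [X] the squared norm of the image of [f].
     Expanding the squared norm of [f - T], which is at most [2 * r ^ 2], cancels [rdot T T]. *)
  assert (Y := rdot_young _ h d CPf (contC_smooth h Sh) Hd).
  assert (M := rdot_minus_sq _ _ Cf (contC_tpoly l c)).
  assert (N : rdot (fun q => f q - tpoly l c q)%C (fun q => f q - tpoly l c q)%C <= 2 * r ^ 2).
  { apply rdot_le_sup; [apply contC_minus; [exact Cf|apply contC_tpoly]|lra|].
    intros q. destruct (HT q) as [B1 B2]. simpl.
    rewrite Rabs_minus_sym in B1. rewrite Rabs_minus_sym in B2. now split. }
  rewrite <- A in Y.
  set (X := rdot (shifted_op _ lam f) (shifted_op _ lam f)) in *.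
  assert (F : rdot f f <= / d * X + 2 * r ^ 2) by lra.
  assert (F2 : d * rdot f f <= d * (/ d * X + 2 * r ^ 2)) by (apply Rmult_le_compat_l; lra).
  replace (d * (/ d * X + 2 * r ^ 2)) with (X + d * (2 * r ^ 2)) in F2 by (field; lra). lra.
Qed.

(** * The spectrum *)

(** The volume density is constant, so the norm of the Finsler volume is a fixed multiple of the
    flat one and the estimates for [rdot] carry over. *)
Lemma L2norm_kz (eps : R) (f : R * R -> C) : 0 <= eps -> eps < 1 -> contC f ->
  L2norm (katok_ziller eps) f =
  sqrt (/ ((1 - eps ^ 2) * sqrt (1 - eps ^ 2))) * sqrt (rdot f f).
Proof.
  intros H0 H1 Cf. destruct (sqrt_one_minus_sq eps H0 H1) as [Hb _].
  assert (Ha := one_minus_sq_pos eps H0 H1).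
  set (rho := / ((1 - eps ^ 2) * sqrt (1 - eps ^ 2))).
  assert (Hr : 0 < rho) by (apply Rinv_0_lt_compat; nra).
  rewrite <- sqrt_mult_alt by lra. unfold L2norm. f_equal.
  unfold rdot. rewrite <- sq_int_scal by now apply cont2_rdot.
  unfold sq_int. apply RInt_ext. intros x _. apply RInt_ext. intros y _.
  rewrite (proj1 (angle_volume_kz eps H0 H1)). fold rho.
  unfold Cmod. rewrite pow2_sqrt by nra.
  change ((fst (f (x, y)) ^ 2 + snd (f (x, y)) ^ 2) * rho =
    rho * (fst (f (x, y)) * fst (f (x, y)) + snd (f (x, y)) * snd (f (x, y)))). ring.
Qed.

(** A minimum over finitely many integers, for an abstract [Q] closed under decreasing the bound.
    Keeping [Q] abstract allows one use inside another, for the two indices of the eigenvalues. *)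
Lemma uniform_lower_bound_Z (Q : Z -> R -> Prop) :
  (forall p d d', Q p d -> 0 < d' <= d -> Q p d') ->
  (forall p, exists d, 0 < d /\ Q p d) ->
  forall N : nat, exists d, 0 < d /\ forall p, (Z.abs p <= Z.of_nat N)%Z -> Q p d.
Proof.
  intros Hdown Hex N. induction N as [|N (d & Hd & IH)].
  - destruct (Hex 0%Z) as (d & Hd & HQ). exists d. split; [exact Hd|].
    intros p Hp. now replace p with 0%Z by lia.
  - destruct (Hex (Z.of_nat (S N))) as (d1 & Hd1 & HQ1).
    destruct (Hex (- Z.of_nat (S N))%Z) as (d2 & Hd2 & HQ2).
    assert (L1 := Rmin_l d (Rmin d1 d2)). assert (L2 := Rmin_r d (Rmin d1 d2)).
    assert (L3 := Rmin_l d1 d2). assert (L4 := Rmin_r d1 d2).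
    assert (L : 0 < Rmin d (Rmin d1 d2)) by (repeat apply Rmin_glb_lt; lra).
    exists (Rmin d (Rmin d1 d2)). split; [exact L|].
    intros p Hp. destruct (Z_le_gt_dec (Z.abs p) (Z.of_nat N)) as [G|G].
    + apply (Hdown p d); [now apply IH|lra].
    + destruct (Z.abs_eq_or_opp p) as [E|E].
      * replace p with (Z.of_nat (S N)) by lia. apply (Hdown _ d1); [exact HQ1|lra].
      * replace p with (- Z.of_nat (S N))%Z by lia. apply (Hdown _ d2); [exact HQ2|lra].
Qed.

(** A nonreal [lam] is kept away by its imaginary part. For real [lam], the eigenvalues with a large
    index exceed it by at least 1, and the remaining ones are finitely many and all different from
    it. *)
Lemma eigval_gap (eps : R) (lam : C) : 0 <= eps -> eps < 1 ->
  (forall p q : Z, lam <> RtoC (lambda_pq eps p q)) ->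
  exists d, 0 < d /\ forall i, d <= (eigval eps i - fst lam) ^ 2 + snd lam ^ 2.
Proof.
  intros H0 H1 Hne. destruct (sqrt_one_minus_sq eps H0 H1) as [Hb Hbb].
  assert (Ha := one_minus_sq_pos eps H0 H1). assert (HP := PI_RGT_0).
  destruct (Req_dec (snd lam) 0) as [E|E].
  2:{ exists (snd lam ^ 2). split; [now apply pow2_gt_0|]. intros i.
      specialize (pow2_ge_0 (eigval eps i - fst lam)). lra. }
  set (mu := fst lam) in *. rewrite E.
  assert (Hmu : forall p q, lambda_pq eps p q - mu <> 0).
  { intros p q Z. apply (Hne p q). apply C_ext; simpl; [fold mu; lra|exact E]. }
  set (b := sqrt (1 - eps ^ 2)) in *.
  assert (Hb1 : b <= 1) by nra.
  set (k := 4 * PI ^ 2 * (2 * (1 - eps ^ 2) / (1 + b))).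
  assert (Hk : 0 < k).
  { apply Rmult_lt_0_compat; [nra|]. apply Rdiv_lt_0_compat; lra. }
  assert (Hkb : 0 < k * b) by now apply Rmult_lt_0_compat.
  (* As [b <= 1], an eigenvalue is at least [k * b * (p ^ 2 + q ^ 2)]; an index beyond [N] in
     absolute value has square at least [N + 1], which pushes this above [Rabs mu + 1]. *)
  destruct (nfloor_ex ((Rabs mu + 1) / (k * b))) as [N HN].
  { apply Rmult_le_pos; [specialize (Rabs_pos mu); lra|]. now apply Rlt_le, Rinv_0_lt_compat. }
  assert (HN' : Rabs mu + 1 <= k * b * (INR N + 1)).
  { assert ((Rabs mu + 1) / (k * b) * (k * b) <= (INR N + 1) * (k * b))
      by (apply Rmult_le_compat_r; lra).
    replace ((Rabs mu + 1) / (k * b) * (k * b)) with (Rabs mu + 1) in H by (field; lra). lra. }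
  assert (Far : forall p q, (Z.of_nat N < Z.abs p \/ Z.of_nat N < Z.abs q)%Z ->
    1 <= lambda_pq eps p q - mu).
  { intros p q Hpq.
    assert (S : forall n, (Z.of_nat N < Z.abs n)%Z -> INR N + 1 <= IZR n ^ 2).
    { intros n Hn. assert (Z.of_nat N + 1 <= n * n)%Z by nia.
      apply IZR_le in H. rewrite plus_IZR, mult_IZR, <- INR_IZR_INZ in H.
      simpl. lra. }
    assert (Pp := pow2_ge_0 (IZR p)). assert (Pq := pow2_ge_0 (IZR q)).
    assert (A : INR N + 1 <= IZR p ^ 2 + IZR q ^ 2).
    { destruct Hpq as [G|G]; apply S in G; lra. }
    assert (B : k * b * (INR N + 1) <= k * b * (IZR p ^ 2 + IZR q ^ 2))
      by (apply Rmult_le_compat_l; lra).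
    assert (D : k * b * (IZR p ^ 2 + IZR q ^ 2) <= lambda_pq eps p q).
    { unfold lambda_pq. fold b. fold k. rewrite Rmult_assoc.
      apply Rmult_le_compat_l; [lra|]. nra. }
    specialize (Rle_abs mu). lra. }
  destruct (uniform_lower_bound_Z (fun p d => forall q, (Z.abs q <= Z.of_nat N)%Z ->
    d <= (lambda_pq eps p q - mu) ^ 2)) with (N := N) as (d & Hd & HQ).
  { intros p d d' H Hd' q Hq. specialize (H q Hq). lra. }
  { intros p. apply (uniform_lower_bound_Z (fun q d => d <= (lambda_pq eps p q - mu) ^ 2)).
    - intros q d d' H Hd'. lra.
    - intros q. exists ((lambda_pq eps p q - mu) ^ 2). split; [|lra].
      now apply pow2_gt_0. }
  exists (Rmin d 1). split; [apply Rmin_glb_lt; lra|].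
  intros [p q]. unfold eigval. cbn [fst snd].
  assert (L1 := Rmin_l d 1). assert (L2 := Rmin_r d 1).
  destruct (Z_le_gt_dec (Z.abs p) (Z.of_nat N)) as [G|G].
  - destruct (Z_le_gt_dec (Z.abs q) (Z.of_nat N)) as [G'|G'].
    + specialize (HQ p G q G'). lra.
    + assert (F := Far p q ltac:(lia)). nra.
  - assert (F := Far p q ltac:(lia)). nra.
Qed.

Lemma regular_value_kz (eps : R) (lam : C) : 0 <= eps -> eps < 1 ->
  (forall p q : Z, lam <> RtoC (lambda_pq eps p q)) ->
  regular_value (katok_ziller eps) lam.
Proof.
  intros H0 H1 Hne. destruct (eigval_gap eps lam H0 H1 Hne) as (d & Hd & Hgap).
  destruct (sqrt_one_minus_sq eps H0 H1) as [Hb _].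
  assert (Ha := one_minus_sq_pos eps H0 H1).
  assert (Hr : 0 < / ((1 - eps ^ 2) * sqrt (1 - eps ^ 2))) by (apply Rinv_0_lt_compat; nra).
  apply sqrt_lt_R0 in Hr. split.
  - exists (sqrt d). split; [now apply sqrt_lt_R0|]. intros f Sf.
    rewrite !L2norm_kz by
      (assumption || (now apply contC_smooth) || (now apply contC_shifted_op)).
    set (r := sqrt (/ _)) in *.
    assert (B := shifted_op_lower_bound eps d lam f H0 H1 Sf Hd Hgap).
    apply sqrt_le_1_alt in B. rewrite sqrt_mult_alt in B by apply Rlt_le, Hd.
    rewrite <- Rmult_assoc, (Rmult_comm (sqrt d)), Rmult_assoc.
    apply Rmult_le_compat_l; [now apply Rlt_le|exact B].
  - intros g Sg e He. assert (Cg := contC_smooth g Sg).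
    set (r := sqrt (/ _)) in *.
    (* A uniform error [e'] in both components has norm at most [2 * r * e'], that is [e / 2], which
       leaves room for the strict inequality. *)
    set (e' := e / (4 * r)).
    assert (He' : 0 < e') by (apply Rdiv_lt_0_compat; lra).
    destruct (tpoly_approx g e' Cg) as (l & c & Hl & HT); [|exact He'|].
    { destruct Sg as [[P1 _] [P2 _]]. intros x y. split; apply C_ext; apply P1 || apply P2. }
    set (mu := fun i => (RtoC (eigval eps i) - lam)%C).
    assert (Hmu : forall i, mu i <> 0%C).
    { intros i E. apply (Hne (fst i) (snd i)). fold (eigval eps i).
      transitivity (RtoC (eigval eps i) - mu i)%C; [unfold mu; ring|]. rewrite E. ring. }
    exists (tpoly l (fun i => (c i / mu i)%C)). split; [apply tpoly_smooth|].
    set (D := fun q => (tpoly l c q - g q)%C).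
    replace (fun q => (shifted_op _ _ _ _ - g q)%C) with D.
    2:{ apply functional_extensionality. intros q. unfold D.
        rewrite shifted_op_tpoly by assumption. f_equal. apply tpoly_ext.
        intros i _. fold (mu i). field. apply Hmu. }
    assert (CD : contC D) by (apply contC_minus; [apply contC_tpoly|exact Cg]).
    rewrite L2norm_kz by assumption. fold r.
    assert (B := rdot_le_sup D e' CD (Rlt_le _ _ He') HT).
    assert (B2 : sqrt (rdot D D) <= 2 * e').
    { rewrite <- (sqrt_pow2 (2 * e')) by lra. apply sqrt_le_1_alt. nra. }
    apply Rle_lt_trans with (r * (2 * e')); [apply Rmult_le_compat_l; lra|].
    unfold e'. replace (r * (2 * (e / (4 * r)))) with (e / 2) by (field; lra). lra.
Qed.

(** The lower bound forces an eigenfunction to have norm zero, and a continuous function of norm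
    zero vanishes on the closed unit square, hence everywhere by periodicity. *)
Lemma eigenvalue_not_regular (eps : R) (lam : C) : 0 <= eps -> eps < 1 ->
  eigenvalue (katok_ziller eps) lam -> ~ regular_value (katok_ziller eps) lam.
Proof.
  intros H0 H1 (f & Sf & [[x y] Hq] & HP) [(c & Hc & HB) _].
  assert (Cf := contC_smooth f Sf).
  destruct (sqrt_one_minus_sq eps H0 H1) as [Hb _].
  assert (Ha := one_minus_sq_pos eps H0 H1).
  assert (Hr : 0 < / ((1 - eps ^ 2) * sqrt (1 - eps ^ 2))) by (apply Rinv_0_lt_compat; nra).
  apply sqrt_lt_R0 in Hr.
  specialize (HB f Sf).
  rewrite !L2norm_kz in HB by
    (assumption || now apply contC_shifted_op).
  set (r := sqrt (/ _)) in *.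
  assert (Z : rdot (shifted_op (katok_ziller eps) lam f) (shifted_op (katok_ziller eps) lam f) = 0).
  { unfold rdot. rewrite (sq_int_ext _ (fun _ => 0)); [apply sq_int_const|].
    intros q. rewrite HP. simpl. ring. }
  rewrite Z, sqrt_0 in HB.
  assert (Hs := sqrt_pos (rdot f f)).
  assert (Hs0 : sqrt (rdot f f) = 0).
  { destruct Hs as [Hs|Hs]; [|now symmetry].
    assert (0 < c * (r * sqrt (rdot f f))) by (repeat apply Rmult_lt_0_compat; assumption).
    lra. }
  apply sqrt_eq_0 in Hs0; [|now apply rdot_ge0].
  destruct (floor_exists x) as [m Hm]. destruct (floor_exists y) as [n Hn].
  assert (E : fst (f (x - IZR m, y - IZR n)) * fst (f (x - IZR m, y - IZR n)) +
    snd (f (x - IZR m, y - IZR n)) * snd (f (x - IZR m, y - IZR n)) = 0).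
  { apply (sq_int_eq0 (fun q => fst (f q) * fst (f q) + snd (f q) * snd (f q))).
    - now apply cont2_rdot.
    - intros q. nra.
    - exact Hs0.
    - lra.
    - lra. }
  assert (Pf : periodicT f).
  { destruct Sf as [[P1 _] [P2 _]]. intros u v. split; apply C_ext; apply P1 || apply P2. }
  assert (Ef := periodicT_IZR f Pf x y (- m) (- n)). rewrite !opp_IZR in Ef.
  fold (Rminus x (IZR m)) (Rminus y (IZR n)) in Ef. rewrite Ef in E.
  apply Hq. apply C_ext; simpl; nra.
Qed.

Lemma eigenvalue_kz (eps : R) (p q : Z) : 0 <= eps -> eps < 1 ->
  eigenvalue (katok_ziller eps) (RtoC (lambda_pq eps p q)).
Proof.
  intros H0 H1. exists (tpoly ((p, q) :: nil) (fun _ => 1%C)).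
  split; [apply tpoly_smooth|split].
  - exists (0, 0). intros E. apply (f_equal fst) in E. simpl in E.
    unfold phase in E. simpl in E.
    replace (2 * PI * (IZR p * 0 + IZR q * 0)) with 0 in E by ring.
    rewrite cos_0, sin_0 in E. lra.
  - intros m. rewrite shifted_op_tpoly by assumption. simpl.
    unfold eigval. cbn [fst snd]. ring.
Qed.

Theorem theorem3p2p6 (eps : R) (heps0 : 0 <= eps) (heps1 : eps < 1) :
  finsler (katok_ziller eps) /\
  (forall f : R * R -> R, smoothT f -> forall x y : R,
     finsler_laplacian (katok_ziller eps) f (x, y) =
     2 * (1 - eps ^ 2) / (1 + sqrt (1 - eps ^ 2))
     * (sqrt (1 - eps ^ 2) * Derive_n (fun s => f (s, y)) 2 x
        + Derive_n (fun s => f (x, s)) 2 y)) /\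
  (forall lam : C,
     spectrum (katok_ziller eps) lam <->
     exists p q : Z, lam = RtoC (lambda_pq eps p q)) /\
  (forall lam : C,
     eigenvalue (katok_ziller eps) lam <->
     exists p q : Z, lam = RtoC (lambda_pq eps p q)).
Proof.
  (* The equivalences come from one cycle: each [lambda_pq] is an eigenvalue, each eigenvalue is in
     the spectrum, and each point of the spectrum is some [lambda_pq]. The last implication is
     classical, the spectrum being defined by a negation. *)
  assert (Spec : forall lam, spectrum (katok_ziller eps) lam ->
    exists p q : Z, lam = RtoC (lambda_pq eps p q)).
  { intros lam Hs. apply Classical_Prop.NNPP. intros Hne. apply Hs.
    apply regular_value_kz; try assumption. intros p q E. apply Hne. now exists p, q. }
  split; [|split; [|split]].
  - now apply katok_ziller_finsler.
  - intros f [_ Sf] x y. rewrite smooth_Derive2_x, smooth_Derive2_y by exact Sf.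
    now apply finsler_laplacian_kz.
  - intros lam. split; [apply Spec|]. intros (p & q & ->).
    apply eigenvalue_not_regular; try assumption. now apply eigenvalue_kz.
  - intros lam. split.
    + intros He. apply Spec. now apply eigenvalue_not_regular.
    + intros (p & q & ->). now apply eigenvalue_kz.
Qed.
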